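(* Let $V$ be a strongly regular holomorphic VOA of CFT-type with central charge $24$ and $V_1\ne 0$, let $\mathcal H$ be a subspace of a Cartan subalgebra of $V_1$, and let $\alpha\in\mathcal H$ be such that $g=\exp(2\pi i\alpha(0))$ has finite order $N$ on $V$, the eigenvalues of $N\alpha(0)$ on $V$ generate the ideal $\mathbb Z$, and $K=N\langle\alpha,\alpha\rangle/2\in\mathbb Z$. Put $R=(N,K)$, $N_0=N/R$, $K_0=K/R$. Let $U=\mathrm{Comm}(M(\mathcal H),V)$, let $L\subset\mathcal H$ be the even lattice with $\mathrm{Comm}(U,V)\cong V_L$, and let $\tilde L$ be the even lattice with $\mathrm{Comm}(U^{[\alpha]},V^{[\alpha]})\cong V_{\tilde L}$, where $U^{[\alpha]}=\mathrm{Comm}(M(\widehat{\mathcal H}),V^{[\alpha]})$. Suppose $N_0\alpha\in L^*$. Then $\bar L=L$ and $$\mathrm{Comm}(M(\widehat{\mathcal H}),V^{[\alpha]})=\bigoplus_{m=0}^{R-1}U(mN_0\alpha).$$ Moreover, $\tilde L=L^{[\alpha]}+\mathbb ZN_0\alpha$.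
   Context: For $v\in V$ write $Y(v,z)=\sum_n v(n)z^{-n-1}$ (also $v_n=v(n)$). $V_1$ carries the form $u(1)v=\langle u,v\rangle\mathbf 1$. $\mathrm{Comm}(W,V)=\{v\in V: u(m)v=0\ \forall u\in W,\,m\ge 0\}$; $M(\mathcal H)$ denotes the Heisenberg subVA generated by $\mathcal H$. $(N,K)$ is the gcd. Lattices: $\mathbb C\otimes L=\mathcal H$ with the form $\langle\cdot,\cdot\rangle$, $L^*$ is the dual lattice, and $V=\bigoplus_{u+L\in L^*/L}V_{u+L}\otimes U(u)$ as a $V_L\otimes U$-module, which defines the $U$-modules $U(u)$ ($U(0)=U$; $U(u)\cong U(v)$ if $u-v\in L$). $\bar L=\{u\in L:\langle u,N_0\alpha\rangle\in\mathbb Z\}$. For $u\in\bar L$, $u^{[\alpha]}=u-m\alpha$, where $0\le m\le N_0-1$ and $\langle u,N_0\alpha\rangle\equiv mK_0 \pmod {N_0}$; $\bar L^{[\alpha]}=\{u^{[\alpha]}:u\in\bar L\}$, written $L^{[\alpha]}$ when $\bar L=L$. Lorentzian construction: $\Pi_{1,1}=\mathbb Zr+\mathbb Zq$, $\langle r,r\rangle=\langle q,q\rangle=0$, $\langle r,q\rangle=-1$; elements $\beta+ar+bq$ of $\mathcal H\oplus\mathbb C\Pi_{1,1}\subseteq(V\otimes V_{\Pi_{1,1}})_1$ are written $(\beta,a,b)$. Put $\rho=(\alpha,1,K/N)$, $J=\mathrm{Comm}(M(\rho),V\otimes V_{\Pi_{1,1}})$, $P=\sum_{j\ge1}\rho(-j)J+(\mathbf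 1-e^{N\rho})_{-1}J$ (an ideal of $J$) and $V^{[\alpha]}=J/P$. $\widehat{\mathcal H}=\{\widehat\beta=(\beta,0,\langle\beta,\alpha\rangle):\beta\in\mathcal H\}$ embeds in $V^{[\alpha]}_1$ and is identified isometrically with $\mathcal H$ via $\widehat\beta\leftrightarrow\beta$; thus $L$ and $\tilde L$ are both viewed in $\mathcal H$, and $U$ is identified with $U\otimes e^{(0,0)}\subseteq V^{[\alpha]}$. *)

(* Defs.v *)
From HB Require Import structures.
From mathcomp Require Import all_boot all_order all_algebra.
From mathcomp Require Import all_classical all_reals.
From mathcomp Require Import trigo.
From mathcomp Require Import complex.

Set Implicit Arguments.
Unset Strict Implicit.
Unset Printing Implicit Defensive.

Import Order.TTheory GRing.Theory Num.Theory.
Local Open Scope classical_set_scope.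
Local Open Scope ring_scope.
Local Open Scope complex_scope.

(** ** Linear algebra in possibly infinite dimension *)

Definition is_int (C : numFieldType) (z : C) : Prop := exists k : int, z = k%:~R.

Definition subspace (C : numFieldType) (M : lmodType C) (S : set M) : Prop :=
  S 0 /\ forall (c : C) x y, S x -> S y -> S (c *: x + y).

Definition linear_on (C : numFieldType) (M M' : lmodType C) (S : set M)
    (f : M -> M') : Prop :=
  forall (c : C) x y, S x -> S y -> f (c *: x + y) = c *: f x + f y.

Definition lspan (C : numFieldType) (M : lmodType C) (A : set M) : set M :=
  [set x | exists (n : nat) (c : 'I_n -> C) (v : 'I_n -> M),
     (forall i, A (v i)) /\ x = \sum_(i < n) c i *: v i].

Definition lin_indep (C : numFieldType) (M : lmodType C) (n : nat)
    (v : 'I_n -> M) : Prop :=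
  forall c : 'I_n -> C, \sum_(i < n) c i *: v i = 0 -> forall i, c i = 0.

Definition finite_dim (C : numFieldType) (M : lmodType C) (S : set M) : Prop :=
  exists (n : nat) (b : 'I_n -> M), S `<=` lspan (range b).

(* [f], restricted to the indices in [D], is a basis of the subspace [S]. *)
Definition hamel_basis (C : numFieldType) (M : lmodType C) (I : eqType)
    (D : set I) (f : I -> M) (S : set M) : Prop :=
  [/\ S = lspan (f @` D)
    & forall (s : seq I) (c : I -> C), uniq s -> (forall i, i \in s -> D i) ->
        \sum_(i <- s) c i *: f i = 0 -> forall i, i \in s -> c i = 0].

(* [S] is the internal direct sum of the subspaces [W i], [i] in [D]. *)
Definition direct_sum_of (C : numFieldType) (M : lmodType C) (I : eqType)
    (D : set I) (W : I -> set M) (S : set M) : Prop :=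
  [/\ forall i, D i -> subspace (W i),
      forall i, D i -> W i `<=` S,
      forall x, S x -> exists (s : seq I) (f : I -> M),
        (forall i, i \in s -> D i /\ W i (f i)) /\ x = \sum_(i <- s) f i
    & forall (s : seq I) (f : I -> M), uniq s ->
        (forall i, i \in s -> D i /\ W i (f i)) ->
        \sum_(i <- s) f i = 0 -> forall i, i \in s -> f i = 0].

Definition bilinear (C : numFieldType) (M M' T : lmodType C)
    (t : M -> M' -> T) : Prop :=
  (forall y, linear (fun x => t x y)) /\ (forall x, linear (t x)).

(* The linear map M (x) M' -> T induced by the bilinear map [t] is injective. *)
Definition tensor_injective (C : numFieldType) (M M' T : lmodType C)
    (t : M -> M' -> T) : Prop :=
  forall (n : nat) (x : 'I_n -> M) (y : 'I_n -> M'), lin_indep x ->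
    \sum_(i < n) t (x i) (y i) = 0 -> forall i, y i = 0.

Definition tensor_image (C : numFieldType) (M M' T : lmodType C)
    (t : M -> M' -> T) : set T :=
  lspan [set z | exists x y, z = t x y].

(** ** Vertex algebras and modules *)

(* The generalized binomial coefficient, for an integer upper index. *)
Definition binz (C : numFieldType) (p : int) (i : nat) : C :=
  (\prod_(j < i) (p - j%:Z)%:~R) / i`!%:R.

(* The Borcherds identity.  By truncation all but finitely many terms of the
   three infinite sums vanish, so equality of the sums is equality of all large
   enough partial sums. *)
Definition borcherds (C : numFieldType) (V M : lmodType C)
    (prod : V -> int -> V -> V) (act : V -> int -> M -> M) (S : set V) : Prop :=
  forall a b x (p q r : int), S a -> S b -> exists k0 : nat,
    forall k : nat, (k0 <= k)%N ->
    \sum_(i < k) binz C p i *: act (prod a (r + i%:Z) b) (p + q - i%:Z) x =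
    \sum_(i < k) ((-1) ^+ i * binz C r i) *:
      (act a (p + r - i%:Z) (act b (q + i%:Z) x)
       - (-1) ^ r *: act b (q + r - i%:Z) (act a (p + i%:Z) x)).

(* [nprod u n v] = u(n)v is the coefficient of z^(-n-1) in Y(u,z)v. *)
Record vertexAlgebra (C : numFieldType) := VertexAlgebra {
  va_sort :> lmodType C;
  vac : va_sort;
  nprod : va_sort -> int -> va_sort -> va_sort;
  va_linl : forall n v, linear (fun u => nprod u n v);
  va_linr : forall u n, linear (nprod u n);
  va_trunc : forall u v, exists n0 : int, forall n, n0 <= n -> nprod u n v = 0;
  va_vacl : forall n v, nprod vac n v = if n == -1 then v else 0;
  va_vacr : forall u, nprod u (-1) vac = u;
  va_creat : forall u n, 0 <= n -> nprod u n vac = 0;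
  va_borcherds : borcherds nprod nprod setT }.

Arguments vac {C} _.
Arguments nprod {C _}.

Definition subva (C : numFieldType) (V : vertexAlgebra C) (S : set V) : Prop :=
  [/\ subspace S, S (vac V) & forall u n v, S u -> S v -> S (nprod u n v)].

Definition generated_va (C : numFieldType) (V : vertexAlgebra C) (A : set V)
    : set V :=
  [set v | forall S, subva S -> A `<=` S -> S v].

Definition Comm (C : numFieldType) (V : vertexAlgebra C) (W : set V) : set V :=
  [set v | forall u (m : int), W u -> 0 <= m -> nprod u m v = 0].

(* Weak modules over a vertex subalgebra [S] of [V]; [vact a] is meaningful
   only for [a] in [S]. *)
Record vmodule (C : numFieldType) (V : vertexAlgebra C) (S : set V) := VModule {
  vm_sort :> lmodType C;
  vact : V -> int -> vm_sort -> vm_sort;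
  vm_linl : forall n x, linear_on S (fun a => vact a n x);
  vm_linr : forall a n, S a -> linear (vact a n);
  vm_trunc : forall a x, S a ->
    exists n0 : int, forall n, n0 <= n -> vact a n x = 0;
  vm_vac : forall n x, vact (vac V) n x = if n == -1 then x else 0;
  vm_borcherds : borcherds nprod vact S }.

Arguments vact {C V S _}.

Lemma linear_linear_on (C : numFieldType) (M M' : lmodType C) (S : set M)
  (f : M -> M') : linear f -> linear_on S f.
Proof. by move=> lf c x y _ _; exact: lf. Qed.

Definition adjoint_module (C : numFieldType) (V : vertexAlgebra C)
    : vmodule (@setT V) :=
  @VModule C V setT V nprod
    (fun n x => linear_linear_on (va_linl n x))
    (fun a n _ => va_linr a n) (fun a x _ => va_trunc a x)
    (@va_vacl C V) (@va_borcherds C V).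

Definition submodule (C : numFieldType) (V : vertexAlgebra C) (S : set V)
    (M : vmodule S) (W : set M) : Prop :=
  subspace W /\ forall a n x, S a -> W x -> W (vact a n x).

Definition irreducible_sub (C : numFieldType) (V : vertexAlgebra C)
    (S : set V) (M : vmodule S) (W : set M) : Prop :=
  [/\ submodule W, exists2 x, W x & x <> 0
    & forall W' : set M, submodule W' -> W' `<=` W ->
        W' = [set 0] \/ W' = W].

Definition module_iso (C : numFieldType) (V : vertexAlgebra C) (S : set V)
    (M M' : vmodule S) : Prop :=
  exists f : M -> M',
    [/\ linear f, bijective f
      & forall a n x, S a -> f (vact a n x) = vact a n (f x)].

(** ** Vertex operator algebras *)

Definition virasoro_op (C : numFieldType) (V : vertexAlgebra C) (w : V)
    (n : int) : V -> V := nprod w (n + 1).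

Definition weight_space (C : numFieldType) (V : vertexAlgebra C) (w : V)
    (n : int) : set V :=
  [set v | virasoro_op w 0 v = n%:~R *: v].

Record voa (C : numFieldType) := Voa {
  voa_va :> vertexAlgebra C;
  omega : voa_va;
  central_charge : C;
  voa_virasoro : forall (m n : int) v,
    virasoro_op omega m (virasoro_op omega n v)
    - virasoro_op omega n (virasoro_op omega m v)
    = (m - n)%:~R *: virasoro_op omega (m + n) v
      + (if m + n == 0 then ((m ^+ 3 - m)%:~R / 12 * central_charge) *: v
         else 0);
  voa_derivative : forall a (n : int) v,
    nprod (virasoro_op omega (-1) a) n v = - n%:~R *: nprod a (n - 1) v;
  voa_grading : direct_sum_of setT (weight_space omega) setT;
  voa_finite : forall n, finite_dim (weight_space omega n);
  voa_bounded : exists n0 : int, forall n, n < n0 ->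
    weight_space omega n = [set 0] }.

Arguments omega {C} _.

Definition Lop (C : numFieldType) (V : voa C) (n : int) : V -> V :=
  virasoro_op (omega V) n.

Definition wt (C : numFieldType) (V : voa C) (n : int) : set V :=
  weight_space (omega V) n.

Arguments Lop {C} V n.
Arguments wt {C} V n.

Definition cft_type (C : numFieldType) (V : voa C) : Prop :=
  (forall n : int, n < 0 -> wt V n = [set 0]) /\ wt V 0 = lspan [set vac V].

Definition C2_cofinite (C : numFieldType) (V : voa C) : Prop :=
  exists (n : nat) (b : 'I_n -> V),
    lspan (range b `|` [set x | exists u v : V, x = nprod u (-2) v]) = setT.

(* The N-grading of an admissible (sub)module. *)
Definition admissible_sub (C : numFieldType) (V : voa C)
    (M : vmodule (@setT V)) (W : set M) : Prop :=
  exists G : int -> set M,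
    [/\ direct_sum_of setT G W, forall n : int, n < 0 -> G n = [set 0]
      & forall (k m n : int) a x, wt V k a -> G n x ->
          G (k + n - m - 1) (vact a m x)].

Definition rational (C : numFieldType) (V : voa C) : Prop :=
  forall M : vmodule (@setT V), admissible_sub (@setT M) ->
    exists (I : eqType) (W : I -> set M),
      direct_sum_of setT W setT /\
      forall i, irreducible_sub (W i) /\ admissible_sub (W i).

Definition holomorphic (C : numFieldType) (V : voa C) : Prop :=
  irreducible_sub (@setT (adjoint_module V)) /\
  forall M : vmodule (@setT V),
    irreducible_sub (@setT M) -> admissible_sub (@setT M) ->
    module_iso M (adjoint_module V).

Definition restricted_dual (C : numFieldType) (V : voa C) (phi : V -> C)
    : Prop :=
  (forall c x y, phi (c *: x + y) = c * phi x + phi y) /\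
  exists s : seq int, forall n, n \notin s -> forall v, wt V n v -> phi v = 0.

(* V is isomorphic, as a V-module, to its contragredient V', on which
   <Y'(a,z)phi, v> = <phi, Y(e^(z L(1)) (-z^-2)^(L(0)) a, z^-1) v>.
   The sum over [i] below is finite since L(1)^i a = 0 for large i. *)
Definition self_dual (C : numFieldType) (V : voa C) : Prop :=
  exists Phi : V -> V -> C,
    [/\ forall x, restricted_dual (Phi x),
        forall c x y v, Phi (c *: x + y) v = c * Phi x v + Phi y v,
        forall x, (forall v, Phi x v = 0) -> x = 0,
        forall phi, restricted_dual phi -> exists x, Phi x = phi
      & forall (k n : int) a x v, wt V k a -> exists i0 : nat,
          forall i1 : nat, (i0 <= i1)%N ->
          Phi (nprod a n x) v =
          (-1) ^ k * \sum_(i < i1) i`!%:R^-1 *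
            Phi x (nprod (iter i (Lop V 1) a) (k *+ 2 - n - i%:Z - 2) v)].

Definition strongly_regular (C : numFieldType) (V : voa C) : Prop :=
  [/\ rational V, C2_cofinite V, cft_type V & self_dual V].

(* The form on V_1 given by u(1)v = <u,v> 1. *)
Definition voa_form (C : numFieldType) (V : voa C) (u v : V) : C :=
  xget 0 [set c : C | nprod u 1 v = c *: vac V].

Arguments voa_form {C} V u v.

Fixpoint lower_central (C : numFieldType) (V : voa C) (A : set V) (k : nat)
    : set V :=
  if k is k'.+1 then
    lspan [set x | exists a b, [/\ A a, lower_central A k' b & x = nprod a 0 b]]
  else A.

(* Nilpotent self-normalizing subalgebras of V_1 with bracket u(0)v. *)
Definition cartan_subalgebra (C : numFieldType) (V : voa C) (A : set V)
    : Prop :=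
  [/\ subspace A, A `<=` wt V 1,
      forall a b, A a -> A b -> A (nprod a 0 b),
      exists k, lower_central A k `<=` [set 0]
    & forall x, wt V 1 x -> (forall a, A a -> A (nprod x 0 a)) -> A x].

(** ** Even lattices, lattice vertex algebras and their modules *)

(* A lattice is a subset [L] of a complex vector space [X] carrying a form
   [frm]; its complexification C (x) L is [lspan L]. *)

Definition zbasis (C : numFieldType) (X : lmodType C) (L : set X) (d : nat)
    (b : 'I_d -> X) : Prop :=
  lin_indep b /\
  L = [set x | exists n : 'I_d -> int, x = \sum_(i < d) (n i)%:~R *: b i].

Definition even_lattice (C : numFieldType) (X : lmodType C)
    (frm : X -> X -> C) (L : set X) : Prop :=
  [/\ exists d (b : 'I_d -> X), zbasis L b,
      forall u v, L u -> L v -> is_int (frm u v),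
      forall u, L u -> exists k : int, frm u u = (k *+ 2)%:~R
    & forall u, lspan L u -> (forall v, lspan L v -> frm u v = 0) -> u = 0].

Definition dual_lattice (C : numFieldType) (X : lmodType C)
    (frm : X -> X -> C) (L : set X) : set X :=
  [set u | lspan L u /\ forall v, L v -> is_int (frm u v)].

(* [schur h n x] is the coefficient of z^n in exp(sum_(i>=1) h(-i)/i z^i) x,
   computed by n p_n = sum_(1<=i<=n) h(-i) p_(n-i); [schur_seq h n x] is
   [:: p_n; ...; p_0]. *)
Fixpoint schur_seq (C : numFieldType) (M : lmodType C) (h : int -> M -> M)
    (n : nat) (x : M) : seq M :=
  if n is n'.+1 then
    let s := schur_seq h n' x in
    (n'.+1%:R^-1 *: \sum_(i < n'.+1) h (- (i.+1)%:Z) s`_i) :: s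
  else [:: x].

Definition schur (C : numFieldType) (M : lmodType C) (h : int -> M -> M)
    (n : nat) (x : M) : M := (schur_seq h n x)`_0.

(* [:: (i1,n1); ...; (ik,nk)] stands for the monomial
   b_i1(-n1-1) ... b_ik(-nk-1). *)
Definition fock_monomial (C : numFieldType) (M : lmodType C) (d : nat)
    (h : 'I_d -> int -> M -> M) (s : seq ('I_d * nat)) (x : M) : M :=
  foldr (fun p y => h p.1 (- (p.2.+1)%:Z) y) x s.

Definition monomial_le (d : nat) (p q : 'I_d * nat) : bool :=
  (p.1 < q.1)%N || ((p.1 == q.1) && (p.2 <= q.2)%N).

(* [MS] is the space S(h^-) (x) C[u + L] with [E lam] = 1 (x) e^lam, where the
   elements j(h)_n and e(beta)_n (for h in C (x) L, beta in L) of a vertex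
   algebra act by the formulas defining the module V_(u+L) over V_L:
   Y(e^beta,z) e^lam
     = eps(beta,lam) z^<beta,lam> exp(sum_(n>=1) beta(-n)/n z^n) e^(beta+lam).
   When [act] is the action of V_L on itself or on a module, the vertex algebra
   and module axioms force eps to be a 2-cocycle with commutator
   (-1)^<beta,gamma> (resp. a compatible 2-cochain). *)
Definition lattice_fock (C : numFieldType) (X : lmodType C)
    (frm : X -> X -> C) (L : set X) (W : vertexAlgebra C) (j e : X -> W)
    (M : lmodType C) (act : W -> int -> M -> M) (MS : set M)
    (u : X) (E : X -> M) : Prop :=
  let coset := [set lam | L (lam - u)] in
  [/\ forall h lam (n : nat), lspan L h -> coset lam ->
        act (j h) n%:Z (E lam) = if n == 0%N then frm h lam *: E lam else 0,
      exists eps : X -> X -> C, forall beta lam (k : int),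
        L beta -> coset lam -> frm beta lam = k%:~R ->
        [/\ eps beta lam != 0,
            forall n : nat, act (e beta) (- k - 1 - n%:Z) (E lam)
              = eps beta lam *: schur (act (j beta)) n (E (beta + lam))
          & forall n : int, - k <= n -> act (e beta) n (E lam) = 0]
    & exists d (b : 'I_d -> X), zbasis L b /\
        @hamel_basis C M (seq ('I_d * nat) * X)%type
          [set i | sorted (@monomial_le d) i.1 /\ coset i.2]
          (fun i => fock_monomial (fun k => act (j (b k))) i.1 (E i.2)) MS].

(* The vertex subalgebra [S] of [W] is the lattice vertex algebra V_L, with
   [j h] = h(-1)1 for h in C (x) L and [e beta] = e^beta for beta in L. *)
Definition lattice_va (C : numFieldType) (X : lmodType C)
    (frm : X -> X -> C) (L : set X) (W : vertexAlgebra C) (S : set W)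
    (j e : X -> W) : Prop :=
  [/\ subva S, e 0 = vac W,
      linear_on (lspan L) j /\ (forall h, lspan L h -> S (j h)),
      forall h h' (n : nat), lspan L h -> lspan L h' ->
        nprod (j h) n%:Z (j h') = if n == 1%N then frm h h' *: vac W else 0
    & lattice_fock frm L j e nprod S 0 e].

Definition transversal (C : numFieldType) (X : lmodType C) (L Ls T : set X)
    : Prop :=
  T `<=` Ls /\ forall u, Ls u -> exists! t, T t /\ L (u - t).

(* A decomposition V = (+)_(u+L in L^*/L) V_(u+L) (x) U(u) of V as a
   V_L (x) U-module, where VL = V_L and U are commuting vertex subalgebras of V:
   [dec_tau u : V_(u+L) x U(u) -> V] is the bilinear map underlying the
   inclusion of the summand, and the sum over a set of representatives of
   L^*/L is direct. *)
Record coset_decomposition (C : numFieldType) (V : voa C) (L : set V)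
    (e : V -> V) (VL U : set V) := CosetDecomposition {
  dec_M : V -> vmodule VL;
  dec_E : forall u, V -> dec_M u;
  dec_U : V -> vmodule U;
  dec_tau : forall u, dec_M u -> dec_U u -> V;
  dec_lattice : forall u, dual_lattice (voa_form V) L u ->
    lattice_fock (voa_form V) L id e (@vact C V VL (dec_M u)) setT u
      (@dec_E u);
  dec_bilinear : forall u, dual_lattice (voa_form V) L u ->
    bilinear (@dec_tau u);
  dec_inj : forall u, dual_lattice (voa_form V) L u ->
    tensor_injective (@dec_tau u);
  dec_actL : forall u a n x w, dual_lattice (voa_form V) L u -> VL a ->
    @dec_tau u (vact a n x) w = nprod a n (@dec_tau u x w);
  dec_actU : forall u b n x w, dual_lattice (voa_form V) L u -> U b ->
    @dec_tau u x (vact b n w) = nprod b n (@dec_tau u x w);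
  dec_sum : forall T, transversal L (dual_lattice (voa_form V) L) T ->
    direct_sum_of T (fun u => tensor_image (@dec_tau u)) setT }.

(** ** The Lorentzian construction *)

(* [ar + bq] in C (x) II_(1,1). *)
Definition II_vec (C : numFieldType) (a b : C) : 'rV[C]_2 :=
  \row_(i < 2) if i == 0 then a else b.

Definition II_form (C : numFieldType) (x y : 'rV[C]_2) : C :=
  - (x 0 0 * y 0 1 + x 0 1 * y 0 0).

Definition II_lattice (C : numFieldType) : set 'rV[C]_2 :=
  [set x | exists a b : int, x = II_vec a%:~R b%:~R].

Record II_va (C : numFieldType) := IIVa {
  ii_va :> vertexAlgebra C;
  ii_j : 'rV[C]_2 -> ii_va;
  ii_e : 'rV[C]_2 -> ii_va;
  ii_lattice : lattice_va (@II_form C) (@II_lattice C) setT ii_j ii_e }.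

(* The tensor product of two vertex algebras:
   (a (x) b)_n (c (x) d) = sum_(i in Z) a_i c (x) b_(n-1-i) d,
   a finite sum by truncation, written here over -k <= i <= k for large k. *)
Record tensor_va (C : numFieldType) (V W : vertexAlgebra C) := TensorVa {
  tens_va :> vertexAlgebra C;
  tens : V -> W -> tens_va;
  tens_bilinear : bilinear tens;
  tens_inj : tensor_injective tens;
  tens_span : tensor_image tens = setT;
  tens_vac : vac tens_va = tens (vac V) (vac W);
  tens_nprod : forall a b (n : int) c d, exists k0 : nat,
    forall k : nat, (k0 <= k)%N ->
    nprod (tens a b) n (tens c d) =
    \sum_(i < k.*2.+1)
      tens (nprod a (i%:Z - k%:Z) c) (nprod b (n - 1 - (i%:Z - k%:Z)) d) }.

(* The quotient of the vertex subalgebra [J] by its ideal [P]. *)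
Record quotient_va (C : numFieldType) (W : vertexAlgebra C) (J P : set W) :=
  QuotientVa {
  quot_va :> vertexAlgebra C;
  quot_map : W -> quot_va;
  quot_linear : linear_on J quot_map;
  quot_vac : quot_map (vac W) = vac quot_va;
  quot_nprod : forall u n v, J u -> J v ->
    quot_map (nprod u n v) = nprod (quot_map u) n (quot_map v);
  quot_ker : forall u, J u -> (quot_map u = 0 <-> P u);
  quot_surj : forall y, exists2 u, J u & quot_map u = y }.

(* The element (beta, a, b). *)
Definition lor_vec (C : numFieldType) (V : voa C) (A : II_va C)
    (T : tensor_va V A) (beta : V) (a b : C) : T :=
  tens T beta (vac A) + tens T (vac V) (ii_j A (II_vec a b)).

Arguments lor_vec {C V A} T beta a b.

Definition lor_rho (C : numFieldType) (V : voa C) (A : II_va C)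
    (T : tensor_va V A) (alpha : V) (N : nat) (K : int) : T :=
  lor_vec T alpha 1 (K%:~R / N%:R).

Arguments lor_rho {C V A} T alpha N K.

Definition lor_J (C : numFieldType) (V : voa C) (A : II_va C)
    (T : tensor_va V A) (alpha : V) (N : nat) (K : int) : set T :=
  Comm (generated_va [set lor_rho T alpha N K]).

Arguments lor_J {C V A} T alpha N K.

(* e^(N rho) = e^(N alpha) (x) e^(N r + K q), where [e] provides the e^beta of
   V_L = Comm(U,V). *)
Definition lor_expNrho (C : numFieldType) (V : voa C) (e : V -> V)
    (A : II_va C) (T : tensor_va V A) (alpha : V) (N : nat) (K : int) : T :=
  tens T (e (N%:R *: alpha)) (ii_e A (II_vec N%:R K%:~R)).

Arguments lor_expNrho {C V} e {A} T alpha N K.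

Definition lor_P (C : numFieldType) (V : voa C) (e : V -> V)
    (A : II_va C) (T : tensor_va V A) (alpha : V) (N : nat) (K : int) : set T :=
  let J := lor_J T alpha N K in
  lspan ([set x | exists (i : nat) y, (0 < i)%N /\ J y /\
            x = nprod (lor_rho T alpha N K) (- i%:Z) y]
         `|` [set x | exists y, J y /\
            x = nprod (vac T - lor_expNrho e T alpha N K) (-1) y]).

Arguments lor_P {C V} e {A} T alpha N K.

(* [betahat] = (beta, 0, <beta,alpha>) in V^[alpha] = J/P. *)
Definition lor_hat (C : numFieldType) (V : voa C) (A : II_va C)
    (T : tensor_va V A) (alpha : V) (J P : set T) (Q : quotient_va J P)
    (beta : V) : Q :=
  quot_map Q (lor_vec T beta 0 (voa_form V beta alpha)).

Arguments lor_hat {C V A T} alpha {J P} Q beta.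

(** ** Shifted lattices *)

Definition lbar (C : numFieldType) (V : voa C) (L : set V) (gam : V) : set V :=
  [set u | L u /\ is_int (voa_form V u gam)].

(* bar L^[alpha]; [N0], [K0] are N/(N,K), K/(N,K), and [gam] is N0 alpha. *)
Definition lbracket (C : numFieldType) (V : voa C) (L : set V) (alpha : V)
    (N0 : nat) (K0 : int) : set V :=
  [set w | exists u (m : nat) (k : int),
     [/\ lbar L (N0%:R *: alpha) u, (m < N0)%N,
         voa_form V u (N0%:R *: alpha) = k%:~R,
         (k = m%:Z * K0 %[mod N0%:Z])%Z
       & w = u - m%:R *: alpha]].

(** ** The automorphism exp(2 pi i alpha(0)) *)

Definition series_cvg_to (R : realType) (a : nat -> R[i]) (l : R[i]) : Prop :=
  forall eps : R[i], 0 < eps -> exists n0 : nat, forall n, (n0 <= n)%N ->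
    `|\sum_(k < n) a k - l| < eps.

(* [g] = exp(T).  Convergence of sum_k T^k v / k! is tested against all linear
   functionals; on a finite-dimensional T-stable subspace, such as V_n for
   T = 2 pi i alpha(0), this is ordinary convergence. *)
Definition is_exp_op (R : realType) (M : lmodType R[i]) (T g : M -> M) : Prop :=
  forall (phi : M -> R[i]) v,
    (forall c x y, phi (c *: x + y) = c * phi x + phi y) ->
    series_cvg_to (fun k => phi (iter k T v) / k`!%:R) (phi (g v)).

Definition has_order (M : Type) (g : M -> M) (N : nat) : Prop :=
  [/\ (0 < N)%N, forall v, iter N g v = v
    & forall k : nat, (0 < k < N)%N -> exists v, iter k g v <> v].

Definition eigenvalue_of (C : numFieldType) (M : lmodType C) (T : M -> M)
    (z : C) : Prop := exists2 v, v <> 0 & T v = z *: v.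

Definition generates_Z (C : numFieldType) (A : set C) : Prop :=
  (forall z, A z -> is_int z) /\
  forall I : set int, I 0 -> (forall x y, I x -> I y -> I (x + y)) ->
    (forall x y, I y -> I (x * y)) ->
    (forall n : int, A n%:~R -> I n) -> I = setT.

(* Main.v *)
Require Import Defs.
From HB Require Import structures.
From mathcomp Require Import all_boot all_order all_algebra.
From mathcomp Require Import all_classical all_reals.
From mathcomp Require Import trigo.
From mathcomp Require Import complex.
From mathcomp Require Import ring zify.

(** [V (x) V_(1,1)] is spanned by the creation operators of the Heisenberg
    algebra of [H (+) C Pi_(1,1)] applied to the tensors [v (x) e^(a,b)], where
    [v] is a vacuum vector for [H] with weight in [L^*].  Normal ordered
    exponentials project the creation operators away compatibly with [P], so
    every vacuum vector of [V^[alpha]] for the hatted [H] lifts to a sum of such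
    tensors, with weights orthogonal to [rho].  Let [sigma = (0,0,-1)], so that
    [sigma(0)] acts on [v (x) e^(a,b)] as [a].  The operator [e^(N rho)_(-1)]
    shifts this degree by [N], is invertible on [J] up to creation operators of
    [rho], and is identified with [1] in [J/P]; hence a lift exists, and is
    unique, with degrees in any given window of [N] consecutive integers.

    A vacuum vector of weight [0] lifts to weights in [L^* (+) Pi_(1,1)] that
    are multiples of [rho], that is to [m N_0 rho] with [0 <= m < R]; the
    corresponding vacuum vectors of [V] are those of [e^(m N_0 alpha) (x)
    U(m N_0 alpha)].  A vacuum vector commuting with [U] lifts to a multiple
    of [e^u (x) e^(a,b)] with [u] in [L] and [<u,alpha> = b + a K/N], and has
    weight [u - a alpha]: these weights form the lattice of [V^[alpha]]. *)

(** The obstacle is that [P] refers to [e (N alpha)], while the hypotheses only put [N alpha] in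
    [L^*] and [e] is a lattice exponential only on [L]. Hence [Nalpha_mem] must precede every shift
    by [e^(N rho)]. The degree argument behind it uses only that this operator is linear, is the
    identity modulo [P] and has [sigma]-degree [N], which is read off the factor [e^(N,K)] alone;
    the other inputs are the nonzero vacuum of [V^[alpha]] and the simplicity of [V].

    The vectors [rho] and [sigma] form a hyperbolic pair orthogonal to the hatted copy of [H]. In
    this basis the oscillators separate into three kinds with respect to the quotient: the hatted
    ones act on [J/P], the modes [rho(-n)] map [J] into [P], and the modes [rho(n)] vanish on [J].
    The modes [sigma(n)] with [n >= 0] still preserve [J], so [J] is graded by [sigma(0)] although
    [J/P] is not.

    The number [R] arises as follows: [a rho] has integral last coordinate [a K_0 / N_0] only if
    [N_0] divides [a], and a window of length [N = R N_0] starting at [0] contains exactly [R] such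
    degrees. *)

Set Implicit Arguments.
Unset Strict Implicit.
Unset Printing Implicit Defensive.

Import Order.TTheory GRing.Theory Num.Theory.
Local Open Scope classical_set_scope.
Local Open Scope ring_scope.

(** * Subspaces and weight decompositions *)

Section LinearAlgebra.
Variable C : numFieldType.
Implicit Types M : lmodType C.

Section LinearFunction.
Variables (M M' : lmodType C) (f : M -> M') (f_lin : linear f).

Lemma lfun0 : f 0 = 0.
Proof. by have := f_lin (-1) 0 0; rewrite scaler0 addr0 scaleN1r addNr. Qed.

Lemma lfunD x y : f (x + y) = f x + f y.
Proof. by rewrite -[x in LHS]scale1r f_lin scale1r. Qed.

Lemma lfunZ c x : f (c *: x) = c *: f x.
Proof. by rewrite -[c *: x]addr0 f_lin lfun0 addr0. Qed.

Lemma lfunN x : f (- x) = - f x.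
Proof. by rewrite -scaleN1r lfunZ scaleN1r. Qed.

Lemma lfunB x y : f (x - y) = f x - f y.
Proof. by rewrite lfunD lfunN. Qed.

Lemma lfun_sum I (r : seq I) (P : pred I) F :
  f (\sum_(i <- r | P i) F i) = \sum_(i <- r | P i) f (F i).
Proof. exact: (big_morph f lfunD lfun0). Qed.

End LinearFunction.

Lemma linear_iter M (f : M -> M) : linear f -> forall n, linear (iter n f).
Proof. by move=> lf; elim=> [|n IHn] c x y //=; rewrite IHn lf. Qed.

Section Subspace.
Variables (M : lmodType C) (S : set M) (S_sub : subspace S).

Lemma subspace0 : S 0. Proof. by case: S_sub. Qed.

Lemma subspaceZ c x : S x -> S (c *: x).
Proof. by move=> Sx; rewrite -[_ *: _]addr0; apply: S_sub.2 => //; exact: subspace0. Qed.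

Lemma subspaceD x y : S x -> S y -> S (x + y).
Proof. by move=> Sx Sy; rewrite -[x]scale1r; exact: S_sub.2. Qed.

Lemma subspaceN x : S x -> S (- x).
Proof. by move=> Sx; rewrite -scaleN1r; exact: subspaceZ. Qed.

Lemma subspaceB x y : S x -> S y -> S (x - y).
Proof. by move=> Sx Sy; apply: subspaceD => //; exact: subspaceN. Qed.

Lemma subspace_sum (I : eqType) (r : seq I) (F : I -> M) :
  (forall i, i \in r -> S (F i)) -> S (\sum_(i <- r) F i).
Proof.
move=> SF; rewrite big_seq.
by elim/big_ind: _ => //; [exact: subspace0 | exact: subspaceD].
Qed.

Lemma subspace_sum_ord n (F : 'I_n -> M) :
  (forall i, S (F i)) -> S (\sum_(i < n) F i).
Proof. by move=> SF; apply: subspace_sum. Qed.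

Section LinearOn.
Variables (M' : lmodType C) (f : M -> M') (f_lin : linear_on S f).

Lemma lon0 : f 0 = 0.
Proof.
by have := f_lin (-1) subspace0 subspace0; rewrite scaler0 addr0 scaleN1r addNr.
Qed.

Lemma lonD x y : S x -> S y -> f (x + y) = f x + f y.
Proof. by move=> Sx Sy; rewrite -[x in LHS]scale1r f_lin// scale1r. Qed.

Lemma lonZ c x : S x -> f (c *: x) = c *: f x.
Proof. by move=> Sx; rewrite -[c *: x]addr0 f_lin ?lon0 ?addr0//; exact: subspace0. Qed.

Lemma lonN x : S x -> f (- x) = - f x.
Proof. by move=> Sx; rewrite -scaleN1r lonZ// scaleN1r. Qed.

Lemma lonB x y : S x -> S y -> f (x - y) = f x - f y.
Proof. by move=> Sx Sy; rewrite lonD ?lonN//; exact: subspaceN. Qed.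

Lemma lon_sum (I : eqType) (r : seq I) (F : I -> M) :
  (forall i, i \in r -> S (F i)) ->
  f (\sum_(i <- r) F i) = \sum_(i <- r) f (F i).
Proof.
elim: r => [|i r IHr] SF; first by rewrite !big_nil lon0.
rewrite !big_cons lonD ?IHr//.
- by move=> k kr; apply: SF; rewrite inE kr orbT.
- by apply: SF; rewrite mem_head.
- by apply: subspace_sum => k kr; apply: SF; rewrite inE kr orbT.
Qed.

End LinearOn.
End Subspace.

Lemma subspace_zero M : subspace [set 0 : M].
Proof. by split=> // c x y -> ->; rewrite scaler0 addr0. Qed.

Lemma lspan_sub M (A : set M) : A `<=` lspan A.
Proof.
move=> x Ax; exists 1%N, (fun=> 1), (fun=> x); split=> //.
by rewrite big_ord1 scale1r.
Qed.

Lemma subspace_lspan M (A : set M) : subspace (lspan A).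
Proof.
split; first by exists 0%N, (fun=> 0), (fun=> 0); split; [case | rewrite big_ord0].
move=> c _ _ [n [a [v [Av ->]]]] [m [b [w [Aw ->]]]].
exists (n + m)%N,
  (fun i => match fintype.split i with inl k => c * a k | inr k => b k end),
  (fun i => match fintype.split i with inl k => v k | inr k => w k end).
split; first by move=> i; case: (fintype.split i).
rewrite big_split_ord /= scaler_sumr; congr (_ + _); apply: eq_bigr => i _.
  by rewrite (unsplitK (inl i)) scalerA.
by rewrite (unsplitK (inr i)).
Qed.

Lemma lspan_min M (A S : set M) : subspace S -> A `<=` S -> lspan A `<=` S.
Proof.
move=> subS AS _ [n [c [v [Av ->]]]].
by apply: (subspace_sum_ord subS) => i; apply: (subspaceZ subS); exact: AS.
Qed.

Lemma subspace_preim M M' (f : M -> M') (S : set M') :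
  linear f -> subspace S -> subspace (f @^-1` S).
Proof.
move=> lf subS; split; first by rewrite /preimage/= (lfun0 lf); exact: subspace0.
by move=> c x y Sx Sy; rewrite /preimage/= lf; exact: subS.2.
Qed.

Lemma lspan_map M M' (f : M -> M') (A : set M) (S : set M') :
  linear f -> subspace S -> (forall x, A x -> S (f x)) ->
  forall x, lspan A x -> S (f x).
Proof. by move=> lf subS AS; exact: (lspan_min (subspace_preim lf subS) AS). Qed.

(** Applying [F i - chi i b] removes the component at [b] and rescales the one at [a] by a nonzero
    factor, so induction on the number of weights applies. With [S] zero this is linear independence
    of eigenvectors of distinct weights. *)
Lemma weight_components M (S : set M) (I : Type) (D : set I) (Lam : eqType)
    (F : I -> M -> M) (chi : I -> Lam -> C) (s : seq Lam) (f : Lam -> M) :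
  subspace S ->
  (forall i, D i -> linear (F i)) ->
  (forall i x, D i -> S x -> S (F i x)) ->
  uniq s ->
  (forall i a, D i -> a \in s -> F i (f a) = chi i a *: f a) ->
  (forall a b, a \in s -> b \in s -> a != b ->
     exists i, D i /\ chi i a != chi i b) ->
  S (\sum_(a <- s) f a) -> forall a, a \in s -> S (f a).
Proof.
move=> subS linF stabF.
elim: s f => // b s IHs f /= /andP[bs us] Ff sep.
rewrite big_cons => Sf.
have Ss a : a \in s -> S (f a).
  move=> sa; have ab : a != b by apply: contraNneq bs => <-.
  have sa' : a \in b :: s by rewrite inE sa orbT.
  have [i [Di chiab]] := sep a b sa' (mem_head _ _) ab.
  pose f' c := (chi i c - chi i b) *: f c.
  suff : S (f' a).
    move=> /(subspaceZ subS (chi i a - chi i b)^-1).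
    by rewrite scalerA mulVf ?scale1r// subr_eq0.
  apply: (IHs f') => //.
  - move=> k c Dk sc; rewrite /f' (lfunZ (linF k Dk)) Ff// ?inE ?sc ?orbT//.
    by rewrite !scalerA mulrC.
  - by move=> c d sc sd; apply: sep; rewrite inE ?sc ?sd orbT.
  have -> : \sum_(c <- s) f' c =
      F i (f b + \sum_(c <- s) f c) - chi i b *: (f b + \sum_(c <- s) f c).
    rewrite (lfunD (linF i Di)) Ff ?mem_head// scalerDr opprD addrACA subrr add0r.
    rewrite (lfun_sum (linF i Di)) scaler_sumr -sumrB big_seq [RHS]big_seq.
    apply: eq_bigr => c sc; rewrite Ff ?inE ?sc ?orbT//.
    by rewrite -scalerBl.
  by apply: (subspaceB subS); [exact: stabF | exact: subspaceZ].
move=> a; rewrite inE => /orP[/eqP->|]; last exact: Ss.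
rewrite -[f b](addrK (\sum_(c <- s) f c)).
by apply: (subspaceB subS) => //; exact: subspace_sum.
Qed.

(** Terms of equal weight are collected, so that the list of weights is duplicate-free as
    [weight_components] requires. *)
Lemma lspan_graded M (X : eqType) (Lam : set X) (S : X -> set M) x :
  (forall a, Lam a -> subspace (S a)) ->
  lspan [set y | exists a, Lam a /\ S a y] x ->
  exists (s : seq X) (f : X -> M),
    [/\ uniq s, forall a, a \in s -> Lam a /\ S a (f a)
      & x = \sum_(a <- s) f a].
Proof.
move=> subS [n [c [v [Sv ->]]]].
have [mu mu_v] := choice Sv.
pose s := undup [seq mu i | i <- index_enum 'I_n].
exists s, (fun a => \sum_(i < n | mu i == a) c i *: v i); split.
- exact: undup_uniq.
- move=> a; rewrite mem_undup => /mapP[i _ ->]; split; first by case: (mu_v i).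
  have subm := subS _ (mu_v i).1.
  rewrite -big_filter; apply: (subspace_sum subm) => k.
  rewrite mem_filter => /andP[/eqP <- _].
  by apply: subspaceZ; [apply: subS|]; case: (mu_v k).
under [RHS]eq_bigr => a _ do rewrite big_mkcond.
rewrite exchange_big /=; apply: eq_bigr => i _.
rewrite -big_mkcond -big_filter (_ : [seq _ <- s | _] = [:: mu i]) ?big_seq1//.
rewrite -(@filter_pred1_uniq _ s (mu i)) ?undup_uniq//.
  by apply: eq_filter => a; rewrite /= eq_sym.
by rewrite mem_undup; apply: map_f; rewrite mem_index_enum.
Qed.

End LinearAlgebra.

Lemma seq_int_bound (s : seq int) : exists M : nat, forall a, a \in s -> (`|a| <= M)%N.
Proof.
elim: s => [|c s [M sM]]; first by exists 0%N.
exists (`|c| + M)%N => a; rewrite inE => /orP[/eqP ->|/sM]; first exact: leq_addr.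
by move=> /leq_trans; apply; exact: leq_addl.
Qed.

Section IntegerGrading.
Variables (C : numFieldType) (M : lmodType C) (F : M -> M) (F_lin : linear F).

(** The sum condition ranges over all large enough finite sets of degrees, so that decompositions of
    two vectors can be added without matching their supports. *)
Let decomposes (x : M) (g : int -> M) : Prop :=
  (forall a, F (g a) = a%:~R *: g a) /\
  exists s0 : seq int, forall s, uniq s -> {subset s0 <= s} ->
    x = \sum_(a <- s) g a.

Let decomposes_lin c x y g h : decomposes x g -> decomposes y h ->
  decomposes (c *: x + y) (fun a => c *: g a + h a).
Proof.
move=> [Fg [sx xE]] [Fh [sy yE]]; split=> [a|].
  by rewrite F_lin Fg Fh scalerDr !scalerA mulrC.
exists (sx ++ sy) => s us sub.
rewrite (xE s)// => [|a sa]; last by apply: sub; rewrite mem_cat sa.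
rewrite (yE s)// => [|a sa]; last by apply: sub; rewrite mem_cat sa orbT.
by rewrite scaler_sumr big_split.
Qed.

Let decomposes_stable (S : set M) x g : subspace S ->
  (forall x, S x -> S (F x)) -> S x -> decomposes x g -> forall a, S (g a).
Proof.
move=> subS stabS Sx [Fg [s0 xE]] a.
apply: (@weight_components _ _ S unit setT int (fun=> F) (fun _ a => a%:~R)
  (undup (a :: s0)) g) => //.
- by move=> ? ? _; exact: stabS.
- exact: undup_uniq.
- by move=> b c _ _ bc; exists tt; split; rewrite // eqr_int.
- rewrite -xE ?undup_uniq// => b sb; by rewrite mem_undup inE sb orbT.
by rewrite mem_undup mem_head.
Qed.

Let decomposes_uniq x g h : decomposes x g -> decomposes x h -> g = h.
Proof.
move=> dg dh; apply/funext => a.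
have d := decomposes_lin (-1) dg dh; rewrite scaleN1r addNr in d.
have F0 y : [set 0] y -> [set 0] (F y) by move=> ->; exact: lfun0.
have /= := decomposes_stable (@subspace_zero _ M) F0 erefl d a.
by rewrite scaleN1r addrC => /eqP; rewrite subr_eq0 => /eqP.
Qed.

Let decomposes_shift G n x g : linear G ->
  (forall x, F (G x) = G (F x) + n%:~R *: G x) -> decomposes x g ->
  decomposes (G x) (fun a => G (g (a - n))).
Proof.
move=> linG FG [Fg [s0 xE]]; split=> [a|].
  by rewrite FG Fg (lfunZ linG) -scalerDl -intrD subrK.
exists [seq a + n | a <- s0] => s us sub.
rewrite (xE [seq a - n | a <- s]).
- by rewrite (lfun_sum linG) big_map.
- by rewrite map_inj_uniq// => a b /addIr.
by move=> a sa; apply/mapP; exists (a + n); rewrite ?addrK//; apply/sub/map_f.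
Qed.

Let decomposes_eigen a x : F x = a%:~R *: x ->
  decomposes x (fun b => if b == a then x else 0).
Proof.
move=> Fx; split=> [b|]; first by case: eqP => [->//|_]; rewrite (lfun0 F_lin) scaler0.
exists [:: a] => s us sub.
rewrite (bigD1_seq a)/= ?eqxx ?big1 ?addr0//; last by apply: sub; rewrite mem_head.
by move=> b /negPf ->.
Qed.

(** Uniqueness of the components is [weight_components] for the zero subspace; linearity of the
    projections and their behaviour under homogeneous operators follow from it. *)
Lemma int_grading :
  (forall x, lspan [set y | exists a : int, F y = a%:~R *: y] x) ->
  exists pr : int -> M -> M,
  (forall a, linear (pr a)) /\
  (forall x, exists s, uniq s /\ x = \sum_(a <- s) pr a x) /\
  (forall x, exists s : seq int, forall a, a \notin s -> pr a x = 0) /\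
  (forall a b x, F x = a%:~R *: x -> pr b x = if b == a then x else 0) /\
  (forall a x, F (pr a x) = a%:~R *: pr a x) /\
  (forall G n, linear G -> (forall x, F (G x) = G (F x) + n%:~R *: G x) ->
     forall a x, pr a (G x) = G (pr (a - n) x)) /\
  (forall S, subspace S -> (forall x, S x -> S (F x)) ->
     forall a x, S x -> S (pr a x)).
Proof.
move=> spanF.
have dec x : exists g, decomposes x g.
  apply: (@lspan_min _ _ _ [set x | exists g, decomposes x g] _ _ x (spanF x));
    last move=> y [a Fy].
  2:
    by exists (fun b => if b == a then y else 0); exact: decomposes_eigen.
  split; last first.
    move=> c y z [g dg] [h dh].
    by exists (fun a => c *: g a + h a); exact: decomposes_lin.
  exists (fun b => if b == 0 then 0 else 0); apply: decomposes_eigen.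
  by rewrite (lfun0 F_lin) scaler0.
have [g dg] := choice dec.
exists (fun a x => g x a); split; [|split; [|split; [|split; [|split; [|split]]]]].
- move=> a c x y.
  by rewrite (decomposes_uniq (dg (c *: x + y)) (decomposes_lin c (dg x) (dg y))).
- move=> x; have [_ [s0 xE]] := dg x; exists (undup s0); split; first exact: undup_uniq.
  by apply: xE; rewrite ?undup_uniq// => a; rewrite mem_undup.
- move=> x; have [_ [s0 xE]] := dg x; exists s0 => a as0.
  have E1 : x = \sum_(b <- undup s0) g x b.
    by apply: xE => [|b]; rewrite ?undup_uniq ?mem_undup.
  have : x = g x a + x.
    rewrite {1}(xE (a :: undup s0)) ?big_cons -?E1//=.
      by rewrite mem_undup as0 undup_uniq.
    by move=> b sb; rewrite inE mem_undup sb orbT.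
  by move/eqP; rewrite -subr_eq subrr eq_sym => /eqP.
- by move=> a b x Fx; rewrite (decomposes_uniq (dg x) (decomposes_eigen Fx)).
- by move=> a x; have [] := dg x.
- move=> G n linG FG a x.
  by rewrite (decomposes_uniq (dg (G x)) (decomposes_shift linG FG (dg x))).
- by move=> S subS stabS a x Sx; exact: (decomposes_stable subS stabS Sx (dg x)).
Qed.

End IntegerGrading.

(** * Projecting away creation operators *)

Section FockReduction.
Variables (C : numFieldType) (M : lmodType C) (I : eqType) (A B : I -> M -> M).
Hypotheses (A_lin : forall i, linear (A i)) (B_lin : forall i, linear (B i)).
Hypothesis BA : forall i x, B i (A i x) = A i (B i x) + x.
Hypothesis BA_neq : forall i j x, i != j -> B i (A j x) = A j (B i x).
Hypothesis AA : forall i j x, A i (A j x) = A j (A i x).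
Hypothesis BB : forall i j x, B i (B j x) = B j (B i x).

(* The truncation of [:exp(- A i * B i):], which projects the vectors killed by
   [B i ^ k] onto the kernel of [B i] along the image of [A i]. *)
Definition fock_proj (i : I) (k : nat) (x : M) : M :=
  \sum_(l < k) ((-1) ^+ l / l`!%:R) *: iter l (A i) (iter l (B i) x).

Lemma fock_proj_linear i k : linear (fock_proj i k).
Proof.
move=> c x y; rewrite /fock_proj scaler_sumr -big_split; apply: eq_bigr => l _ /=.
by rewrite (linear_iter (B_lin i)) (linear_iter (A_lin i)) scalerDr !scalerA mulrC.
Qed.

Lemma fock_proj_split i k x : fock_proj i k.+1 x =
  x + \sum_(l < k) ((-1) ^+ l.+1 / l.+1`!%:R) *:
        iter l.+1 (A i) (iter l.+1 (B i) x).
Proof. by rewrite /fock_proj big_ord_recl/= fact0 expr0 divr1 scale1r. Qed.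

Lemma iter_lin0 (f : M -> M) n : linear f -> iter n f 0 = 0.
Proof. by move=> lf; rewrite (lfun0 (linear_iter lf n)). Qed.

Lemma fock_proj_id i k x : B i x = 0 -> fock_proj i k.+1 x = x.
Proof.
move=> Bx; rewrite fock_proj_split big1 ?addr0// => l _.
rewrite [iter l.+1 (B i) x]iterSr Bx (iter_lin0 _ (B_lin i)).
by rewrite (iter_lin0 _ (A_lin i)) scaler0.
Qed.

(** [G] is only required to be linear on [S], which covers both the quotient map on [J] and
    operators on the whole space. The right-hand side is the projection formed from [A'] and [B'],
    which need not satisfy commutation relations. *)
Lemma fock_proj_comm i k (S : set M) (M' : lmodType C) (A' B' : M' -> M')
    (G : M -> M') x :
  linear_on S G -> subspace S ->
  (forall y, S y -> S (A i y)) -> (forall y, S y -> S (B i y)) ->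
  (forall y, S y -> G (A i y) = A' (G y)) ->
  (forall y, S y -> G (B i y) = B' (G y)) -> S x ->
  S (fock_proj i k x) /\
  G (fock_proj i k x) =
  \sum_(l < k) ((-1) ^+ l / l`!%:R) *: iter l A' (iter l B' (G x)).
Proof.
move=> linG subS SA SB GA GB Sx.
have SBl l : S (iter l (B i) x) by elim: l => //= l; exact: SB.
have SAl l m : S (iter m (A i) (iter l (B i) x)) by elim: m => //= m; exact: SA.
have SZ l m c : S (c *: iter m (A i) (iter l (B i) x)) by exact: subspaceZ.
split; first by apply: (subspace_sum_ord subS) => l; exact: SZ.
rewrite (lon_sum subS linG) => [|l _]; last exact: SZ.
apply: eq_bigr => l _; rewrite (lonZ subS linG)//; congr (_ *: _).
have -> m : G (iter m (A i) (iter l (B i) x)) = iter m A' (G (iter l (B i) x)).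
  by elim: m => //= m <-; rewrite GA.
by congr iter; elim: (l : nat) => //= m <-; rewrite GB.
Qed.

Lemma iter_BA i k x :
  iter k.+1 (B i) (A i x) = A i (iter k.+1 (B i) x) + k.+1%:R *: iter k (B i) x.
Proof.
elim: k => [|k IHk]; first by rewrite /= BA scale1r.
rewrite iterS IHk (lfunD (B_lin i)) BA (lfunZ (B_lin i)) -!iterS -addrA; congr (_ + _).
by rewrite -[k.+2%:R]natr1 scalerDl scale1r addrC.
Qed.

Lemma fock_proj_recr i k x : fock_proj i k.+1 x = fock_proj i k x +
  ((-1) ^+ k / k`!%:R) *: iter k (A i) (iter k (B i) x).
Proof. by rewrite /fock_proj big_ord_recr. Qed.

(** By [B^l A = A B^l + l B^(l-1)] the sum telescopes to its top term, which vanishes as soon as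
    [B i ^ k] kills [x]. *)
Lemma fock_proj_A i k x : fock_proj i k.+1 (A i x) =
  ((-1) ^+ k / k`!%:R) *: iter k.+1 (A i) (iter k (B i) x).
Proof.
elim: k => [|k IHk]; first by rewrite /fock_proj big_ord1.
rewrite fock_proj_recr IHk iter_BA (lfunD (linear_iter (A_lin i) k.+1)).
rewrite (lfunZ (linear_iter (A_lin i) k.+1)) -iterSr scalerDr scalerA addrC.
rewrite -addrA -scalerDl (_ : _ + _ / _ = 0) ?scale0r ?addr0// factS natrM exprS.
have k0 : k.+1%:R != 0 :> C by rewrite pnatr_eq0.
have f0 : k`!%:R != 0 :> C by rewrite pnatr_eq0 -lt0n fact_gt0.
have E (a b c : C) : a != 0 -> b != 0 -> -1 * c / (a * b) * a + c / b = 0.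
  by move=> a0 b0; field; rewrite a0 b0.
exact: E.
Qed.

Lemma fock_proj_commA i j k x : i != j ->
  fock_proj i k (A j x) = A j (fock_proj i k x).
Proof.
move=> ij; have [] := @fock_proj_comm i k setT M (A i) (B i) (A j) x => //.
- by move=> c y z _ _; exact: A_lin.
- by move=> y _; rewrite BA_neq.
Qed.

Lemma fock_proj_commB i j k x : i != j ->
  fock_proj i k (B j x) = B j (fock_proj i k x).
Proof.
move=> ij; have [] := @fock_proj_comm i k setT M (A i) (B i) (B j) x => //.
- by move=> c y z _ _; exact: B_lin.
- by move=> y _; rewrite BA_neq// eq_sym.
Qed.

Let proj_seq k s x := foldr (fun i y => fock_proj i k y) x s.

Let proj_seq_linear k s : linear (proj_seq k s).
Proof. by elim: s => // i s IHs c x y /=; rewrite IHs fock_proj_linear. Qed.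

(** The occurrence of [i] nearest to the vector does the work: the projections applied before it
    have other indices and commute with [A i] and [B i]. *)
Let proj_seq_A k s i x : i \in s -> iter k (B i) x = 0 ->
  proj_seq k.+1 s (A i x) = 0.
Proof.
move=> + Bx; elim: s => // j s IHs; rewrite inE /=.
case: (boolP (i \in s)) => [si _|si]; first by rewrite IHs// (lfun0 (fock_proj_linear _ _)).
rewrite orbF => /eqP <-.
have comm (s' : seq I) f :
    (forall l, l \in s' -> forall y,
       fock_proj l k.+1 (f y) = f (fock_proj l k.+1 y)) ->
    forall y, proj_seq k.+1 s' (f y) = f (proj_seq k.+1 s' y).
  elim: s' => //= l s' IHl fl y; rewrite IHl ?fl ?mem_head//.
  by move=> m ms; apply: fl; rewrite inE ms orbT.
have nil_s l : l \in s -> l != i by move=> ls; apply: contraNneq si => <-.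
rewrite (comm s (A i)) => [|l /nil_s li y]; last exact: fock_proj_commA.
rewrite fock_proj_A.
have -> : iter k (B i) (proj_seq k.+1 s x) = proj_seq k.+1 s (iter k (B i) x).
  have commB y : proj_seq k.+1 s (B i y) = B i (proj_seq k.+1 s y).
    by rewrite comm// => l /nil_s li z; exact: fock_proj_commB.
  by elim: {1 4}k => //= m ->; rewrite commB.
by rewrite Bx (lfun0 (proj_seq_linear _ _)) (iter_lin0 _ (A_lin i)) scaler0.
Qed.

(** The composite of the projections over the indices of [l] kills every creation term and fixes
    [o], while each factor preserves [Inv]. Finiteness of [l] provides a common truncation order. *)
Lemma fock_reduce (Inv : M -> Prop) o (l : seq (I * M)) :
  (forall i k x, Inv x -> Inv (fock_proj i k.+1 x)) ->
  (forall i, B i o = 0) ->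
  (forall t, t \in l -> exists k, iter k (B t.1) t.2 = 0) ->
  Inv (o + \sum_(t <- l) A t.1 t.2) -> Inv o.
Proof.
move=> Inv_proj Bo l_nil.
have [k Bk] : exists k, forall t, t \in l -> iter k (B t.1) t.2 = 0.
  elim: l l_nil => [|t l IHl] l_nil; first by exists 0%N.
  have [|k1 Hk1] := IHl; first by move=> u ul; apply: l_nil; rewrite inE ul orbT.
  have [k2 Hk2] := l_nil t (mem_head _ _).
  exists (k1 + k2)%N => u; rewrite inE => /orP[/eqP->|/Hk1 E].
    by rewrite iterD Hk2 (iter_lin0 _ (B_lin _)).
  by rewrite addnC iterD E (iter_lin0 _ (B_lin _)).
move=> Inv_x.
have Inv_p s y : Inv y -> Inv (proj_seq k.+1 s y).
  by move=> Iy; elim: s => //= i s; exact: Inv_proj.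
have := Inv_p [seq t.1 | t <- l] _ Inv_x.
rewrite (lfunD (proj_seq_linear _ _)) (lfun_sum (proj_seq_linear _ _)).
rewrite big_seq big1 ?addr0 => [|t tl]; last by rewrite proj_seq_A ?map_f ?Bk.
by congr Inv; elim: [seq _ | _ <- _] => //= i s ->; rewrite fock_proj_id.
Qed.

End FockReduction.

(** * Vertex algebras *)

Section VertexAlgebra.
Variables (C : numFieldType) (V : vertexAlgebra C).
Implicit Types (a b u v x y : V) (p q r n m : int).

Lemma posz0 : Posz 0 = 0. Proof. by []. Qed.

Lemma binz0 p : binz C p 0 = 1.
Proof. by rewrite /binz big_ord0 fact0 divr1. Qed.

Lemma binz1 p : binz C p 1 = p%:~R.
Proof. by rewrite /binz big_ord1 subr0 divr1. Qed.

Lemma binz_0l (i : nat) : (0 < i)%N -> binz C 0 i = 0.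
Proof. by case: i => // i _; rewrite /binz big_ord_recl subrr mul0r mul0r. Qed.

Lemma binz_N2 (i : nat) : (-1) ^+ i * binz C (-2) i = i.+1%:R.
Proof.
elim: i => [|i IHi]; first by rewrite binz0 expr0 mulr1.
have i1 : i.+1%:R != 0 :> C by rewrite pnatr_eq0.
have -> : binz C (-2) i.+1 = binz C (-2) i * (- i.+2%:R / i.+1%:R).
  rewrite /binz big_ord_recr/= factS natrM.
  have -> : (-2 - i%:Z)%:~R = - i.+2%:R :> C.
    by rewrite -[i.+2%:R]/(i.+2%:Z%:~R) -intrN; congr intmul; lia.
  have f0 : i`!%:R != 0 :> C by rewrite pnatr_eq0 -lt0n fact_gt0.
  have G (u a b c : C) : a != 0 -> b != 0 -> u * c / (a * b) = u / b * (c / a).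
    by move=> a0 b0; field; rewrite a0 b0.
  exact: G.
rewrite exprS mulN1r mulNr [(-1) ^+ i * _]mulrA IHi mulNr mulrN opprK.
by rewrite mulrC divfK.
Qed.

Lemma nprod0l n v : nprod (0 : V) n v = 0.
Proof. exact: (lfun0 (va_linl n v)). Qed.

Lemma nprod0r u n : nprod u n (0 : V) = 0.
Proof. exact: (lfun0 (va_linr u n)). Qed.

Lemma nprodZl c u n v : nprod (c *: u) n v = c *: nprod u n v.
Proof. exact: (lfunZ (va_linl n v)). Qed.

Lemma nprodZr c u n v : nprod u n (c *: v) = c *: nprod u n v.
Proof. exact: (lfunZ (va_linr u n)). Qed.

Lemma nprodDl u u' n v : nprod (u + u') n v = nprod u n v + nprod u' n v.
Proof. exact: (lfunD (va_linl n v)). Qed.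

Lemma nprodDr u n v v' : nprod u n (v + v') = nprod u n v + nprod u n v'.
Proof. exact: (lfunD (va_linr u n)). Qed.

(** Borcherds identity with [r = 0], for a pair of fields with at most a double pole. *)
Lemma commutator a b b0 b1 p q x :
  nprod a 0 b = b0 -> nprod a 1 b = b1 ->
  (forall i : nat, (1 < i)%N -> nprod a i%:Z b = 0) ->
  nprod a p (nprod b q x) =
  nprod b q (nprod a p x) + nprod b0 (p + q) x + p%:~R *: nprod b1 (p + q - 1) x.
Proof.
move=> ab0 ab1 ab2; have ab1' : nprod a (Posz 1) b = b1 by [].
have [k0] := @va_borcherds C V a b x p q 0 I I.
move=> /(_ k0.+2 (leq_trans (leqnSn _) (leqnSn _))).
rewrite big_ord_recl big_ord_recl big1 ?addr0 => [|i _]; last first.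
  by rewrite add0r ab2// nprod0l scaler0.
rewrite /= binz0 scale1r binz1 -[bump 0 0]/1%N !add0r ab0 ab1' -addrA => E.
rewrite -addrA [_ + p%:~R *: _]E.
rewrite big_ord_recl big1 ?addr0 => [|i _]; last by rewrite binz_0l// mulr0 scale0r.
by rewrite /= binz0 expr0 mulr1 !scale1r ?addr0 ?subr0 addrC subrK.
Qed.

Lemma zero_mode_derivation a b q x :
  nprod a 0 (nprod b q x) = nprod b q (nprod a 0 x) + nprod (nprod a 0 b) q x.
Proof.
have [k0] := @va_borcherds C V a b x 0 q 0 I I.
move=> /(_ k0.+1 (leqnSn _)).
rewrite big_ord_recl big1 ?addr0 => [|i _]; last by rewrite binz_0l// scale0r.
rewrite /= binz0 scale1r ?posz0 ?addr0 ?add0r ?subr0 => ->.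
rewrite big_ord_recl big1 ?addr0 => [|i _]; last by rewrite binz_0l// mulr0 scale0r.
by rewrite /= binz0 expr0 mulr1 !scale1r ?addr0 ?subr0 ?add0r addrC subrK.
Qed.

Lemma commute_modes a b : (forall i : nat, nprod a i%:Z b = 0) ->
  forall p q x, nprod a p (nprod b q x) = nprod b q (nprod a p x).
Proof.
move=> ab p q x; rewrite (@commutator a b 0 0)//; [|exact: (ab 0%N)|exact: (ab 1%N)].
by rewrite !nprod0l scaler0 !addr0.
Qed.

Lemma annihilate_sym a b : (forall i : nat, nprod a i%:Z b = 0) ->
  forall i : nat, nprod b i%:Z a = 0.
Proof.
move=> ab i; rewrite -(va_vacr a) -(commute_modes ab) va_creat// nprod0r//.
Qed.

(** Borcherds identity with [p = 0]: a mode of a product expands into products of modes in both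
    orders. *)
Lemma iterate_stable (S : set V) a b r q x : subspace S ->
  (forall i : nat, S (nprod a (r - i%:Z) (nprod b (q + i%:Z) x))) ->
  (forall i : nat, S (nprod b (q + r - i%:Z) (nprod a i%:Z x))) ->
  S (nprod (nprod a r b) q x).
Proof.
move=> subS Sab Sba; have [k0] := @va_borcherds C V a b x 0 q r I I.
move=> /(_ k0.+1 (leqnSn _)).
rewrite big_ord_recl big1 ?addr0 => [|i _]; last by rewrite binz_0l// scale0r.
rewrite /= binz0 scale1r ?posz0 ?addr0 ?add0r ?subr0 => ->.
apply: subspace_sum_ord => // i; apply: subspaceZ => //.
rewrite !add0r; apply: subspaceB => //; exact: subspaceZ.
Qed.

Lemma iterate_zero a b r q x :
  (forall i : nat, nprod a (r - i%:Z) (nprod b (q + i%:Z) x) = 0) ->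
  (forall i : nat, nprod b (q + r - i%:Z) (nprod a i%:Z x) = 0) ->
  nprod (nprod a r b) q x = 0.
Proof. exact: (iterate_stable (@subspace_zero _ V)). Qed.

(** In the same expansion with [r = q = -1], regularity of both fields on [x] leaves only the
    leading term. *)
Lemma iterate_m1 a b x :
  (forall i : nat, nprod a i%:Z x = 0) -> (forall i : nat, nprod b i%:Z x = 0) ->
  nprod (nprod a (-1) b) (-1) x = nprod a (-1) (nprod b (-1) x).
Proof.
move=> ax bx; have [k0] := @va_borcherds C V a b x 0 (-1) (-1) I I.
move=> /(_ k0.+1 (leqnSn _)).
rewrite big_ord_recl big1 ?addr0 => [|i _]; last by rewrite binz_0l// scale0r.
rewrite /= binz0 scale1r ?posz0 ?addr0 ?add0r ?subr0 => ->.
rewrite big_ord_recl big1 => [|i _]; last first.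
  rewrite !add0r ax nprod0r scaler0 subr0.
  rewrite lift0 (_ : -1 + i.+1%:Z = i%:Z); last by lia.
  by rewrite bx nprod0r scaler0.
by rewrite /= binz0 expr0 mulr1 scale1r ?addr0 ?add0r ?subr0 ax nprod0r scaler0 subr0.
Qed.

(** The vector [a_(-2) 1] plays the role of the derivative of [a], so that the argument works in
    vertex algebras given without a conformal vector. *)
Lemma translation_mode a (n : nat) x :
  nprod (nprod a (-2) (vac V)) n.+1%:Z x = - n.+1%:R *: nprod a n%:Z x.
Proof.
have [k0] := @va_borcherds C V a (vac V) x 0 n.+1%:Z (-2) I I.
move=> /(_ (k0 + n.+1)%N (leq_addr _ _)); rewrite addnS.
rewrite big_ord_recl big1 ?addr0 => [|i _]; last by rewrite binz_0l// scale0r.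
rewrite /= binz0 scale1r ?posz0 ?addr0 ?add0r ?subr0 => ->.
have n_lt : (n < (k0 + n).+1)%N by lia.
rewrite (bigD1 (Ordinal n_lt))//= big1 ?addr0 => [|i /eqP ni].
  have e1 : (n.+1%:Z + n%:Z == -1) = false by apply/eqP; lia.
  have e2 : (n.+1%:Z - 2 - n%:Z == -1) = true by apply/eqP; lia.
  rewrite /= !va_vacl e1 e2 nprod0r sub0r.
  rewrite add0r (_ : (-1) ^ (-2) = 1) ?scale1r; last first.
    by rewrite -exprnN sqrrN expr1n invr1.
  by rewrite binz_N2 scalerN scaleNr.
have e1 : (n.+1%:Z + i%:Z == -1) = false by apply/eqP; lia.
have e2 : (n.+1%:Z - 2 - i%:Z == -1) = false.
  by apply/eqP => E; apply: ni; apply: val_inj => /=; lia.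
by rewrite !va_vacl e1 e2 nprod0r scaler0 subr0 scaler0.
Qed.

(* The vertex operator of [e = e^h], which satisfies [L(-1) e = h(-1) e], has
   no singular part on the vectors annihilated by [h(i)], [i >= 0]. *)
Lemma exponential_regular h e x : nprod e (-2) (vac V) = nprod h (-1) e ->
  (forall i : nat, nprod h i%:Z x = 0) -> forall n : nat, nprod e n%:Z x = 0.
Proof.
move=> De hx; have [n0 en0] := va_trunc e x.
(* Downward induction from the truncation bound: [(n+1) e_n x] is, up to sign, the mode [n+1] of
   [h_(-1) e] on [x], which expands into terms ending in [h(i) x] or containing [e_(n+1+i) x]. *)
suff E (d n : nat) : (`|n0| <= n + d)%N -> nprod e n%:Z x = 0.
  by move=> n; apply: (E `|n0|%N); lia.
elim: d n => [|d IHd] n le_n; first by apply: en0; lia.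
apply/eqP; have := @translation_mode e n x; rewrite De iterate_zero.
- move=> /esym/eqP; rewrite scaler_eq0 oppr_eq0 pnatr_eq0 /=; exact.
- move=> i; rewrite (_ : n.+1%:Z + i%:Z = (n.+1 + i)%N%:Z)//.
  by rewrite IHd ?nprod0r//; lia.
- by move=> i; rewrite hx nprod0r.
Qed.

Lemma Comm_subva (W : set V) : subva (Comm W).
Proof.
split.
- split=> [u m _ _|c x y Cx Cy u m Wu m0]; first exact: nprod0r.
  by rewrite va_linr Cx// Cy// scaler0 addr0.
- by move=> u m _; exact: va_creat.
move=> a n b Ca Cb u [m|//] Wu _.
have ua (i : nat) : nprod u i%:Z a = 0 by exact: Ca.
by rewrite (commute_modes ua) Cb// nprod0r.
Qed.

(** For fixed [v], the vectors whose nonnegative modes all kill [v] form a vertex subalgebra, so it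
    is enough to test generators. *)
Lemma Comm_generatedP (A : set V) v :
  Comm (generated_va A) v <-> forall u (m : nat), A u -> nprod u m%:Z v = 0.
Proof.
split=> [Cv u m Au|Av]; first by apply: Cv => // S _ AS; exact: AS.
move=> u m; case: m => [m|//] /(_ [set u | forall m : nat, nprod u m%:Z v = 0]) Su _.
apply: Su => [|w Aw n]; last exact: Av.
split; first split.
- by move=> n; exact: nprod0l.
- by move=> c x y x0 y0 n /=; rewrite va_linl x0 y0 scaler0 addr0.
- by move=> n; rewrite va_vacl.
move=> a n b a0 b0 k /=; apply: iterate_zero => i; last by rewrite a0 nprod0r.
by rewrite -PoszD b0 nprod0r.
Qed.

(** The Borcherds identity with upper index [P] beyond the truncation of [b] on [x] loses all terms
    ending in a mode of [b]. It expresses [b(m) a(q) x] by modes of products and by terms with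
    larger [q], so a descending induction on [q] from the truncation of [a] concludes. *)
Lemma subspace_span_modes x b l y :
  lspan [set z | exists a k, z = nprod a k x] y ->
  lspan [set z | exists a k, z = nprod a k x] (nprod b l y).
Proof.
set S := lspan _; have subS : subspace S := @subspace_lspan _ _ _.
apply: (lspan_map (va_linr b l) subS) => _ [a [k ->]].
have [P bP] := va_trunc b x; have [k1 ak1] := va_trunc a x.
suff E (d : nat) q m : k1 - d%:Z <= q -> S (nprod b m (nprod a q x)).
  by apply: (E `|k1 - k|%N); lia.
elim: d q m => [|d IHd] q m le_q.
  by rewrite ak1 ?nprod0r; [exact: subspace0 | lia].
have [k0] := @va_borcherds C V b a x P q (m - P) I I.
move=> /(_ k0.+1 (leqnSn _)) E.
have : S (\sum_(i < k0.+1)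
  binz C P i *: nprod (nprod b (m - P + i%:Z) a) (P + q - i%:Z) x).
  apply: subspace_sum_ord => // i; apply: subspaceZ => //.
  by apply: lspan_sub; exists (nprod b (m - P + i%:Z) a), (P + q - i%:Z).
rewrite E big_ord_recl /= binz0 expr0 mulr1 scale1r ?posz0 ?addr0 ?subr0.
rewrite bP// nprod0r scaler0 subr0 addrC [P + (m - P)]addrC subrK => /(subspaceB subS).
set Sum := \sum_(_ | _) _ => H.
rewrite -[nprod b m _](addrK Sum) [_ + Sum]addrC; apply: H.
apply: subspace_sum_ord => // i; apply: subspaceZ => //.
rewrite bP ?nprod0r ?scaler0 ?subr0; last by lia.
by apply: IHd; rewrite /= /bump; lia.
Qed.

End VertexAlgebra.

(** * Heisenberg fields and vacuum vectors *)

Section HeisenbergDefs.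
Variables (C : numFieldType) (W : vertexAlgebra C) (X : lmodType C).
Variables (HX : set X) (frm : X -> X -> C) (j : X -> W).

Record heisenberg : Prop := Heisenberg {
  heis_sub : subspace HX;
  heis_lin : linear_on HX j;
  heis_sym : forall h h', HX h -> HX h' -> frm h h' = frm h' h;
  heis_bil : forall c x y z, HX x -> HX y -> HX z ->
    frm (c *: x + y) z = c * frm x z + frm y z;
  heis_ope : forall h h' (n : nat), HX h -> HX h' ->
    nprod (j h) n%:Z (j h') = if n == 1%N then frm h h' *: vac W else 0 }.

(** Two families are kept because [rho] and [sigma] are isotropic and dual to each other. Their
    existence also stands for nondegeneracy of the form. *)
Record dual_bases (I : finType) (f g : I -> X) : Prop := DualBases {
  dual_f : forall i, HX (f i);
  dual_g : forall i, HX (g i);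
  dual_frm : forall i k, frm (g i) (f k) = (i == k)%:R;
  dual_span : forall h, HX h -> exists c : I -> C, h = \sum_i c i *: f i }.

Definition weight_vector (mu : X) (x : W) : Prop :=
  forall h, HX h -> nprod (j h) 0 x = frm h mu *: x.

Definition highest_weight (mu : X) (x : W) : Prop :=
  forall h (n : nat), HX h ->
    nprod (j h) n%:Z x = if n == 0%N then frm h mu *: x else 0.

Definition locally_nilpotent (x : W) : Prop :=
  forall h (n : nat), HX h -> exists k, iter k (nprod (j h) n.+1%:Z) x = 0.

Inductive fock_span (O : set W) : W -> Prop :=
| fock_span0 : fock_span O 0
| fock_span_lin c x y :
    fock_span O x -> fock_span O y -> fock_span O (c *: x + y)
| fock_span_gen x : O x -> fock_span O x
| fock_span_creation h (n : nat) x : HX h -> fock_span O x ->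
    fock_span O (nprod (j h) (- n.+1%:Z) x).

Lemma subspace_fock_span O : subspace (fock_span O).
Proof. by split; [exact: fock_span0 | exact: fock_span_lin]. Qed.

End HeisenbergDefs.

Section Heisenberg.
Variables (C : numFieldType) (W : vertexAlgebra C) (X : lmodType C).
Variables (HX : set X) (frm : X -> X -> C) (j : X -> W).
Hypothesis hH : heisenberg HX frm j.

Local Notation weight_vector := (weight_vector HX frm j).
Local Notation highest_weight := (highest_weight HX frm j).
Local Notation locally_nilpotent := (locally_nilpotent HX j).
Local Notation fock_span := (fock_span HX j).
Let subH := heis_sub hH.

Lemma heis_frmDr z x y c : HX z -> HX x -> HX y ->
  frm z (c *: x + y) = c * frm z x + frm z y.
Proof.
move=> Hz Hx Hy; rewrite !(heis_sym hH Hz)//; last exact: subH.2.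
exact: (heis_bil hH).
Qed.

Lemma heis_frm0r z : HX z -> frm z 0 = 0.
Proof.
move=> Hz; have H0 := subspace0 subH.
by have := heis_frmDr (-1) Hz H0 H0; rewrite scaler0 addr0 mulN1r addNr.
Qed.

Lemma heis_frmZr z x c : HX z -> HX x -> frm z (c *: x) = c * frm z x.
Proof.
move=> Hz Hx; have H0 := subspace0 subH.
by have := heis_frmDr c Hz Hx H0; rewrite !addr0 heis_frm0r// addr0.
Qed.

Lemma heis_frmBr z x y : HX z -> HX x -> HX y -> frm z (x - y) = frm z x - frm z y.
Proof.
move=> Hz Hx Hy; rewrite addrC -scaleN1r heis_frmDr//.
by rewrite mulN1r addrC.
Qed.

Lemma heis_frm_suml (I : finType) (F : I -> X) (c : I -> C) z :
  (forall i, HX (F i)) -> HX z ->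
  frm (\sum_i c i *: F i) z = \sum_i c i * frm (F i) z.
Proof.
move=> HF Hz; rewrite (heis_sym hH)//; last first.
  by apply: (subspace_sum subH) => i _; exact: subspaceZ.
elim: (index_enum I) => [|i r IHr]; first by rewrite !big_nil heis_frm0r.
rewrite !big_cons heis_frmDr// ?IHr ?(heis_sym hH Hz)//.
by apply: (subspace_sum subH) => k _; exact: subspaceZ.
Qed.

Lemma heis_commutator h h' p q x : HX h -> HX h' ->
  nprod (j h) p (nprod (j h') q x) = nprod (j h') q (nprod (j h) p x)
    + (if p + q == 0 then p%:~R * frm h h' else 0) *: x.
Proof.
move=> Hh Hh'; rewrite (@commutator _ _ (j h) (j h') 0 (frm h h' *: vac W)).
- rewrite nprod0l addr0 nprodZl va_vacl; congr (_ + _).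
  rewrite (_ : (p + q - 1 == -1) = (p + q == 0)); last by apply/eqP/eqP; lia.
  by case: ifP => _; rewrite ?scalerA// !scaler0 scale0r.
- exact: (heis_ope hH 0%N).
- exact: (heis_ope hH 1%N).
- by move=> [|[|i]]// _; rewrite (heis_ope hH i.+2).
Qed.

Lemma heis_zero_mode h h' q x : HX h -> HX h' ->
  nprod (j h) 0 (nprod (j h') q x) = nprod (j h') q (nprod (j h) 0 x).
Proof.
move=> Hh Hh'; rewrite heis_commutator// mulr0z mul0r.
by set c : C := (if _ then _ else _); have -> : c = 0; rewrite /c ?if_same// scale0r addr0.
Qed.

Lemma highest_weight_commutator mu b h p q x : highest_weight mu b -> HX h ->
  nprod (j h) p (nprod b q x) =
  nprod b q (nprod (j h) p x) + frm h mu *: nprod b (p + q) x.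
Proof.
move=> hb Hh; rewrite (@commutator _ _ (j h) b (frm h mu *: b) 0).
- by rewrite nprod0l scaler0 addr0 nprodZl.
- exact: (hb h 0%N).
- exact: (hb h 1%N).
- by move=> [|[|i]]// _; rewrite (hb h i.+2).
Qed.

Lemma highest_weight_weight mu x : highest_weight mu x -> weight_vector mu x.
Proof. by move=> hx h Hh; exact: (hx h 0%N). Qed.

Lemma weight_vector_mode mu h p x : HX h -> weight_vector mu x ->
  weight_vector mu (nprod (j h) p x).
Proof.
by move=> Hh wx h' Hh'; rewrite heis_zero_mode// wx// nprodZr.
Qed.

Lemma subspace_highest_weight mu : subspace (highest_weight mu).
Proof.
split=> [h n _|c x y hx hy h n Hh]; first by rewrite nprod0r scaler0 if_same.
rewrite va_linr hx// hy//; case: ifP => _; last by rewrite scaler0 addr0.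
by rewrite scalerDr !scalerA mulrC.
Qed.

Lemma subspace_weight_vector mu : subspace (weight_vector mu).
Proof.
split=> [h _|c x y hx hy h Hh]; first by rewrite nprod0r scaler0.
by rewrite va_linr hx// hy// scalerDr !scalerA mulrC.
Qed.

Lemma commutant_highest_weight x :
  Comm (generated_va (j @` HX)) x <-> highest_weight 0 x.
Proof.
split=> [/Comm_generatedP Cx h n Hh|hx].
  by rewrite Cx; [rewrite heis_frm0r// scale0r if_same|exists h].
apply/Comm_generatedP => _ n [h Hh <-].
by rewrite hx// heis_frm0r// scale0r if_same.
Qed.

Lemma iter_mode_add (f : W -> W) n m x : linear f -> iter n f x = 0 ->
  (n <= m)%N -> iter m f x = 0.
Proof.
move=> lf fx nm; rewrite -(subnK nm) iterD fx.
by rewrite (lfun0 (linear_iter lf _)).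
Qed.

Lemma subspace_locally_nilpotent : subspace locally_nilpotent.
Proof.
split=> [h n _|c x y nx ny h n Hh]; first by exists 0%N.
have [k xk] := nx h n Hh; have [l yl] := ny h n Hh; exists (k + l)%N.
have lin := va_linr (j h) n.+1%:Z.
rewrite (linear_iter lin) (iter_mode_add lin xk) ?leq_addr//.
by rewrite (iter_mode_add lin yl) ?leq_addl// scaler0 addr0.
Qed.

Lemma highest_weight_nilpotent mu x : highest_weight mu x -> locally_nilpotent x.
Proof. by move=> hx h n Hh; exists 1%N; rewrite /= (hx h n.+1). Qed.

(** The commutator of the two modes is a scalar, so one more power of the annihilation mode
    suffices. *)
Lemma locally_nilpotent_mode h p x : HX h -> locally_nilpotent x ->
  locally_nilpotent (nprod (j h) p x).
Proof.
move=> Hh nx h' n Hh'; have [k xk] := nx h' n Hh'; exists k.+1.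
set B := nprod (j h') _; set c := if n.+1%:Z + p == 0 then n.+1%:~R * frm h' h else 0.
have BA y : B (nprod (j h) p y) = nprod (j h) p (B y) + c *: y.
  by rewrite /B heis_commutator.
have linB : linear B := va_linr _ _.
have E l : iter l.+1 B (nprod (j h) p x) =
    nprod (j h) p (iter l.+1 B x) + (c * l.+1%:R) *: iter l B x.
  elim: l => [|l IHl]; first by rewrite /= BA mulr1.
  rewrite [LHS]iterS IHl (lfunD linB) BA (lfunZ linB) -addrA.
  rewrite -[B (iter l B x)]/(iter l.+1 B x) -scalerDl.
  by congr (_ + _ *: _); rewrite -[l.+2%:R]natr1 mulrDr mulr1 addrC.
by rewrite E xk scaler0 addr0 iterS xk /B !nprod0r.
Qed.

Lemma fock_span_nilpotent (O : set W) x :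
  (forall y, O y -> exists mu, highest_weight mu y) ->
  fock_span O x -> locally_nilpotent x.
Proof.
move=> hO; elim=> {x} [|c x y _ nx _ ny|x /hO[mu]|h n x Hh _].
- exact: (subspace0 subspace_locally_nilpotent).
- exact: subspace_locally_nilpotent.2.
- exact: highest_weight_nilpotent.
- exact: locally_nilpotent_mode.
Qed.

(** * Normalised oscillators and weight decompositions from dual bases *)

Section DualBases.
Variables (I : finType) (f g : I -> X).
Hypothesis fgP : dual_bases HX frm f g.

(** The factor turns [[h(n), h'(-n)] = n <h,h'>] into the canonical relation assumed for the Fock
    projections. *)
Definition creation (t : I * nat) (x : W) : W :=
  t.2.+1%:R^-1 *: nprod (j (f t.1)) (- t.2.+1%:Z) x.

Definition annihilation (t : I * nat) (x : W) : W :=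
  nprod (j (g t.1)) t.2.+1%:Z x.

Lemma creation_linear t : linear (creation t).
Proof.
by move=> c x y; rewrite /creation va_linr scalerDr !scalerA mulrC.
Qed.

Lemma annihilation_linear t : linear (annihilation t).
Proof. exact: va_linr. Qed.

Lemma annihilation_creation t x :
  annihilation t (creation t x) = creation t (annihilation t x) + x.
Proof.
rewrite /annihilation /creation nprodZr heis_commutator; last first.
- exact: (dual_f fgP).
- exact: (dual_g fgP).
rewrite subrr eqxx (dual_frm fgP) eqxx mulr1 scalerDr scalerA.
by rewrite mulVf ?scale1r// pnatr_eq0.
Qed.

Lemma annihilation_creation_neq t u x : t != u ->
  annihilation t (creation u x) = creation u (annihilation t x).
Proof.
case: t u => [i n] [k m] tu; rewrite /annihilation /creation nprodZr heis_commutator; last first.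
- exact: (dual_f fgP).
- exact: (dual_g fgP).
rewrite /= (dual_frm fgP); case: eqP => [E|_]; last by rewrite scale0r addr0.
rewrite (_ : i == k = false) ?mulr0 ?scale0r ?addr0//.
apply: contraNF tu => /eqP ->; apply/eqP; congr (_, _); lia.
Qed.

Lemma annihilation_comm t u x :
  annihilation t (annihilation u x) = annihilation u (annihilation t x).
Proof.
rewrite /annihilation heis_commutator; try exact: (dual_g fgP).
rewrite (_ : (_ == 0) = false) ?scale0r ?addr0//; apply/eqP; lia.
Qed.

Lemma creation_comm t u x : creation t (creation u x) = creation u (creation t x).
Proof.
rewrite /creation !nprodZr heis_commutator; try exact: (dual_f fgP).
rewrite (_ : (_ == 0) = false) ?scale0r ?addr0; last by apply/eqP; lia.
by rewrite !scalerA mulrC.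
Qed.

Lemma fock_span_split (O : set W) x :
  (forall y, O y -> exists mu, highest_weight mu y) -> fock_span O x ->
  exists o (l : seq ((I * nat) * W)),
    [/\ lspan O o, forall t, t \in l -> locally_nilpotent t.2
      & x = o + \sum_(t <- l) creation t.1 t.2].
Proof.
move=> hO; elim=> {x} [|c x y _ [o [l [Oo nl ->]]] _ [o' [l' [Oo' nl' ->]]]|x Ox|h n x Hh Fx _].
- exists 0, [::]; split=> //; first exact: (subspace0 (subspace_lspan O)).
  by rewrite big_nil addr0.
- exists (c *: o + o'), ([seq (t.1, c *: t.2) | t <- l] ++ l'); split.
  + exact: (subspace_lspan O).2.
  + move=> t; rewrite mem_cat => /orP[/mapP[u ul ->]|/nl'//].
    exact: (subspaceZ subspace_locally_nilpotent _ (nl _ ul)).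
  rewrite big_cat big_map /= scalerDr addrACA scaler_sumr; congr (_ + (_ + _)).
  by apply: eq_bigr => t _; rewrite (lfunZ (creation_linear _)).
- exists x, [::]; split=> //; first exact: lspan_sub.
  by rewrite big_nil addr0.
have [c hE] := dual_span fgP Hh.
(* Expand [h] in the basis [f]; the factor [n.+1] cancels the normalisation of [creation]. *)
exists 0, [seq ((i, n), (n.+1%:R * c i) *: x) | i <- index_enum I]; split.
- exact: (subspace0 (subspace_lspan O)).
- move=> _ /mapP[i _ ->]; apply: (subspaceZ subspace_locally_nilpotent).
  exact: fock_span_nilpotent Fx.
rewrite add0r big_map {1}hE (lon_sum subH (heis_lin hH)) => [|i _]; last first.
  exact/(subspaceZ subH)/(dual_f fgP).
rewrite (lfun_sum (va_linl _ x)); apply: eq_bigr => i _.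
rewrite (lonZ subH (heis_lin hH))//; last exact: (dual_f fgP).
by rewrite /creation/= nprodZl nprodZr scalerA mulrA mulVf ?mul1r// pnatr_eq0.
Qed.

(** [Inv] records what has to survive when creation terms are dropped, such as equality with a given
    vector or its class modulo [P]. *)
Lemma fock_span_reduce (O : set W) (Inv : W -> Prop) x :
  (forall y, O y -> exists mu, highest_weight mu y) -> fock_span O x ->
  (forall t k y, Inv y -> Inv (fock_proj creation annihilation t k.+1 y)) ->
  Inv x -> exists o, lspan O o /\ Inv o.
Proof.
move=> hO Fx Inv_proj; have [o [l [Oo nl ->]]] := fock_span_split hO Fx => Inv_x.
exists o; split=> //; move: (Inv_x); apply: (@fock_reduce _ _ _ creation annihilation) => //.
- exact: creation_linear.
- exact: annihilation_linear.
- exact: annihilation_creation.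
- exact: annihilation_creation_neq.
- exact: creation_comm.
- exact: annihilation_comm.
- move=> t; apply: (lspan_map (annihilation_linear t) (@subspace_zero _ W) _ Oo).
  move=> y /hO[mu hy]; rewrite /annihilation hy//; exact: (dual_g fgP).
- by move=> t tl; apply: (nl _ tl); exact: (dual_g fgP).
Qed.

Lemma fock_span_vacuum (O : set W) x :
  (forall y, O y -> exists mu, highest_weight mu y) -> fock_span O x ->
  (forall h (n : nat), HX h -> nprod (j h) n.+1%:Z x = 0) -> lspan O x.
Proof.
move=> hO Fx x0.
have [||o [Oo xo]] := @fock_span_reduce O (eq x) x hO Fx; [|by []|by rewrite xo].
move=> t k y <-; rewrite fock_proj_id//; first exact: creation_linear.
  exact: annihilation_linear.
by apply: x0; exact: (dual_g fgP).
Qed.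

Lemma weight_separation mu nu : HX mu -> HX nu ->
  (forall h, HX h -> frm h mu = frm h nu) -> mu = nu.
Proof.
move=> Hmu Hnu E; have [c muE] := dual_span fgP Hmu.
have [d nuE] := dual_span fgP Hnu; rewrite muE nuE; apply: eq_bigr => i _.
have coord (a : I -> C) : frm (g i) (\sum_k a k *: f k) = a i.
  rewrite (heis_sym hH) ?heis_frm_suml; try exact: (dual_g fgP); last first.
  - by apply: (subspace_sum subH) => k _; exact/(subspaceZ subH)/(dual_f fgP).
  - exact: (dual_f fgP).
  rewrite (bigD1 i)//= big1 ?addr0 => [|k ki].
    by rewrite (heis_sym hH) ?(dual_frm fgP) ?eqxx ?mulr1//;
      [exact: (dual_f fgP)|exact: (dual_g fgP)].
  rewrite (heis_sym hH) ?(dual_frm fgP)//; [|exact: (dual_f fgP)|exact: (dual_g fgP)].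
  by rewrite eq_sym (negPf ki) mulr0.
by rewrite -(coord c) -muE E ?nuE ?coord//; exact: (dual_g fgP).
Qed.

Lemma weight_component (S : set W) (s : seq X) (F : X -> W) :
  subspace S -> (forall h x, HX h -> S x -> S (nprod (j h) 0 x)) ->
  uniq s -> (forall mu, mu \in s -> HX mu /\ weight_vector mu (F mu)) ->
  S (\sum_(mu <- s) F mu) -> forall mu, mu \in s -> S (F mu).
Proof.
move=> subS stabS us wF.
apply: (@weight_components _ _ S X HX X (fun h => nprod (j h) 0) frm s F) => //.
- by move=> h Hh; exact: va_linr.
- by move=> h mu Hh /wF[_]; exact.
move=> mu nu /wF[Hmu _] /wF[Hnu _] munu; apply: contrapT => nex.
move/eqP: munu; apply; apply: weight_separation => // h Hh.
by apply/eqP/negPn/negP => ne; apply: nex; exists h.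
Qed.

(** The independence of weight vectors is applied to the differences between [F] and the family
    concentrated at [lam]. The weight [lam] is added to the list because it is not yet known to
    occur in [s]. *)
Lemma weight_component_eq lam x (s : seq X) (F : X -> W) :
  HX lam -> weight_vector lam x ->
  uniq s -> (forall mu, mu \in s -> HX mu /\ weight_vector mu (F mu)) ->
  x = \sum_(mu <- s) F mu ->
  (forall mu, mu \in s -> F mu = if mu == lam then x else 0) /\
  (x != 0 -> lam \in s).
Proof.
move=> Hlam wx us wF xE.
pose G mu := (if mu \in s then F mu else 0) - (if mu == lam then x else 0).
have G0 mu : mu \in undup (lam :: s) -> G mu = 0.
  apply: (@weight_component [set 0]) => //.
  - exact: subspace_zero.
  - by move=> h y _ ->; exact: nprod0r.
  - exact: undup_uniq.
  - move=> nu; rewrite mem_undup inE /G => nus; split.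
      by case/orP: nus => [/eqP->//|/wF[]].
    apply: (subspaceB (subspace_weight_vector nu)).
      by case: ifP => [/wF[]//|_]; exact: (subspace0 (subspace_weight_vector nu)).
    by case: eqP => [->//|_]; exact: (subspace0 (subspace_weight_vector nu)).
  change (\sum_(a <- undup (lam :: s)) G a = 0).
  rewrite sumrB -!big_mkcond -[X in X - _]big_filter -[X in _ - X]big_filter.
  rewrite [X in \sum_(_ <- X) x](_ : _ = [:: lam]) ?big_seq1; last first.
    rewrite -(@filter_pred1_uniq _ (undup (lam :: s)) lam) ?undup_uniq//.
    by rewrite mem_undup mem_head.
  apply/eqP; rewrite subr_eq0 xE; apply/eqP/perm_big/uniq_perm => //.
  - exact/filter_uniq/undup_uniq.
  - by move=> nu; rewrite mem_filter mem_undup inE; case: (nu \in s); rewrite ?orbT.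
split=> [mu mus|x0].
  have := G0 mu; rewrite mem_undup inE mus orbT /G mus => /(_ isT)/eqP.
  by rewrite subr_eq0 => /eqP.
apply: contraNT x0 => ls; have := G0 lam.
rewrite mem_undup mem_head /G (negPf ls) eqxx sub0r => /(_ isT)/eqP.
by rewrite oppr_eq0.
Qed.

End DualBases.
End Heisenberg.

(** * Even lattices and their vertex algebras *)

Section EvenLattice.
Variables (C : numFieldType) (X : lmodType C) (frm : X -> X -> C) (L : set X).
Hypothesis L_even : even_lattice frm L.

Lemma zbasis_lattice : exists d (b : 'I_d -> X), zbasis L b.
Proof. by case: L_even. Qed.

Lemma zbasis_mem d (b : 'I_d -> X) : zbasis L b -> forall i, L (b i).
Proof.
move=> [_ ->] i; exists (fun k => (k == i)%:Z).
rewrite (bigD1 i)//= eqxx scale1r big1 ?addr0// => k /negPf ->.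
by rewrite scale0r.
Qed.

Lemma lattice0 : L 0.
Proof.
have [d [b [_ ->]]] := zbasis_lattice; exists (fun=> 0).
by rewrite big1// => i _; rewrite scale0r.
Qed.

Lemma latticeB u v : L u -> L v -> L (u - v).
Proof.
have [d [b [_ ->]]] := zbasis_lattice => -[m ->] [n ->].
exists (fun i => m i - n i); rewrite -sumrB; apply: eq_bigr => i _.
by rewrite intrD intrN scalerBl.
Qed.

Lemma latticeN u : L u -> L (- u).
Proof. by rewrite -sub0r; apply: latticeB; exact: lattice0. Qed.

Lemma lattice_int u v : L u -> L v -> is_int (frm u v).
Proof. by case: L_even => _ LL _ _; exact: LL. Qed.

Lemma zbasis_coordinates d (b : 'I_d -> X) h : zbasis L b -> lspan L h ->
  exists c : 'I_d -> C, h = \sum_i c i *: b i.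
Proof.
move=> zb; apply: (@lspan_min _ _ _ [set h | exists c : 'I_d -> C, h = \sum_i c i *: b i]).
- split; first by exists (fun=> 0); rewrite big1// => i _; rewrite scale0r.
  move=> c _ _ [a ->] [a' ->]; exists (fun i => c * a i + a' i).
  rewrite scaler_sumr -big_split; apply: eq_bigr => i _ /=.
  by rewrite scalerDl scalerA.
- by case: zb => _ -> _ [n ->]; exists (fun i => (n i)%:~R).
Qed.

Section Gram.
Variables (W : vertexAlgebra C) (j : X -> W).
Hypothesis hH : heisenberg (lspan L) frm j.
Variables (d : nat) (b : 'I_d -> X) (zb : zbasis L b).

Let gram : 'M[C]_d := \matrix_(i, k) frm (b i) (b k).
Let Hb i : lspan L (b i). Proof. by apply: lspan_sub; exact: zbasis_mem. Qed.

Let Hsum (c : 'I_d -> C) : lspan L (\sum_i c i *: b i).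
Proof.
apply: (subspace_sum (subspace_lspan L)) => i _.
by apply: (subspaceZ (subspace_lspan L)); exact: Hb.
Qed.

Let frm_gram (c : 'I_d -> C) k :
  frm (\sum_i c i *: b i) (b k) = ((\row_i c i) *m gram) 0 k.
Proof.
by rewrite (heis_frm_suml hH)// mxE; apply: eq_bigr => i _; rewrite !mxE.
Qed.

(** A kernel vector yields a combination of the basis orthogonal to the whole complexified lattice,
    hence zero by nondegeneracy. *)
Lemma gram_unit : gram \in unitmx.
Proof.
rewrite -row_free_unit -kermx_eq0; apply/eqP/row_matrixP => i; rewrite row0.
set u := row i _; have uG : u *m gram = 0 by rewrite /u -row_mul mulmx_ker row0.
have uE : u = \row_k u 0 k by apply/rowP => k; rewrite mxE.
have u0 : \sum_k u 0 k *: b k = 0.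
  case: L_even => _ _ _; apply; first exact: Hsum.
  move=> v /(zbasis_coordinates zb)[c ->].
  rewrite (heis_sym hH) ?(heis_frm_suml hH)//; try exact: Hsum.
  rewrite big1// => k _.
  by rewrite (heis_sym hH)// frm_gram -uE uG mxE mulr0.
apply/rowP => k; have [indep _] := zb.
by have -> := indep (fun k => u 0 k) u0 k; rewrite mxE.
Qed.

Lemma lattice_dual_bases : exists g : 'I_d -> X, dual_bases (lspan L) frm b g.
Proof.
exists (fun k => \sum_i invmx gram k i *: b i); split.
- exact: Hb.
- by move=> k; exact: Hsum.
- move=> k l; rewrite frm_gram.
  have -> : (\row_i invmx gram k i) = row k (invmx gram) by apply/rowP => i; rewrite !mxE.
  by rewrite -row_mul mulVmx ?gram_unit// !mxE.
- by move=> h; exact: zbasis_coordinates.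
Qed.

(* Cramer's rule: the determinant of the Gram matrix annihilates [L^*/L]. *)
Lemma dual_multiple_aux mu : lspan L mu -> (forall v, L v -> is_int (frm mu v)) ->
  exists2 c : nat, (0 < c)%N & L (c%:R *: mu).
Proof.
move=> Hmu mu_int; have [c muE] := zbasis_coordinates zb Hmu.
have [G GE] : exists G : 'M[int]_d, gram = map_mx intr G.
  have E i : exists r : 'I_d -> int, forall k, frm (b i) (b k) = (r k)%:~R.
    have H k : exists r : int, frm (b i) (b k) = r%:~R.
      exact: (lattice_int (zbasis_mem zb i) (zbasis_mem zb k)).
    by have [r rE] := choice H; exists r.
  have [r rE] := choice E; exists (\matrix_(i, k) r i k).
  by apply/matrixP => i k; rewrite !mxE rE.
have [n nE] : exists n : 'rV[int]_d, (\row_i c i) *m gram = map_mx intr n.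
  have [n nE] : exists n : 'I_d -> int, forall k, frm mu (b k) = (n k)%:~R.
    have H k : exists r : int, frm mu (b k) = r%:~R.
      by apply: mu_int; exact: zbasis_mem.
    by have [r rE] := choice H; exists r.
  by exists (\row_k n k); apply/rowP => k; rewrite -frm_gram -muE nE !mxE.
have detG : \det G != 0.
  have := gram_unit; rewrite unitmxE GE det_map_mx unitfE.
  by apply: contra_neq => ->.
have L_det : L ((\det G)%:~R *: mu).
  have [_ ->] := zb; exists (fun i => (n *m \adj G) 0 i).
  rewrite {1}muE scaler_sumr; apply: eq_bigr => i _; rewrite scalerA; congr (_ *: _).
  have : \row_i c i *m gram *m \adj gram = map_mx intr (n *m \adj G).
    by rewrite nE GE map_mxM map_mx_adj.
  rewrite -mulmxA mul_mx_adj mul_mx_scalar GE det_map_mx.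
  by move=> /rowP/(_ i); rewrite !mxE => ->; rewrite rmorph_sum/=;
       apply: eq_bigr => k _; rewrite !mxE.
exists `|\det G|%N; first by rewrite absz_gt0.
case: (intP (\det G)) L_det detG => [|m|m] // + _.
by rewrite mulrNz scaleNr => /latticeN; rewrite opprK abszN.
Qed.

End Gram.
End EvenLattice.

Lemma dual_multiple (C : numFieldType) (X : lmodType C) (frm : X -> X -> C)
    (L : set X) (W : vertexAlgebra C) (j : X -> W) mu :
  even_lattice frm L -> heisenberg (lspan L) frm j ->
  lspan L mu -> (forall v, L v -> is_int (frm mu v)) ->
  exists2 c : nat, (0 < c)%N & L (c%:R *: mu).
Proof.
move=> L_even hH; have [d [b zb]] := zbasis_lattice L_even.
exact: (dual_multiple_aux L_even hH zb).
Qed.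

Section LatticeVertexAlgebra.
Variables (C : numFieldType) (X : lmodType C) (frm : X -> X -> C) (L : set X).
Variables (W : vertexAlgebra C) (S : set W) (j e : X -> W).
Hypothesis hH : heisenberg (lspan L) frm j.
Hypothesis L_even : even_lattice frm L.
Hypothesis L_va : lattice_va frm L S j e.
Local Notation highest_weight := (highest_weight (lspan L) frm j).
Local Notation weight_vector := (weight_vector (lspan L) frm j).

Lemma exp_highest_weight lam : L lam -> highest_weight lam (e lam).
Proof. by case: L_va => _ _ _ _ [+ _ _] Ll h n Hh; apply; rewrite /= ?subr0. Qed.

(** The first Schur polynomial of [beta] is [beta(-1)], and the cocycle value cancels because
    [e beta] is recovered from its mode [-1] on the vacuum. *)
Lemma exp_translation beta : L beta ->
  nprod (e beta) (-2) (vac W) = nprod (j beta) (-1) (e beta).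
Proof.
move=> Lb; have Hb := lspan_sub Lb; case: L_va => _ e0 _ _ [_ [eps epsP] _].
have [||_ E _] := epsP beta 0 0 Lb; rewrite /= ?subr0 ?(heis_frm0r hH)//.
  exact: (lattice0 L_even).
have E0 : nprod (e beta) (-1) (vac W) = eps beta 0 *: e beta.
  by have := E 0%N; rewrite /schur /= e0 !addr0.
have E1 : nprod (e beta) (-2) (vac W) = eps beta 0 *:
    (1^-1 *: \sum_(i < 1) nprod (j beta) (- i.+1%:Z) [:: e beta]`_i).
  by have := E 1%N; rewrite /schur /= e0 !addr0.
by rewrite E1 invr1 scale1r big_ord1 /= -nprodZr -E0 va_vacr.
Qed.

Lemma exp_product beta gam (k : int) : L beta -> L gam ->
  frm beta gam = k%:~R ->
  (forall n : int, - k <= n -> nprod (e beta) n (e gam) = 0) /\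
  (exists2 c, c != 0 & nprod (e beta) (- k - 1) (e gam) = c *: e (beta + gam)).
Proof.
move=> Lb Lg bg; case: L_va => _ e0 _ _ [_ [eps epsP] _].
have [||eps0 E E0] := epsP beta gam k Lb; rewrite /= ?subr0//.
split=> //; exists (eps beta gam) => //.
by have := E 0%N; rewrite /schur /= subr0.
Qed.

Lemma exp_neq0 lam : L lam -> e lam != 0.
Proof.
move=> Ll; case: L_va => _ _ _ _ [_ _ [d [b [_ [_ indep]]]]].
apply/eqP => e0; have := indep [:: ([::], lam)] (fun=> 1) isT.
rewrite big_seq1 /= e0 scaler0 => /(_ _ erefl ([::], lam)).
have H1 i : i \in [:: ([::] : seq ('I_d * nat), lam)] ->
    [set i | sorted (@monomial_le d) i.1 /\ [set lam | L (lam - 0)] i.2] i.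
  by rewrite inE => /eqP -> /=; rewrite subr0.
by move=> /(_ H1 (mem_head _ _))/eqP; rewrite oner_eq0.
Qed.

Lemma exp_mem lam : L lam -> S (e lam).
Proof.
move=> Ll; case: L_va => _ _ _ _ [_ _ [d [b [_ [-> _]]]]].
by apply: lspan_sub; exists ([::], lam) => //=; rewrite subr0.
Qed.

Lemma fock_monomial_span d (b : 'I_d -> X) (O : set W) s x :
  (forall i, lspan L (b i)) -> fock_span (lspan L) j O x ->
  fock_span (lspan L) j O (fock_monomial (fun k => nprod (j (b k))) s x).
Proof.
move=> Hb Fx; rewrite /fock_monomial; elim: s => //= t s IHs.
exact: fock_span_creation.
Qed.

Lemma lattice_va_span x : S x ->
  fock_span (lspan L) j [set y | exists lam, L lam /\ y = e lam] x.
Proof.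
case: L_va => _ _ _ _ [_ _ [d [b [zb [-> _]]]]].
apply: lspan_min => [|_ [[s lam] [_ /= Ll] <-]]; first exact: subspace_fock_span.
apply: fock_monomial_span => [i|]; first by apply: lspan_sub; exact: (zbasis_mem zb).
by apply: fock_span_gen; exists lam; split=> //; rewrite -[lam]subr0.
Qed.

(** Membership in [L] or in [Lt] is proved through this: it suffices to exhibit a nonzero vector of
    the given weight in the lattice vertex algebra. *)
Lemma lattice_va_weight mu x : S x -> x != 0 -> lspan L mu ->
  weight_vector mu x -> L mu.
Proof.
move=> Sx x0 Hmu wx; have [d [b zb]] := zbasis_lattice L_even.
have [g fgP] := lattice_dual_bases L_even hH zb.
have : lspan [set y | exists lam, L lam /\ weight_vector lam y] x.
  elim: (lattice_va_span Sx) => {Sx x0 wx x} [|c x y _ Wx _ Wy|x [lam [Ll ->]]|h n x Hh _].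
  - exact: (subspace0 (subspace_lspan _)).
  - exact: (subspace_lspan _).2.
  - apply: lspan_sub; exists lam; split=> //.
    exact: (highest_weight_weight (exp_highest_weight Ll)).
  - apply: (lspan_map (va_linr _ _) (subspace_lspan _)) => y [lam [Ll wy]].
    by apply: lspan_sub; exists lam; split=> //; exact: (weight_vector_mode hH).
move=> /lspan_graded[lam _|s [F [us sF xE]]]; first exact: subspace_weight_vector.
have [|_ /(_ x0)/sF[]//] := weight_component_eq hH fgP Hmu wx us _ xE.
by move=> lam /sF[Ll wF]; split=> //; exact: lspan_sub.
Qed.

Lemma lattice_va_vacuum x : S x -> highest_weight 0 x -> exists c, x = c *: vac W.
Proof.
move=> Sx hx; have [d [b zb]] := zbasis_lattice L_even.
have [g fgP] := lattice_dual_bases L_even hH zb.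
pose O := [set y | exists lam, L lam /\ y = e lam].
have hO y : O y -> exists mu, highest_weight mu y.
  by move=> [lam [Ll ->]]; exists lam; exact: exp_highest_weight.
have : lspan O x.
  apply: (fock_span_vacuum hH fgP hO (lattice_va_span Sx)) => h n Hh.
  by rewrite (hx h n.+1).
move=> Ox; pose Sc lam := [set y | exists c : C, y = c *: e lam].
have : lspan [set y | exists lam, L lam /\ Sc lam y] x.
  apply: (lspan_min (subspace_lspan _) _ Ox) => _ [lam [Ll ->]].
  by apply: lspan_sub; exists lam; split=> //; exists 1; rewrite scale1r.
move=> /lspan_graded[lam _|s [F [us sF xE]]].
  split; first by exists 0; rewrite scale0r.
  by move=> c _ _ [a ->] [b' ->]; exists (c * a + b'); rewrite scalerDl scalerA.
have H0 : lspan L 0 := lspan_sub (lattice0 L_even).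
have [|FE] := weight_component_eq hH fgP H0 (highest_weight_weight hx) us _ xE.
  move=> lam /sF[Ll [c ->]]; split; first exact: lspan_sub.
  apply: (subspaceZ (subspace_weight_vector _ _ _ _)).
  exact: (highest_weight_weight (exp_highest_weight Ll)).
have [-> _|_ /(_ isT) s0] := eqVneq x 0; first by exists 0; rewrite scale0r.
have := FE 0 s0; rewrite eqxx => <-; case: (sF _ s0) => _ [c ->].
by exists c; case: L_va => _ ->.
Qed.

End LatticeVertexAlgebra.

(** The form may be defined by choice, as [voa_form] is, so its symmetry and bilinearity are
    extracted from the products, by comparing multiples of the nonzero vacuum. *)
Lemma lattice_va_heisenberg (C : numFieldType) (X : lmodType C)
    (frm : X -> X -> C) (L : set X) (W : vertexAlgebra C) (S : set W) (j e : X -> W) :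
  vac W != 0 -> lattice_va frm L S j e -> heisenberg (lspan L) frm j.
Proof.
move=> vac0 [_ _ [j_lin _] ope _].
have vacI a b : a *: vac W = b *: vac W -> a = b.
  move=> /eqP; rewrite -subr_eq0 -scalerBl scaler_eq0 (negPf vac0) orbF.
  by rewrite subr_eq0 => /eqP.
split=> //; first exact: subspace_lspan.
- move=> h h' Hh Hh'; apply: vacI.
  have := ope _ _ 1%N Hh' Hh; rewrite /= => <-.
  have H2 i : (1 < i)%N -> nprod (j h) i (j h') = 0.
    by move=> i1; rewrite ope// gtn_eqF.
  (* On the vacuum, the commutator of [h(-1)] and [h'(1)] compares the two orders of the arguments
     of the form. *)
  have := commutator (-1) 1 (vac W) (ope _ _ 0%N Hh Hh') (ope _ _ 1%N Hh Hh') H2.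
  rewrite va_vacr (va_creat (j h')) // (lfun0 (va_linr _ _)).
  rewrite (lfun0 (va_linl _ _)) (lfunZ (va_linl _ _)) va_vacl addr0 /= scaleN1r.
  by move/eqP; rewrite eq_sym subr_eq0 => /eqP.
- move=> c x y z Hx Hy Hz; apply: vacI.
  have Hxy : lspan L (c *: x + y) by exact: (subspace_lspan L).2.
  have frmE u v : lspan L u -> lspan L v -> frm u v *: vac W = nprod (j u) 1 (j v).
    by move=> Hu Hv; rewrite (ope u v 1%N).
  by rewrite scalerDl -scalerA !frmE// j_lin// va_linl.
Qed.

(** * Hyperbolic plane and tensor products *)

Section HyperbolicPlane.
Variable C : numFieldType.
Implicit Types x y z : 'rV[C]_2.

Lemma II_vec0E (a b : C) : II_vec a b 0 0 = a.
Proof. by rewrite mxE. Qed.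

Lemma II_vec_eta x : x = II_vec (x 0 0) (x 0 1).
Proof.
apply/rowP => i; rewrite !mxE; case: eqP => [->//|/eqP i0].
by congr (x _ _); apply/val_inj; case: i i0 => -[|[|]].
Qed.

Lemma II_vecD (a b a' b' : C) : II_vec a b + II_vec a' b' = II_vec (a + a') (b + b').
Proof. by apply/rowP => i; rewrite !mxE; case: ifP. Qed.

Lemma II_vecZ (c a b : C) : c *: II_vec a b = II_vec (c * a) (c * b).
Proof. by apply/rowP => i; rewrite !mxE; case: ifP. Qed.

Lemma II_vec_inj (a b a' b' : C) : II_vec a b = II_vec a' b' -> a = a' /\ b = b'.
Proof.
by move=> E; split; [have := congr1 (fun x : 'rV_2 => x 0 0) E
  | have := congr1 (fun x : 'rV_2 => x 0 1) E]; rewrite !mxE.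
Qed.

Lemma II_formE (a b a' b' : C) :
  II_form (II_vec a b) (II_vec a' b') = - (a * b' + b * a').
Proof. by rewrite /II_form !mxE. Qed.

Lemma II_form_sym x y : II_form x y = II_form y x.
Proof. rewrite /II_form; ring. Qed.

Lemma II_form_bil c x y z : II_form (c *: x + y) z = c * II_form x z + II_form y z.
Proof. rewrite /II_form !mxE; ring. Qed.

Lemma II_zbasis : zbasis (@II_lattice C)
  (fun i : 'I_2 => if i == 0 then II_vec 1 0 else II_vec 0 1).
Proof.
have E (c : 'I_2 -> C) :
    \sum_(i < 2) c i *: (if i == 0 then II_vec 1 0 else II_vec 0 1) = II_vec (c 0) (c 1).
  rewrite big_ord_recl big_ord1 /= !II_vecZ II_vecD !mulr0 !mulr1 addr0 add0r.
  by congr (II_vec _ (c _)); exact: val_inj.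
split=> [c|].
  have z : (0 : 'rV[C]_2) = II_vec 0 0 by apply/rowP => i; rewrite !mxE if_same.
  rewrite E z => /II_vec_inj[c0 c1] i.
  by case: (unliftP 0 i) => [k ->|->]//; rewrite -c1; congr c; apply: val_inj; rewrite /= ord1.
apply/seteqP; split=> [x [a [b ->]]|x [n ->]].
  by exists (fun i => if i == 0 then a else b); rewrite E.
by exists (n 0), (n 1); rewrite E.
Qed.

Lemma II_span x : lspan (@II_lattice C) x.
Proof.
rewrite (II_vec_eta x) -[X in II_vec X _]mulr1 -[X in II_vec _ X]mulr1.
have -> : II_vec (x 0 0 * 1) (x 0 1 * 1) = x 0 0 *: II_vec 1 0 + x 0 1 *: II_vec 0 1.
  by rewrite !II_vecZ II_vecD !mulr0 addr0 add0r.
have subs := @subspace_lspan _ _ (@II_lattice C).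
apply: subs.2; last apply: (subspaceZ subs).
  by apply: lspan_sub; exists 1, 0.
by apply: lspan_sub; exists 0, 1.
Qed.

Lemma II_even : even_lattice (@II_form C) (@II_lattice C).
Proof.
split.
- by exists 2%N; eexists; exact: II_zbasis.
- move=> _ _ [a [b ->]] [a' [b' ->]]; exists (- (a * b' + b * a')).
  by rewrite II_formE intrN intrD !intrM.
- move=> _ [a [b ->]]; exists (- (a * b)).
  by rewrite II_formE mulr2n intrD intrN intrM; ring.
- move=> u _ u0; rewrite (II_vec_eta u).
  have := u0 (II_vec 0 1) (II_span _); have := u0 (II_vec 1 0) (II_span _).
  rewrite [u in II_form u]II_vec_eta !II_formE !mulr0 !mulr1 ?add0r ?addr0.
  move=> /eqP; rewrite oppr_eq0 => /eqP ->.
  move=> /eqP; rewrite oppr_eq0 => /eqP ->.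
  by apply/rowP => i; rewrite !mxE if_same.
Qed.

Variable A : II_va C.

Lemma II_heisenberg : heisenberg (lspan (@II_lattice C)) (@II_form C) (@ii_j C A).
Proof.
have [_ _ [jlin _] ope _] := ii_lattice A; split.
- exact: subspace_lspan.
- exact: jlin.
- by move=> h h' _ _; exact: II_form_sym.
- by move=> c x y z _ _ _; exact: II_form_bil.
- by move=> h h' n Hh Hh'; exact: ope.
Qed.

End HyperbolicPlane.

Lemma big_uniq_support (V : zmodType) (I : eqType) (s t : seq I) (g : I -> V) :
  uniq s -> uniq t -> {subset s <= t} ->
  (forall a, a \in t -> a \notin s -> g a = 0) ->
  \sum_(a <- t) g a = \sum_(a <- s) g a.
Proof.
move=> us ut st g0; rewrite (bigID (mem s))/= [X in _ + X]big_seq_cond.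
rewrite [X in _ + X]big1 ?addr0; last by move=> a /andP[]; exact: g0.
rewrite -big_filter; apply: perm_big; apply: uniq_perm; rewrite ?filter_uniq//.
by move=> a; rewrite mem_filter; case: (boolP (a \in s)) => //= /st ->.
Qed.

Section Tensor.
Variables (C : numFieldType) (V A : vertexAlgebra C) (T : tensor_va V A).
Implicit Types (a c : V) (b d : A).

Lemma tensDl a a' b : tens T (a + a') b = tens T a b + tens T a' b.
Proof. exact: (lfunD ((tens_bilinear T).1 b)). Qed.

Lemma tensDr a b b' : tens T a (b + b') = tens T a b + tens T a b'.
Proof. exact: (lfunD ((tens_bilinear T).2 a)). Qed.

Lemma tensZl k a b : tens T (k *: a) b = k *: tens T a b.
Proof. exact: (lfunZ ((tens_bilinear T).1 b)). Qed.

Lemma tensZr k a b : tens T a (k *: b) = k *: tens T a b.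
Proof. exact: (lfunZ ((tens_bilinear T).2 a)). Qed.

Lemma tens0l b : tens T 0 b = 0.
Proof. exact: (lfun0 ((tens_bilinear T).1 b)). Qed.

Lemma tens0r a : tens T a 0 = 0.
Proof. exact: (lfun0 ((tens_bilinear T).2 a)). Qed.

Lemma tens_eq0 a b : b != 0 -> tens T a b = 0 -> a = 0.
Proof.
move=> b0 ab; apply: contrapT => a0; move/eqP: b0; apply.
apply: (@tens_inj C V A T 1 (fun=> a) (fun=> b) _ _ 0); last by rewrite big_ord1.
move=> c; rewrite big_ord1 => /eqP; rewrite scaler_eq0 => /orP[/eqP c0|/eqP//] i.
by rewrite ord1.
Qed.

Lemma tens_support a b n c d (s : seq int) : uniq s ->
  (forall i, i \notin s -> tens T (nprod a i c) (nprod b (n - 1 - i) d) = 0) ->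
  nprod (tens T a b) n (tens T c d) =
  \sum_(i <- s) tens T (nprod a i c) (nprod b (n - 1 - i) d).
Proof.
move=> us s0; have [k0 E] := tens_nprod T a b n c d.
have [K sK] := seq_int_bound s.
rewrite (E (k0 + K)%N (leq_addr _ _)); set k := (k0 + K)%N.
pose t := [seq i%:Z - k%:Z | i : nat <- iota 0 k.*2.+1].
transitivity (\sum_(i <- t) tens T (nprod a i c) (nprod b (n - 1 - i) d)).
  rewrite big_map -[iota _ _]/(index_iota 0 k.*2.+1).
  by rewrite (big_mkord xpredT (fun i : nat =>
      tens T (nprod a (i%:Z - k%:Z) c) (nprod b (n - 1 - (i%:Z - k%:Z)) d))).
apply: big_uniq_support => //.
- rewrite map_inj_in_uniq ?iota_uniq// => i l _ _ /addIr; by case.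
- move=> i /sK iK; apply/mapP; exists (absz (i + k%:Z)); rewrite ?mem_iota; lia.
- by move=> i _; exact: s0.
Qed.

Lemma tens_actl a n c d :
  nprod (tens T a (vac A)) n (tens T c d) = tens T (nprod a n c) d.
Proof.
rewrite (@tens_support _ _ _ _ _ [:: n])// ?big_seq1 => [|i].
  by rewrite va_vacl (_ : n - 1 - n = -1) ?eqxx//; lia.
rewrite inE va_vacl => ni; rewrite (_ : _ == _ = false) ?tens0r//.
by apply/eqP; lia.
Qed.

Lemma tens_actr b n c d :
  nprod (tens T (vac V) b) n (tens T c d) = tens T c (nprod b n d).
Proof.
rewrite (@tens_support _ _ _ _ _ [:: -1])// ?big_seq1 => [|i].
  by rewrite va_vacl eqxx (_ : n - 1 - -1 = n)//; lia.
by rewrite inE va_vacl => /negPf ->; rewrite tens0l.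
Qed.

Lemma tens_translation a b : nprod (tens T a b) (-2) (vac T) =
  tens T a (nprod b (-2) (vac A)) + tens T (nprod a (-2) (vac V)) b.
Proof.
rewrite tens_vac (@tens_support _ _ _ _ _ [:: -1; -2])//.
  by rewrite big_cons big_seq1 (_ : -2 - 1 - -1 = -2)// (_ : -2 - 1 - -2 = -1)// !va_vacr.
move=> i; rewrite !inE => i_neq.
have [i0|i0] := leP 0 i; first by rewrite va_creat// tens0l.
by rewrite [X in tens T _ X]va_creat ?tens0r//; lia.
Qed.

Lemma tens_ind (S : set T) : subspace S -> (forall a b, S (tens T a b)) ->
  forall x, S x.
Proof.
move=> subS Sab x; have : tensor_image (tens T) x by rewrite tens_span.
by apply: lspan_min => // _ [a [b ->]].
Qed.

End Tensor.

(** * The coset decomposition of V *)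

(** A transversal containing [beta] makes the summand indexed by [beta] itself available. The
    representative is chosen from a set that depends only on the coset, hence is constant on
    cosets. *)
Lemma transversal_through (C : numFieldType) (X : lmodType C) (L Ls : set X) beta :
  L 0 -> (forall u v, L u -> L v -> L (u - v)) -> Ls beta ->
  exists2 T, Defs.transversal L Ls T & T beta.
Proof.
move=> L0 LB Lsb.
have LC u v : L (u - v) -> L (v - u).
  by move=> /(LB _ _ L0); rewrite sub0r opprB.
have LT u v w : L (u - v) -> L (v - w) -> L (u - w).
  by move=> Luv /LC Lwv; have := LB _ _ Luv Lwv; rewrite opprB addrA subrK.
pose r u := if `[< L (u - beta) >] then beta
            else xget 0 [set t | Ls t /\ L (u - t)].
have rE u v : L (u - v) -> r u = r v.
  move=> Luv; rewrite /r (_ : `[< L (u - beta) >] = `[< L (v - beta) >]); last first.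
    by apply: asbool_equiv_eq; split; apply: LT => //; exact: LC.
  case: ifP => // _; congr xget; apply/seteqP; split=> t [Lst Lt]; split=> //.
    exact: LT (LC _ _ Luv) Lt.
  exact: LT Luv Lt.
have rP u : Ls u -> Ls (r u) /\ L (u - r u).
  move=> Lsu; rewrite /r; case: ifPn => [/asboolP//|_].
  have [] // := @xgetPex _ 0 [set t | Ls t /\ L (u - t)].
  by exists u; split=> //; rewrite subrr.
exists [set t | Ls t /\ t = r t]; last first.
  by split=> //; rewrite /r ifT//; apply/asboolP; rewrite subrr.
split=> [t []//|u Lsu]; have [Lsr Lur] := rP u Lsu; exists (r u); split.
  by split=> //; split=> //; exact: rE.
by move=> t [[_ tE] Lut]; rewrite tE; exact: rE.
Qed.

Section CosetDecomposition.
Variables (C : numFieldType) (V : voa C) (L : set V) (e : V -> V) (VL U : set V).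
Variable D : coset_decomposition L e VL U.
Local Notation frm := (voa_form V).
Local Notation Ls := (dual_lattice frm L).
Hypothesis hH : heisenberg (lspan L) frm (id : V -> V).
Hypothesis L_even : even_lattice frm L.
Hypothesis VL_H : lspan L `<=` VL.
Local Notation highest_weight := (highest_weight (lspan L) frm (id : V -> V)).
Local Notation weight_vector := (weight_vector (lspan L) frm (id : V -> V)).
Local Notation fock_span := (fock_span (lspan L) (id : V -> V)).

Lemma sub_dual_lattice : L `<=` Ls.
Proof.
move=> u Lu; split; first exact: lspan_sub.
by move=> v Lv; exact: (lattice_int L_even).
Qed.

Lemma is_intD (x y : C) : is_int x -> is_int y -> is_int (x + y).
Proof. by move=> [m ->] [n ->]; exists (m + n); rewrite intrD. Qed.

Lemma is_intM (x y : C) : is_int x -> is_int y -> is_int (x * y).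
Proof. by move=> [m ->] [n ->]; exists (m * n); rewrite intrM. Qed.

Lemma dual_lattice_lin (k : int) u v : Ls u -> Ls v -> Ls (k%:~R *: u + v).
Proof.
move=> [Hu u_int] [Hv v_int]; split; first exact: (subspace_lspan L).2.
move=> w Lw; rewrite (heis_bil hH)//; last exact: lspan_sub.
by apply: is_intD; [apply: is_intM; [exists k|exact: u_int]|exact: v_int].
Qed.

Lemma dual_lattice0 : Ls 0.
Proof. exact/sub_dual_lattice/(lattice0 L_even). Qed.

Lemma dual_latticeZ (k : int) u : Ls u -> Ls (k%:~R *: u).
Proof. by move=> Lsu; rewrite -[_ *: u]addr0; exact/dual_lattice_lin/dual_lattice0. Qed.

Lemma dual_latticeD u v : Ls u -> Ls v -> Ls (u + v).
Proof. by move=> Lsu Lsv; rewrite -[u]scale1r; exact: (dual_lattice_lin 1). Qed.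

Lemma dec_highest_weight u lam w : Ls u -> L (lam - u) ->
  highest_weight lam (dec_tau (dec_E D u lam) w).
Proof.
move=> Lsu Llu h n Hh; rewrite -dec_actL//; last exact: VL_H.
case: (dec_lattice D Lsu) => -> // _ _.
case: ifP => _; last exact: (lfun0 ((dec_bilinear D Lsu).1 w)).
by rewrite (lfunZ ((dec_bilinear D Lsu).1 w)).
Qed.

Lemma dec_E_neq0 u lam : Ls u -> L (lam - u) -> dec_E D u lam != 0.
Proof.
move=> Lsu Llu; case: (dec_lattice D Lsu) => _ _ [d [b [_ [_ indep]]]].
apply/eqP => E0; have := indep [:: ([::], lam)] (fun=> 1) isT.
rewrite big_seq1 /= E0 scaler0 => /(_ _ erefl ([::], lam)).
have H1 i : i \in [:: ([::] : seq ('I_d * nat), lam)] ->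
    [set i | sorted (@monomial_le d) i.1 /\ [set lam | L (lam - u)] i.2] i.
  by rewrite inE => /eqP -> /=.
by move=> /(_ H1 (mem_head _ _))/eqP; rewrite oner_eq0.
Qed.

Lemma dec_tau_inj u lam w : Ls u -> L (lam - u) ->
  dec_tau (dec_E D u lam) w = 0 -> w = 0.
Proof.
move=> Lsu Llu tau0.
suff /(_ ord0) : forall i : 'I_1, w = 0 by [].
apply: (Defs.dec_inj Lsu (n := 1%N) (x := fun=> dec_E D u lam) (y := fun=> w)).
  move=> c; rewrite big_ord1 => /eqP; rewrite scaler_eq0 (negPf (dec_E_neq0 Lsu Llu)) orbF.
  by move=> /eqP c0 i; rewrite ord1.
by rewrite big_ord1.
Qed.

Let gen T lam : set V :=
  [set y | exists u w, [/\ T u, L (lam - u) & y = dec_tau (dec_E D u lam) w]].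

Let dec_span T x : Defs.transversal L Ls T ->
  fock_span [set y | exists lam, Ls lam /\ gen T lam y] x.
Proof.
move=> T_trans; have [_ _ dec _] := dec_sum D T_trans.
have [s [F [sF ->]]] := dec x I.
have subF := @subspace_fock_span _ _ _ (lspan L) (id : V -> V)
  [set y | exists lam, Ls lam /\ gen T lam y].
apply: (subspace_sum subF) => u /sF[Tu]; have Lsu := T_trans.1 _ Tu.
apply: (lspan_min subF) => _ [y [w ->]].
case: (dec_lattice D Lsu) => _ _ [d [b [zb [spanE _]]]].
have : setT y by []. rewrite spanE.
apply: (lspan_map ((dec_bilinear D Lsu).1 w) subF) => _ [[m lam] [_ /= Llu] <-].
have Hb i : lspan L (b i) by apply: lspan_sub; exact: (zbasis_mem zb).
have -> : dec_tau (fock_monomial (fun k => vact (b k)) m (dec_E D u lam)) w =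
    fock_monomial (fun k => nprod (b k)) m (dec_tau (dec_E D u lam) w).
  rewrite /fock_monomial; elim: m => //= t m <-.
  by rewrite dec_actL//; exact: VL_H.
apply: fock_monomial_span => //; apply: fock_span_gen; exists lam; split.
  by rewrite -(subrK u lam); apply: dual_latticeD => //; exact: sub_dual_lattice.
by exists u, w.
Qed.

Let gen_highest_weight T lam y : Defs.transversal L Ls T -> gen T lam y -> highest_weight lam y.
Proof.
by move=> [TLs _] [u [w [Tu Llu ->]]]; apply: dec_highest_weight => //; exact: TLs.
Qed.

Lemma coset_span x :
  fock_span [set y | exists lam, Ls lam /\ highest_weight lam y] x.
Proof.
have [T T_trans _] := transversal_through (lattice0 L_even) (latticeB L_even) dual_lattice0.
elim: (dec_span x T_trans) => {x} [|c x y _ Fx _ Fy|y [lam [Lsl]]|h n x Hh _ Fx].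
- exact: fock_span0.
- exact: fock_span_lin.
- by move=> /(gen_highest_weight T_trans) hy; apply: fock_span_gen; exists lam.
- exact: fock_span_creation.
Qed.

(** With a transversal through [lam], the only Fock vacua of weight [lam] are [e^lam (x) w] in the
    summand indexed by [lam], because the representative of a coset is unique. *)
Lemma coset_highest_weight lam v : Ls lam -> highest_weight lam v ->
  exists w, v = dec_tau (dec_E D lam lam) w.
Proof.
move=> Lsl hv.
have [T T_trans Tl] := transversal_through (lattice0 L_even) (latticeB L_even) Lsl.
have [d [b zb]] := zbasis_lattice L_even.
have [g fgP] := lattice_dual_bases L_even hH zb.
have Ov : lspan [set y | exists lam, Ls lam /\ gen T lam y] v.
  apply: (fock_span_vacuum hH fgP _ (dec_span v T_trans)).
    by move=> y [mu [_ /(gen_highest_weight T_trans) hy]]; exists mu.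
  by move=> h n Hh; rewrite (hv h n.+1).
have rep_uniq mu u u' : Ls mu -> T u -> T u' -> L (mu - u) -> L (mu - u') -> u = u'.
  move=> Lsmu Tu Tu' Lu Lu'; have [t [_ tu]] := T_trans.2 mu Lsmu.
  by rewrite -(tu u)// -(tu u').
have subgen mu : Ls mu -> subspace (gen T mu).
  move=> Lsmu; have [t [[Tt Lt] _]] := T_trans.2 mu Lsmu; have Lst := T_trans.1 _ Tt.
  split.
    by exists t, 0; split=> //; rewrite (lfun0 ((dec_bilinear D Lst).2 _)).
  move=> c _ _ [u [w [Tu Lu ->]]] [u' [w' [Tu' Lu' ->]]].
  have uu' := rep_uniq mu u u' Lsmu Tu Tu' Lu Lu'; subst u'.
  exists u, (c *: w + w'); split=> //.
  by rewrite (dec_bilinear D (T_trans.1 _ Tu)).2.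
have [s [F [us sF vE]]] := lspan_graded subgen Ov.
have [|FE ls] := weight_component_eq hH fgP Lsl.1 (highest_weight_weight hv) us _ vE.
  move=> mu /sF[Lsmu gmu]; split; first exact: Lsmu.1.
  exact: (highest_weight_weight (gen_highest_weight T_trans gmu)).
have [-> | v0] := eqVneq v 0.
  by exists 0; rewrite (lfun0 ((dec_bilinear D Lsl).2 _)).
have ls' := ls v0; have := FE lam ls'; rewrite eqxx => <-.
have [_ [u [w [Tu Lu ->]]]] := sF _ ls'.
have lu : lam = u by apply: (rep_uniq lam) => //; rewrite subrr; exact: (lattice0 L_even).
by subst u; exists w.
Qed.

End CosetDecomposition.

(** * The Lorentzian Heisenberg algebra *)

Section Lorentzian.
Variables (C : numFieldType) (V : voa C) (L : set V) (A : II_va C) (T : tensor_va V A).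
Local Notation frm := (voa_form V).
Local Notation Ls := (dual_lattice frm L).
Local Notation idV := (id : V -> V).
Hypothesis hH : heisenberg (lspan L) frm idV.

Local Notation X := (V * 'rV[C]_2)%type.

Definition lor_space : set X := [set h | lspan L h.1].
Definition lor_form (h h' : X) : C := frm h.1 h'.1 + II_form h.2 h'.2.
Definition lor_elt (h : X) : T :=
  tens T h.1 (vac A) + tens T (vac V) (ii_j A h.2).
(** The first coordinate ranges over [L^*] rather than [L], since [V] may involve every coset module
    of [V_L]. *)
Definition lor_lattice : set X := [set mu | Ls mu.1 /\ @II_lattice C mu.2].

(* The vacuum vectors [v (x) e^(a,b)] of weight [mu = (beta, a, b)]. *)
Definition pure_vacuum (mu : X) : set T :=
  [set y | exists v, highest_weight (lspan L) frm idV mu.1 v /\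
           y = tens T v (ii_e A mu.2)].

Local Notation highest_weightT := (highest_weight lor_space lor_form lor_elt).

Lemma lor_elt_act h n c d : nprod (lor_elt h) n (tens T c d) =
  tens T (nprod h.1 n c) d + tens T c (nprod (ii_j A h.2) n d).
Proof. by rewrite /lor_elt nprodDl tens_actl tens_actr. Qed.

Lemma lor_heisenberg : heisenberg lor_space lor_form lor_elt.
Proof.
have hA := II_heisenberg A; split.
- split=> [|c x y Hx Hy]; first exact: (subspace0 (subspace_lspan L)).
  exact: (subspace_lspan L).2.
- move=> c x y _ _; rewrite /lor_elt /= tensDl tensZl (heis_lin hA); try exact: II_span.
  by rewrite tensDr tensZr scalerDr addrACA.
- by move=> h h' Hh Hh'; rewrite /lor_form (heis_sym hH)// II_form_sym.
- move=> c x y z Hx Hy Hz; rewrite /lor_form /= (heis_bil hH)// II_form_bil; ring.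
- move=> h h' n Hh Hh'; rewrite {2}/lor_elt nprodDr !lor_elt_act !va_creat//.
  rewrite tens0l tens0r addr0 add0r (heis_ope hH n Hh Hh').
  rewrite (heis_ope hA n (II_span _) (II_span _)) tens_vac.
  by case: ifP => _; rewrite ?tensZl ?tensZr -?scalerDl// tens0l tens0r addr0.
Qed.

Lemma tens_highest_weight beta x v p : highest_weight (lspan L) frm idV beta v ->
  highest_weight (lspan (@II_lattice C)) (@II_form C) (@ii_j C A) x p ->
  highest_weightT (beta, x) (tens T v p).
Proof.
move=> hv hp h n Hh; rewrite lor_elt_act (hv h.1 n Hh) (hp h.2 n (II_span _)).
case: ifP => _; rewrite ?tensZl ?tensZr -?scalerDl//.
by rewrite tens0l tens0r addr0.
Qed.

Lemma pure_vacuum_highest_weight mu y : lor_lattice mu -> pure_vacuum mu y ->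
  highest_weightT mu y.
Proof.
move=> [_ Lmu] [v [hv ->]]; rewrite [mu]surjective_pairing.
apply: tens_highest_weight => //.
exact: (exp_highest_weight (ii_lattice A)).
Qed.

Lemma subspace_pure_vacuum mu : subspace (pure_vacuum mu).
Proof.
have subh := subspace_highest_weight (lspan L) frm idV mu.1; split.
  by exists 0; split; [exact: (subspace0 subh)|rewrite tens0l].
move=> c _ _ [v [hv ->]] [w [hw ->]]; exists (c *: v + w); split.
  exact: subh.2.
by rewrite tensDl tensZl.
Qed.

Hypothesis V_span : forall v : V, fock_span (lspan L) idV
  [set y | exists lam, Ls lam /\ highest_weight (lspan L) frm idV lam y] v.

Lemma lor_fock_span x : fock_span lor_space lor_elt
  [set y | exists mu, lor_lattice mu /\ pure_vacuum mu y] x.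
Proof.
set O := [set y | _]; have subF := subspace_fock_span lor_space lor_elt O.
have L0 : lspan L 0 := subspace0 (subspace_lspan L).
apply: (tens_ind subF) => v p.
elim: (V_span v) p => {v} [|c v w _ IHv _ IHw|v [lam [Lsl hv]]|h n v Hh _ IHv] p.
- by rewrite tens0l; exact: fock_span0.
- by rewrite tensDl tensZl; exact: fock_span_lin.
- have : (fun _ : A => True) p by [].
  elim: (lattice_va_span (ii_lattice A) (I : setT p)) => {p}
    [|c p q _ IHp _ IHq|p [y [Ly ->]]|y n p _ _ IHp] _.
  + by rewrite tens0r; exact: fock_span0.
  + by rewrite tensDr tensZr; apply: fock_span_lin; auto.
  + by apply: fock_span_gen; exists (lam, y); split=> //; exists v.
  + have -> : tens T v (nprod (ii_j A y) (- n.+1%:Z) p) =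
        nprod (lor_elt (0, y)) (- n.+1%:Z) (tens T v p).
      by rewrite lor_elt_act /= nprod0l tens0l add0r.
    by apply: fock_span_creation => //; exact: IHp.
- have -> : tens T (nprod h (- n.+1%:Z) v) p =
      nprod (lor_elt (h, 0)) (- n.+1%:Z) (tens T v p).
    rewrite lor_elt_act /= (lon0 (heis_sub (II_heisenberg A)) (heis_lin (II_heisenberg A))).
    by rewrite nprod0l tens0r addr0.
  by apply: fock_span_creation => //; exact: IHv.
Qed.

Definition lor_sigma : X := (0, II_vec 0 (-1)).

Lemma lor_sigma_form mu : lspan L mu.1 -> lor_form lor_sigma mu = mu.2 0 0.
Proof.
move=> Hmu; rewrite /lor_form /= (heis_sym hH)//; last exact: (subspace0 (subspace_lspan L)).
rewrite (heis_frm0r hH)// add0r [mu.2 in LHS]II_vec_eta II_formE; ring.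
Qed.

Lemma lor_sigma_mem : lor_space lor_sigma.
Proof. exact: (subspace0 (subspace_lspan L)). Qed.

Lemma lor_sigma_tens v x (n : nat) : @II_lattice C x ->
  nprod (lor_elt lor_sigma) n%:Z (tens T v (ii_e A x)) =
  if n == 0%N then x 0 0 *: tens T v (ii_e A x) else 0.
Proof.
move=> Lx; rewrite lor_elt_act nprod0l tens0l add0r.
rewrite (exp_highest_weight (ii_lattice A) Lx n (II_span _)) [x in II_form _ x]II_vec_eta II_formE.
by case: ifP => _; rewrite ?tens0r// tensZr; congr (_ *: _); ring.
Qed.

Lemma lor_sigma_span x : lspan [set y | exists a : int,
  nprod (lor_elt lor_sigma) 0 y = a%:~R *: y] x.
Proof.
have subs := subspace_lspan [set y | exists a : int,
  nprod (lor_elt lor_sigma) 0 y = a%:~R *: y].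
elim: (lor_fock_span x) => {x} [|c x y _ Sx _ Sy|y [mu [Lmu]]|h n y Hh _].
- exact: (subspace0 subs).
- exact: subs.2.
- move=> /(pure_vacuum_highest_weight Lmu) hy; apply: lspan_sub.
  case: Lmu => -[Hmu _] [a [b mu2]]; exists a.
  rewrite (hy _ 0%N lor_sigma_mem) /= lor_sigma_form// mu2 II_vec0E//.
- apply: (lspan_map (va_linr _ _) subs) => z [a za]; apply: lspan_sub; exists a.
  rewrite (heis_zero_mode lor_heisenberg)//; last exact: lor_sigma_mem.
  by rewrite za nprodZr.
Qed.

Section DualBases.
Variables (alpha : V) (kappa : C).
Hypothesis alpha_H : lspan L alpha.
Hypothesis alpha_norm : frm alpha alpha = 2 * kappa.

Definition lor_rhov : X := (alpha, II_vec 1 kappa).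
Definition lor_hatv (beta : V) : X := (beta, II_vec 0 (frm beta alpha)).

Lemma lor_rhov_mem : lor_space lor_rhov. Proof. exact: alpha_H. Qed.

Lemma lor_rho_rho : lor_form lor_rhov lor_rhov = 0.
Proof. rewrite /lor_form /= II_formE alpha_norm; ring. Qed.

Lemma lor_sigma_rho : lor_form lor_sigma lor_rhov = 1.
Proof. by rewrite lor_sigma_form ?II_vec0E. Qed.

Lemma lor_rho_hat beta : lspan L beta -> lor_form lor_rhov (lor_hatv beta) = 0.
Proof.
by move=> Hb; rewrite /lor_form /= II_formE (heis_sym hH)// mul1r mulr0 addr0 subrr.
Qed.

Lemma lor_hat_hat beta gam : lor_form (lor_hatv beta) (lor_hatv gam) = frm beta gam.
Proof. by rewrite /lor_form /= II_formE !mul0r mulr0 addr0 oppr0 addr0. Qed.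

(** The hatted vector is orthogonal to [rho], so [mu] may be replaced by [mu - a rho], which has
    degree zero. This is the origin of the weights [u - a alpha]. *)
Lemma lor_hat_form beta mu : lspan L beta -> lspan L mu.1 ->
  lor_form (lor_hatv beta) mu = frm beta (mu.1 - mu.2 0 0 *: alpha).
Proof.
move=> Hb Hmu; rewrite (heis_frmBr hH) ?(heis_frmZr hH)//; last first.
  exact: (subspaceZ (subspace_lspan L)).
rewrite /lor_form /= [mu.2 in LHS]II_vec_eta II_formE; ring.
Qed.

Variables (d : nat) (b g : 'I_d -> V).
Hypothesis bgP : dual_bases (lspan L) frm b g.

(** [rho] and [sigma] span a hyperbolic plane orthogonal to the hatted vectors, so the dual family
    interchanges them. *)
Definition lor_basis (i : 'I_d + bool) : X :=
  match i with inl k => lor_hatv (b k) | inr c => if c then lor_rhov else lor_sigma end.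
Definition lor_cobasis (i : 'I_d + bool) : X :=
  match i with inl k => lor_hatv (g k) | inr c => if c then lor_sigma else lor_rhov end.

Lemma lor_dual_bases : dual_bases lor_space lor_form lor_basis lor_cobasis.
Proof.
have subH := subspace_lspan L.
have hT := lor_heisenberg.
have ss : lor_form lor_sigma lor_sigma = 0.
  by rewrite lor_sigma_form ?II_vec0E//; exact: lor_sigma_mem.
have sh beta : lspan L beta -> lor_form lor_sigma (lor_hatv beta) = 0.
  by move=> Hb; rewrite lor_sigma_form ?II_vec0E.
have Hh beta : lspan L beta -> lor_space (lor_hatv beta) by [].
have [Hb Hg] := (dual_f bgP, dual_g bgP).
have Hs := lor_sigma_mem; have Hr := lor_rhov_mem.
split.
- by case=> [k|[]] /=; [exact: Hb|exact: Hr|exact: Hs].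
- by case=> [k|[]] /=; [exact: Hg|exact: Hs|exact: Hr].
- case=> [k|c] [l|c'] /=.
  + by rewrite lor_hat_hat (dual_frm bgP).
  + by rewrite (heis_sym hT); case: c' => //=; rewrite ?lor_rho_hat ?sh//; exact: Hh.
  + by case: c => //=; rewrite ?lor_rho_hat ?sh.
  + by case: c; case: c' => //=; rewrite ?lor_rho_rho ?lor_sigma_rho ?ss//
         (heis_sym hT)// ?lor_sigma_rho.
move=> h Hh1; pose x := h.1 - h.2 0 0 *: alpha.
have Hx : lspan L x by apply: subspaceB => //; exact: subspaceZ.
have [c xE] := dual_span bgP Hx.
(* Subtracting [a rho] leaves degree zero; the coefficient of [sigma = (0,0,-1)] then corrects the
   last coordinate. *)
exists (fun i => match i with inl k => c k | inr true => h.2 0 0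
  | inr false => frm x alpha + h.2 0 0 * kappa - h.2 0 1 end).
have E1 (F : 'I_d + bool -> X) : \sum_i F i = \sum_k F (inl k) + (F (inr true) + F (inr false)).
  by rewrite big_sumType /=; congr (_ + _); rewrite big_bool.
have fstE I (r : seq I) (F : I -> X) : (\sum_(i <- r) F i).1 = \sum_(i <- r) (F i).1.
  by elim: r => [|i r IHr]; rewrite ?big_nil// !big_cons -IHr.
have sndE I (r : seq I) (F : I -> X) : (\sum_(i <- r) F i).2 = \sum_(i <- r) (F i).2.
  by elim: r => [|i r IHr]; rewrite ?big_nil// !big_cons -IHr.
have hatE : \sum_k c k *: lor_hatv (b k) = lor_hatv x.
  rewrite [LHS]surjective_pairing fstE sndE /lor_hatv; congr (_, _); first by rewrite xE.
  rewrite xE (heis_frm_suml hH)//.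
  elim: (index_enum _) => [|i r IHr].
    by rewrite !big_nil; apply/rowP => i; rewrite !mxE if_same.
  by rewrite !big_cons IHr /= II_vecZ II_vecD mulr0 addr0.
rewrite E1 /= hatE [LHS]surjective_pairing [RHS]surjective_pairing; congr (_, _) => /=.
  by rewrite scaler0 addr0 /x subrK.
rewrite !II_vecZ !II_vecD [LHS]II_vec_eta; congr II_vec; ring.
Qed.

End DualBases.

Section Exponentials.
Variables (VL : set V) (e : V -> V).
Hypothesis L_even : even_lattice frm L.
Hypothesis L_va : lattice_va frm L VL idV e.

Definition lor_exp (mu : X) : T := tens T (e mu.1) (ii_e A mu.2).

Lemma lor_exp_vacuum mu : L mu.1 -> pure_vacuum mu (lor_exp mu).
Proof.
by move=> Lmu; exists (e mu.1); split=> //; exact: (exp_highest_weight L_va).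
Qed.

Lemma lor_exp_neq0 mu : L mu.1 -> @II_lattice C mu.2 -> lor_exp mu != 0.
Proof.
move=> L1 L2; apply/eqP => /tens_eq0 E.
have /negP := exp_neq0 L_va L1; apply; apply/eqP/E.
exact: (exp_neq0 (ii_lattice A)).
Qed.

Lemma lor_exp_translation mu : L mu.1 -> @II_lattice C mu.2 ->
  nprod (lor_exp mu) (-2) (vac T) = nprod (lor_elt mu) (-1) (lor_exp mu).
Proof.
move=> L1 L2; rewrite tens_translation lor_elt_act addrC.
rewrite (exp_translation hH L_even L_va)//.
by rewrite (exp_translation (II_heisenberg A) (II_even C) (ii_lattice A)).
Qed.

Lemma lor_exp_regular mu x : L mu.1 -> @II_lattice C mu.2 ->
  (forall i : nat, nprod (lor_elt mu) i%:Z x = 0) ->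
  forall n : nat, nprod (lor_exp mu) n%:Z x = 0.
Proof. by move=> L1 L2; apply: exponential_regular; exact: lor_exp_translation. Qed.

(** Isotropy of [mu] makes the leading exponents of the two tensor factors opposite, so exactly one
    summand of the product survives. *)
Lemma lor_exp_inverse mu : L mu.1 -> @II_lattice C mu.2 -> lor_form mu mu = 0 ->
  exists2 c, c != 0 & nprod (lor_exp mu) (-1) (lor_exp (- mu)) = c *: vac T.
Proof.
move=> L1 L2 mu0; have LN1 := latticeN L_even L1; have LN2 := latticeN (II_even C) L2.
have [k kE] : is_int (frm mu.1 (- mu.1)) by exact: (lattice_int L_even).
have k'E : II_form mu.2 (- mu.2) = (- k)%:~R.
  have HA := II_heisenberg A.
  rewrite intrN -kE -[- mu.2]scaleN1r (heis_frmZr HA _ (II_span _) (II_span _)) -[- mu.1]scaleN1r.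
  rewrite (heis_frmZr hH _ (lspan_sub L1) (lspan_sub L1)).
  by have /eqP := mu0; rewrite /lor_form addr_eq0 => /eqP ->; rewrite !mulN1r !opprK.
have [E1 [c c0 E2]] := exp_product L_va L1 LN1 kE.
have [F1 [c' c'0 F2]] := exp_product (ii_lattice A) L2 LN2 k'E.
exists (c * c'); first by rewrite mulf_neq0.
rewrite /lor_exp (@tens_support _ _ _ _ _ _ _ _ _ [:: - k - 1])// ?big_seq1 => [|i].
  rewrite E2 (_ : -1 - 1 - (- k - 1) = - - k - 1) ?F2; last by lia.
  rewrite tensZl tensZr scalerA !subrr.
  by case: L_va => _ -> _ _ _; case: (ii_lattice A) => _ -> _ _ _; rewrite tens_vac.
rewrite inE => ik; have [ki|ki] := leP (- k) i; first by rewrite E1// tens0l.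
by rewrite F1 ?tens0r//; move/eqP: ik; lia.
Qed.

End Exponentials.
End Lorentzian.

(** * Vacuum spaces of a simple [V] under the commutant *)

Section Irreducibility.
Variables (C : numFieldType) (V : voa C) (L : set V).
Local Notation frm := (voa_form V).
Local Notation Ls := (dual_lattice frm L).
Local Notation idV := (id : V -> V).
Local Notation highest_weight := (highest_weight (lspan L) frm idV).
Local Notation fock_span := (fock_span (lspan L) idV).
Hypothesis hH : heisenberg (lspan L) frm idV.
Hypothesis L_even : even_lattice frm L.
Hypothesis V_span : forall v : V,
  fock_span [set y | exists lam, Ls lam /\ highest_weight lam y] v.

Lemma commutant_mode_highest_weight lam u l v : highest_weight 0 u ->
  highest_weight lam v -> highest_weight lam (nprod u l v).
Proof.
move=> hu hv h n Hh; rewrite (highest_weight_commutator _ _ _ hu Hh).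
rewrite (heis_frm0r hH Hh) scale0r addr0 (hv h n Hh).
by case: ifP => _; [exact: nprodZr|exact: nprod0r].
Qed.

(* By simplicity [v] is a sum of [a(k) v1]; comparing weights, and projecting
   away the Heisenberg creation operators, only [a] in the commutant survive. *)
Lemma highest_weight_irreducible lam v1 v :
  irreducible_sub (@setT (adjoint_module V)) ->
  Ls lam -> highest_weight lam v1 -> v1 <> 0 -> highest_weight lam v ->
  lspan [set z | exists u l, highest_weight 0 u /\ z = nprod u l v1] v.
Proof.
move=> [_ _ V_irr] Lsl hv1 v1_neq0 hv.
have [d [b zb]] := zbasis_lattice L_even.
have [g bgP] := lattice_dual_bases L_even hH zb.
pose S1 : set V := lspan [set z | exists a k, z = nprod a k v1].
have S1v : S1 v.
  have [S10|->//] : S1 = [set 0] \/ S1 = setT.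
    apply: (V_irr S1) => //; split; first exact: subspace_lspan.
    by move=> a n x _; exact: subspace_span_modes.
  have : S1 v1 by apply: lspan_sub; exists (vac V), (-1); rewrite va_vacl.
  by rewrite S10.
pose Fw mu : set V := fock_span (highest_weight mu).
have Fw_weight mu a : Fw mu a -> weight_vector (lspan L) frm idV mu a.
  have subw := subspace_weight_vector (lspan L) frm idV mu.
  elim=> {a} [|c x y _ ? _ ?|x|h n x Hh _ wx].
  - exact: (subspace0 subw).
  - exact: subw.2.
  - exact: highest_weight_weight.
  - exact: weight_vector_mode.
have Fw_span a : lspan [set y | exists mu, Ls mu /\ Fw mu y] a.
  have subl := subspace_lspan [set y | exists mu, Ls mu /\ Fw mu y].
  elim: (V_span a) => {a} [|c x y _ ? _ ?|x [mu [Lm hx]]|h n x Hh _ Sx].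
  - exact: (subspace0 subl).
  - exact: subl.2.
  - by apply: lspan_sub; exists mu; split=> //; exact: fock_span_gen.
  - apply: (lspan_map (va_linr _ _) subl _ Sx) => y [mu [Lm Fy]].
    by apply: lspan_sub; exists mu; split=> //; exact: fock_span_creation.
pose Sg nu : set V := lspan [set z | exists a k, Fw (nu - lam) a /\ z = nprod a k v1].
have : lspan [set z | exists nu, Ls nu /\ Sg nu z] v.
  apply: (lspan_min (subspace_lspan _) _ S1v) => _ [a [k ->]].
  apply: (lspan_map (va_linl k v1) (subspace_lspan _) _ (Fw_span a)) => y [mu [Lm Fy]].
  apply: lspan_sub; exists (mu + lam); split; first exact: dual_latticeD.
  by apply: lspan_sub; exists y, k; rewrite addrK.
move=> /lspan_graded[nu _|s [F [us sF vE]]]; first exact: subspace_lspan.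
have [|FE ls] := weight_component_eq hH bgP Lsl.1 (highest_weight_weight hv) us _ vE.
  move=> nu /sF[Lnu Sgn]; split; first exact: Lnu.1.
  apply: (lspan_min (subspace_weight_vector _ _ _ _) _ Sgn) => _ [a [k [Fa ->]]] h Hh.
  have Ha := Fw_weight _ _ Fa h Hh.
  rewrite zero_mode_derivation Ha nprodZl (hv1 h 0%N Hh) nprodZr -scalerDl.
  by rewrite (heis_frmBr hH Hh Lnu.1 Lsl.1) addrC subrK.
pose D0 := [set z | exists u l, highest_weight 0 u /\ z = nprod u l v1].
have D0_hw y : D0 y -> highest_weight lam y.
  by move=> [u [l [hu ->]]]; exact: commutant_mode_highest_weight.
have Sg_fock z : Sg lam z -> fock_span D0 z.
  apply: lspan_min => [|_ [a [k [+ ->]]]]; first exact: subspace_fock_span.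
  rewrite subrr => Fa; elim: Fa k => {a} [|c x y _ IHx _ IHy|u hu|h n a Hh _ IHa] k.
  - by rewrite nprod0l; exact: fock_span0.
  - by rewrite va_linl; exact: fock_span_lin.
  - by apply: fock_span_gen; exists u, k.
  (* The product expansion puts the creation modes on the left, or applies nonnegative modes of [h]
     to [v1], where they act by scalars. *)
  apply: (iterate_stable (subspace_fock_span (lspan L) idV D0)) => i.
    by rewrite (_ : _ - _ = - (n + i).+1%:Z); [exact: fock_span_creation|lia].
  rewrite (hv1 h i Hh); case: ifP => _.
    by rewrite nprodZr; apply: (subspaceZ (subspace_fock_span _ _ _)).
  by rewrite nprod0r; exact: fock_span0.
have Fv : fock_span D0 v.
  have [->|v0] := eqVneq v 0; first exact: fock_span0.
  have ls' := ls v0; have := FE lam ls'; rewrite eqxx => vF.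
  by apply: Sg_fock; rewrite -vF; case: (sF lam ls').
apply: (fock_span_vacuum hH bgP _ Fv) => [y /D0_hw hy|h n Hh]; first by exists lam.
by rewrite (hv h n.+1).
Qed.

End Irreducibility.

(** * The quotient J/P *)

Lemma sum_fibers (V : nmodType) (I J : eqType) (s : seq I) (w : I -> J) (f : I -> V) :
  \sum_(a <- undup [seq w i | i <- s]) \sum_(i <- s | w i == a) f i =
  \sum_(i <- s) f i.
Proof.
under eq_bigr => a _ do rewrite big_mkcond.
rewrite exchange_big /= big_seq [RHS]big_seq; apply: eq_bigr => i si.
rewrite -big_mkcond -big_filter (_ : [seq _ <- _ | _] = [:: w i]) ?big_seq1//.
rewrite -(@filter_pred1_uniq _ (undup [seq w i | i <- s]) (w i)) ?undup_uniq//.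
  by apply: eq_filter => a; rewrite /= eq_sym.
by rewrite mem_undup; apply: map_f.
Qed.

Section Quotient.
Variables (C : numFieldType) (V : voa C) (L VL : set V) (e : V -> V).
Variables (A : II_va C) (T : tensor_va V A).
Local Notation frm := (voa_form V).
Local Notation Ls := (dual_lattice frm L).
Local Notation idV := (id : V -> V).
Hypothesis hH : heisenberg (lspan L) frm idV.
Hypothesis L_even : even_lattice frm L.
Hypothesis L_va : lattice_va frm L VL idV e.
Hypothesis V_span : forall v : V, fock_span (lspan L) idV
  [set y | exists lam, Ls lam /\ highest_weight (lspan L) frm idV lam y] v.

Local Notation X := (V * 'rV[C]_2)%type.
Local Notation elt := (@lor_elt C V A T).
Local Notation space := (lor_space L).
Local Notation pure_vac := (@pure_vacuum C V L A T).
Local Notation form := (@lor_form C V).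

Variables (alpha : V) (N : nat) (K : int).
Hypothesis alpha_H : lspan L alpha.
Hypothesis N_gt0 : (0 < N)%N.
Hypothesis K_def : K%:~R = N%:R * frm alpha alpha / 2.

Local Notation kappa := (K%:~R / N%:R : C).
Local Notation rho := (lor_rhov alpha kappa).
Local Notation sigma := (@lor_sigma C V).
Local Notation J := (lor_J T alpha N K).
Local Notation P := (lor_P e T alpha N K).
Local Notation hatv := (lor_hatv alpha).
Local Notation Nrho := (N%:R *: alpha, II_vec N%:R K%:~R).
Local Notation expNrho := (lor_exp T e Nrho).

Let hT : heisenberg space form elt. Proof. exact: lor_heisenberg. Qed.

Lemma lor_N_neq0 : N%:R != 0 :> C. Proof. by rewrite pnatr_eq0 -lt0n. Qed.

Lemma lor_alpha_norm : frm alpha alpha = 2 * kappa.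
Proof. by rewrite K_def; have N0 := lor_N_neq0; field. Qed.

Let alpha_norm := lor_alpha_norm.
Let rho_mem : space rho. Proof. exact: lor_rhov_mem. Qed.
Let sigma_mem : space sigma. Proof. exact: lor_sigma_mem. Qed.

Let rho_rho : form rho rho = 0. Proof. exact: lor_rho_rho. Qed.
Let rho_hat beta : lspan L beta -> form rho (hatv beta) = 0.
Proof. exact: (lor_rho_hat hH). Qed.

Lemma lor_JP x : J x <-> forall n : nat, nprod (elt rho) n%:Z x = 0.
Proof.
split=> [/Comm_generatedP Jx n|x0]; first exact: Jx.
by apply/Comm_generatedP => _ n ->; exact: x0.
Qed.

Let subvaJ : subva J. Proof. exact: Comm_subva. Qed.

Lemma subspace_lor_J : subspace J. Proof. by case: subvaJ. Qed.
Let subJ := subspace_lor_J.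

Lemma lor_J_mode u n v : J u -> J v -> J (nprod u n v).
Proof. by case: subvaJ => _ _; exact. Qed.

Lemma lor_J_orthogonal h p x : space h -> form rho h = 0 -> J x ->
  J (nprod (elt h) p x).
Proof.
move=> Hh rh /lor_JP Jx; apply/lor_JP => n.
rewrite (heis_commutator hT)// Jx nprod0r add0r rh mulr0.
by set c : C := (if _ then _ else _); have -> : c = 0; rewrite /c ?if_same// scale0r.
Qed.

(** Two nonnegative Heisenberg modes commute, so orthogonality to [rho] is not asked for; in
    particular [sigma(0)] acts on [J]. *)
Lemma lor_J_annihilation h (m : nat) x : space h -> J x -> J (nprod (elt h) m%:Z x).
Proof.
move=> Hh /lor_JP Jx; apply/lor_JP => n.
rewrite (heis_commutator hT)// Jx nprod0r add0r.
set c : C := (if _ then _ else _); have -> : c = 0; last by rewrite scale0r.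
rewrite /c; case: eqP => // nm; have -> : n = 0%N by lia.
by rewrite mul0r.
Qed.

Lemma lor_J_highest_weight mu x : lor_space L mu -> highest_weight space form elt mu x ->
  form rho mu = 0 -> J x.
Proof.
by move=> Hmu hx rmu; apply/lor_JP => n; rewrite hx// rmu scale0r if_same.
Qed.

Lemma lor_J_hat beta : lspan L beta -> J (elt (hatv beta)).
Proof.
move=> Hb; apply/lor_JP => n; rewrite (heis_ope hT)//.
by rewrite rho_hat// scale0r if_same.
Qed.

Lemma lor_P_creation (n : nat) y : J y -> P (nprod (elt rho) (- n.+1%:Z) y).
Proof. by move=> Jy; apply: lspan_sub; left; exists n.+1, y. Qed.

Lemma lor_P_shift y : J y -> P (y - nprod expNrho (-1) y).
Proof.
move=> Jy; apply: lspan_sub; right; exists y; split=> //.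
by rewrite nprodDl va_vacl eqxx -[- lor_expNrho _ _ _ _ _]scaleN1r nprodZl scaleN1r.
Qed.

Lemma lor_P_decomposition x : P x -> exists (l : seq (nat * T)) y,
  [/\ forall t, t \in l -> J t.2, J y
    & x = \sum_(t <- l) nprod (elt rho) (- t.1.+1%:Z) t.2 + (y - nprod expNrho (-1) y)].
Proof.
pose Q := [set x | exists (l : seq (nat * T)) y,
  [/\ forall t, t \in l -> J t.2, J y
    & x = \sum_(t <- l) nprod (elt rho) (- t.1.+1%:Z) t.2 + (y - nprod expNrho (-1) y)]].
suff subQ : subspace Q.
  apply: (lspan_min (S := Q)) => // z [[i [y [+ [Jy ->]]]]|[y [Jy ->]]].
    case: i => // n _; exists [:: (n, y)], 0; split=> [t|//|].
    - by rewrite inE => /eqP ->.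
    - exact: subspace0.
    - by rewrite big_seq1 nprod0r subrr addr0.
  exists [::], y; split=> //.
  by rewrite big_nil add0r nprodDl va_vacl eqxx -[- lor_expNrho _ _ _ _ _]scaleN1r nprodZl scaleN1r.
split=> [|c _ _ [l [y [Jl Jy ->]]] [l' [y' [Jl' Jy' ->]]]].
  exists [::], 0; split=> //; first exact: subspace0.
  by rewrite big_nil nprod0r subrr addr0.
exists ([seq (t.1, c *: t.2) | t <- l] ++ l'), (c *: y + y'); split.
- move=> t; rewrite mem_cat => /orP[/mapP[u /Jl Ju ->]|/Jl'//].
  exact: (subspaceZ subJ _ Ju).
- exact: subJ.2.
rewrite big_cat big_map /= scalerDr addrACA scaler_sumr; congr (_ + _ + _).
  by apply: eq_bigr => t _; rewrite nprodZr.
by rewrite va_linr scalerBr opprD addrACA.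
Qed.

Variable Va : quotient_va J P.
Local Notation q := (quot_map Va).
Local Notation hat := (lor_hat alpha Va).

Let q_lin : linear_on J q. Proof. exact: quot_linear. Qed.

Lemma quot_P x : J x -> P x -> q x = 0.
Proof. by move=> Jx Px; apply/quot_ker. Qed.

Lemma lor_hatE beta : hat beta = q (elt (hatv beta)). Proof. by []. Qed.

Lemma quot_heisenberg : heisenberg (lspan L) frm hat.
Proof.
have subH := subspace_lspan L.
split=> //.
- move=> c x y Hx Hy; rewrite !lor_hatE -q_lin; try exact: lor_J_hat.
  rewrite -(heis_lin hT)//; congr (q _).
  congr (elt (_, _)); rewrite /= II_vecZ II_vecD mulr0 addr0 (heis_bil hH)//.
- exact: (heis_sym hH).
- exact: (heis_bil hH).
move=> h h' n Hh Hh'; rewrite !lor_hatE -quot_nprod; try exact: lor_J_hat.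
rewrite (heis_ope hT)//.
rewrite lor_hat_hat; case: ifP => _; last exact: (lon0 subJ q_lin).
rewrite (lonZ subJ q_lin) ?quot_vac//.
by case: subvaJ.
Qed.

Lemma quot_weight mu x : lor_space L mu -> J x ->
  weight_vector space form elt mu x ->
  weight_vector (lspan L) frm hat (mu.1 - mu.2 0 0 *: alpha) (q x).
Proof.
move=> Hmu Jx wx h Hh; rewrite lor_hatE -quot_nprod//; last exact: lor_J_hat.
rewrite wx// (lor_hat_form hH)//.
by rewrite (lonZ subJ q_lin).
Qed.

Lemma quot_highest_weight mu x : lor_space L mu -> J x ->
  highest_weight space form elt mu x ->
  highest_weight (lspan L) frm hat (mu.1 - mu.2 0 0 *: alpha) (q x).
Proof.
move=> Hmu Jx hx h n Hh; rewrite lor_hatE -quot_nprod//; last exact: lor_J_hat.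
rewrite hx// (lor_hat_form hH)//.
by case: ifP => _; rewrite ?(lonZ subJ q_lin)// (lon0 subJ q_lin).
Qed.

(** * Lifting vacuum vectors through the quotient map *)

Section Reduction.
Variables (d : nat) (b g : 'I_d -> V).
Hypothesis bgP : dual_bases (lspan L) frm b g.

Local Notation cr := (creation elt (lor_basis alpha kappa b)).
Local Notation an := (annihilation elt (lor_cobasis alpha kappa g)).

Let bgT : dual_bases space form (lor_basis alpha kappa b) (lor_cobasis alpha kappa g).
Proof. exact: (lor_dual_bases T hH alpha_H alpha_norm bgP). Qed.

(** Three cases. Hatted oscillators descend to the quotient, where the projection fixes a vacuum
    vector; for [rho(-n)] with [sigma(n)] all correction terms lie in [P]; for [sigma(-n)] with
    [rho(n)] the projection is the identity on [J]. *)
Lemma quot_fock_proj t k z : J z ->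
  (forall h (n : nat), lspan L h -> nprod (hat h) n.+1%:Z (q z) = 0) ->
  J (fock_proj cr an t k.+1 z) /\ q (fock_proj cr an t k.+1 z) = q z.
Proof.
move=> Jz qz; case: t => -[i|[]] n.
- have [Hb Hg] := (dual_f bgP i, dual_g bgP i).
  pose A' (_ : unit) (y : Va) : Va := n.+1%:R^-1 *: nprod (hat (b i)) (- n.+1%:Z) y.
  pose B' (_ : unit) (y : Va) : Va := nprod (hat (g i)) n.+1%:Z y.
  have JA y : J y -> J (cr (inl i, n) y).
    move=> Jy; apply: (subspaceZ subJ); apply: lor_J_orthogonal => //.
    exact: rho_hat.
  have JB y : J y -> J (an (inl i, n) y).
    by move=> Jy; apply: lor_J_orthogonal => //; exact: rho_hat.
  have [||Jp ->] := @fock_proj_comm _ _ _ cr an (inl i, n) k.+1 J Va (A' tt) (B' tt) q z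
    q_lin subJ JA JB _ _ Jz.
  + move=> y Jy; rewrite /cr (lonZ subJ q_lin)/=; last first.
      by apply: lor_J_orthogonal => //; exact: rho_hat.
    by rewrite quot_nprod//; exact: lor_J_hat.
  + by move=> y Jy; rewrite /an quot_nprod//; exact: lor_J_hat.
  split=> //; rewrite -/(fock_proj A' B' tt k.+1 (q z)) fock_proj_id//.
  + by move=> [] c x y; rewrite /A' va_linr scalerDr !scalerA mulrC.
  + by move=> []; exact: va_linr.
  + exact: qz.
- have JA y : J y -> J (cr (inr true, n) y).
    by move=> Jy; apply: (subspaceZ subJ); apply: lor_J_orthogonal => //; exact: rho_rho.
  have JB y : J y -> J (an (inr true, n) y) by exact: lor_J_annihilation.
  have JAB l m : J (iter m (cr (inr true, n)) (iter l (an (inr true, n)) z)).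
    by elim: m => [|m]; [elim: l => // l; exact: JB|exact: JA].
  rewrite fock_proj_split.
  set D := \sum_(l < k) _.
  have JD : J D.
    by apply: (subspace_sum subJ) => l _; exact: (subspaceZ subJ _ (JAB l.+1 l.+1)).
  split; first exact: (subspaceD subJ).
  rewrite (lonD q_lin)// (lon_sum subJ q_lin) ?big1 ?addr0//.
    move=> l _; rewrite (lonZ subJ q_lin); last exact: (JAB l.+1 l.+1).
    rewrite iterS (lonZ subJ q_lin)/=; last first.
      by apply: lor_J_orthogonal => //; exact: (JAB l.+1 l).
    rewrite quot_P ?scaler0//; first by apply: lor_J_orthogonal => //; exact: (JAB l.+1 l).
    by apply: lor_P_creation; exact: (JAB l.+1 l).
  by move=> l _; exact: (subspaceZ subJ _ (JAB l.+1 l.+1)).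
- rewrite fock_proj_id//; first exact: creation_linear.
    exact: annihilation_linear.
  by have /lor_JP := Jz; exact.
Qed.

(** This does not presuppose that [N alpha] lies in [L], so it is available for proving that. The
    last clause keeps track of the [sigma]-degree, on which the quotient carries no grading. *)
Lemma quot_vacuum_lift lam x : lspan L lam -> J x ->
  highest_weight (lspan L) frm hat lam (q x) ->
  exists (s : seq X) (F : X -> T),
  [/\ uniq s,
      forall mu, mu \in s -> [/\ lor_lattice L mu, pure_vac mu (F mu), J (F mu),
        F mu != 0 & form rho mu = 0],
      forall mu, mu \in s -> mu.1 - mu.2 0 0 *: alpha = lam,
      q x = \sum_(mu <- s) q (F mu)
    & forall a, nprod (elt sigma) 0 x = a *: x ->
        forall mu, mu \in s -> mu.2 0 0 = a].
Proof.
move=> Hlam Jx hqx.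
pose O := [set y | exists mu, lor_lattice L mu /\ pure_vac mu y].
have hO y : O y -> exists mu, highest_weight space form elt mu y.
  by move=> [mu [Lmu py]]; exists mu; exact: pure_vacuum_highest_weight.
pose Inv z := [/\ J z, q z = q x
  & forall a, nprod (elt sigma) 0 x = a *: x -> nprod (elt sigma) 0 z = a *: z].
have [||o [Oo [Jo qo so]]] := @fock_span_reduce _ _ _ _ _ _ hT _ _ _ bgT O Inv x hO
    (lor_fock_span V_span x).
- move=> t k z [Jz qz sz].
  have [|Jp qp] := @quot_fock_proj t k z Jz.
    by move=> h n Hh; rewrite qz hqx.
  split=> //; first by rewrite qp.
  move=> a xa; have za := sz a xa.
  have slin : linear_on setT (nprod (elt sigma) 0 : T -> T).
    by move=> c y y' _ _; exact: va_linr.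
  have sA y : setT y -> nprod (elt sigma) 0 (cr t y) = cr t (nprod (elt sigma) 0 y).
    move=> _; rewrite /creation nprodZr (heis_zero_mode hT)//; exact: (dual_f bgT).
  have sB y : setT y -> nprod (elt sigma) 0 (an t y) = an t (nprod (elt sigma) 0 y).
    move=> _; rewrite /annihilation (heis_zero_mode hT)//; exact: (dual_g bgT).
  have subT : subspace (setT : set T) by [].
  have [_ ->] := @fock_proj_comm _ _ _ cr an t k.+1 setT T (cr t) (an t)
    (nprod (elt sigma) 0) z slin subT (fun _ _ => I) (fun _ _ => I) sA sB I.
  rewrite -/(fock_proj cr an t k.+1 _) za.
  by rewrite (lfunZ (@fock_proj_linear _ _ _ cr an _ _ t k.+1))//;
     [exact: creation_linear|exact: annihilation_linear].
- by split.
have [s0 [F [us0 sF oE]]] := lspan_graded (fun mu _ => @subspace_pure_vacuum C V L A T mu) Oo.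
have Hs0 mu : mu \in s0 -> space mu by move=> /sF[[[]]].
have wF mu : mu \in s0 -> space mu /\ weight_vector space form elt mu (F mu).
  move=> ms; split; first exact: Hs0.
  by have [Lmu pF] := sF _ ms; apply/highest_weight_weight/pure_vacuum_highest_weight.
have JF mu : mu \in s0 -> J (F mu).
  apply: (weight_component hT bgT) => //; last by rewrite -oE.
  by move=> h y Hh; exact: lor_J_annihilation.
have qoE : q x = \sum_(mu <- s0) q (F mu) by rewrite -qo oE (lon_sum subJ q_lin).
pose w (mu : X) := mu.1 - mu.2 0 0 *: alpha.
pose s := [seq mu <- s0 | (F mu != 0) && (w mu == lam)].
have ss0 mu : mu \in s -> mu \in s0 by rewrite mem_filter => /andP[].
exists s, F; split.
- by rewrite filter_uniq.
- move=> mu ms; have ms0 := ss0 _ ms; have [Lmu pF] := sF _ ms0.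
  have F0 : F mu != 0 by move: ms; rewrite mem_filter => /andP[/andP[]].
  split=> //; first exact: JF.
  have /lor_JP/(_ 0%N) := JF _ ms0; have [_ wmu] := wF _ ms0.
  by rewrite wmu// => /eqP; rewrite scaler_eq0 (negPf F0) orbF => /eqP.
- by move=> mu; rewrite mem_filter => /andP[/andP[_ /eqP]].
(* Different [mu] can have the same weight in the quotient, so fibres of [w] are summed before
   weights are compared there. *)
- pose G a := \sum_(mu <- s0 | w mu == a) q (F mu).
  have GE : q x = \sum_(a <- undup [seq w mu | mu <- s0]) G a.
    by rewrite qoE -(@sum_fibers _ _ _ s0 w).
  have Hw mu : mu \in s0 -> lspan L (w mu).
    move=> /Hs0 Hmu; apply: (subspaceB (subspace_lspan L)) => //.
    exact: (subspaceZ (subspace_lspan L)).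
  have [|FE ls] := weight_component_eq quot_heisenberg bgP Hlam
    (highest_weight_weight hqx) (undup_uniq _) _ GE.
    move=> a; rewrite mem_undup => /mapP[mu ms ->]; split; first exact: Hw.
    rewrite /G -big_filter; apply: (subspace_sum (subspace_weight_vector _ _ _ _)) => nu.
    rewrite mem_filter => /andP[/eqP <- ns]; apply: quot_weight; [exact: Hs0|exact: JF|].
    by case: (wF nu ns).
  have -> : q x = G lam.
    have [l_in|l_out] := boolP (lam \in undup [seq w mu | mu <- s0]).
      by rewrite FE// eqxx.
    have -> : q x = 0 by apply: contraNeq l_out; exact: ls.
    rewrite /G big_seq_cond big1// => mu /andP[ms /eqP wl].
    by move: l_out; rewrite mem_undup -wl map_f.
  rewrite /G big_filter [LHS]big_mkcond [RHS]big_mkcond; apply: eq_bigr => mu _.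
  case: (w mu == lam); rewrite ?andbT ?andbF//.
  by case: eqVneq => [->|//]; rewrite (lon0 subJ q_lin).
- move=> a xa mu ms; have ms0 := ss0 _ ms.
  have F0 : F mu != 0 by move: ms; rewrite mem_filter => /andP[/andP[]].
  pose Sa := [set z | nprod (elt sigma) 0 z = a *: z].
  have subSa : subspace Sa.
    split; first by rewrite /Sa/= nprod0r scaler0.
    move=> c y z ya za; rewrite /Sa/= va_linr ya za scalerDr !scalerA mulrC//.
  have : Sa (F mu).
    apply: (weight_component hT bgT subSa _ us0 wF) => //; last by rewrite -oE; exact: so.
    by move=> h y Hh ya; rewrite /Sa/= (heis_zero_mode hT)// ya nprodZr.
  rewrite /Sa/= (wF mu ms0).2// (lor_sigma_form hH (Hs0 mu ms0)).
  by move=> /eqP; rewrite -subr_eq0 -scalerBl scaler_eq0 (negPf F0) orbF subr_eq0 => /eqP.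
Qed.

End Reduction.
(** Multiplication by [e^(N rho)] is only seen to produce a vacuum vector of the shifted weight;
    this recovers its form as a tensor. *)
Lemma highest_weight_pure mu x : lor_lattice L mu ->
  highest_weight space form elt mu x -> pure_vac mu x.
Proof.
move=> Lmu hx; have [d [b zb]] := zbasis_lattice L_even.
have [g bgP] := lattice_dual_bases L_even hH zb.
have bgT := lor_dual_bases T hH alpha_H alpha_norm bgP.
have hO y : (exists mu, lor_lattice L mu /\ pure_vac mu y) ->
    exists mu, highest_weight space form elt mu y.
  by move=> [nu [Lnu py]]; exists nu; exact: pure_vacuum_highest_weight.
have Ox : lspan [set y | exists mu, lor_lattice L mu /\ pure_vac mu y] x.
  apply: (fock_span_vacuum hT bgT hO (lor_fock_span V_span x)) => h n Hh.
  by rewrite (hx h n.+1 Hh).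
have [s [F [us sF xE]]] := lspan_graded (fun mu _ => @subspace_pure_vacuum C V L A T mu) Ox.
have Hmu : space mu by case: Lmu => -[].
have [|FE ls] := weight_component_eq hT bgT Hmu (highest_weight_weight hx) us _ xE.
  move=> nu /sF[Lnu pF]; split; first by case: Lnu => -[].
  exact/highest_weight_weight/pure_vacuum_highest_weight.
have [->|x0] := eqVneq x 0; first exact: (subspace0 (subspace_pure_vacuum _ _ _)).
by have ms := ls x0; have := FE mu ms; rewrite eqxx => <-; case: (sF mu ms).
Qed.

(** * Multiplication by exponentials of multiples of [rho] *)

Section ExponentialShift.
Variables (mu : X) (t : C).
Hypothesis mu_rho : mu = t *: rho.
Hypothesis mu1 : L mu.1.
Hypothesis mu2 : @II_lattice C mu.2.
Local Notation E := (nprod (lor_exp T e mu) (-1)).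

Let mu_mem : space mu. Proof. exact: lspan_sub. Qed.

Let mu_form h : space h -> form h mu = t * form h rho.
Proof. by move=> Hh; rewrite mu_rho (heis_frmZr hT). Qed.

Lemma lor_expJ_highest_weight : highest_weight space form elt mu (lor_exp T e mu).
Proof.
apply: pure_vacuum_highest_weight; first by split=> //; exact: sub_dual_lattice.
exact: (lor_exp_vacuum _ L_va).
Qed.

(** All [rho(i)] with [i >= 0] vanish on [J], so the criterion for exponentials applies. As a
    consequence the shift commutes with annihilation operators on [J]. *)
Lemma lor_expJ_regular x : J x -> forall n : nat, nprod (lor_exp T e mu) n%:Z x = 0.
Proof.
move=> /lor_JP Jx; apply: (lor_exp_regular hH L_even L_va) => // i.
rewrite mu_rho (lonZ (heis_sub hT) (heis_lin hT))//.
by rewrite nprodZl Jx scaler0.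
Qed.

Lemma lor_expJ_mem : J (lor_exp T e mu).
Proof.
apply: (lor_J_highest_weight mu_mem lor_expJ_highest_weight).
by rewrite mu_form// rho_rho mulr0.
Qed.

Lemma lor_expJ_comm h p x : space h -> E (nprod (elt h) p x) =
  nprod (elt h) p (E x) - (t * form h rho) *: nprod (lor_exp T e mu) (p - 1) x.
Proof.
move=> Hh; rewrite (highest_weight_commutator _ _ _ lor_expJ_highest_weight Hh).
by rewrite mu_form// addrK.
Qed.

Lemma lor_expJ_annihilation h (n : nat) x : space h -> J x ->
  E (nprod (elt h) n.+1%:Z x) = nprod (elt h) n.+1%:Z (E x).
Proof.
move=> Hh Jx; rewrite lor_expJ_comm// (_ : n.+1%:Z - 1 = n%:Z); last by lia.
by rewrite lor_expJ_regular// scaler0 subr0.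
Qed.

Lemma lor_expJ_orthogonal h p x : space h -> form rho h = 0 ->
  E (nprod (elt h) p x) = nprod (elt h) p (E x).
Proof.
by move=> Hh rh; rewrite lor_expJ_comm// (heis_sym hT)// rh mulr0 scale0r subr0.
Qed.

Lemma lor_expJ_weight nu x : space nu -> J x -> highest_weight space form elt nu x ->
  highest_weight space form elt (nu + mu) (E x).
Proof.
move=> Hnu Jx hx h [|n] Hh; last first.
  by rewrite -lor_expJ_annihilation// hx// nprod0r.
have := lor_expJ_comm 0 x Hh => /eqP; rewrite eq_sym subr_eq => /eqP ->.
rewrite (hx h 0%N Hh) nprodZr -mu_form// -scalerDl.
congr (_ *: _).
by have := heis_frmDr hT 1 Hh Hnu mu_mem; rewrite scale1r mul1r => ->.
Qed.

End ExponentialShift.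

(** Both exponentials are regular on [J], so their composite is a mode of their product, which is a
    nonzero multiple of the vacuum. *)
Lemma lor_expJ_inverse mu t : mu = t *: rho -> L mu.1 -> @II_lattice C mu.2 ->
  exists2 c, c != 0 & forall x, J x ->
    nprod (lor_exp T e mu) (-1) (nprod (lor_exp T e (- mu)) (-1) x) = c *: x.
Proof.
move=> mu_rho mu1 mu2; have mu0 : form mu mu = 0.
  by rewrite mu_rho (heis_frmZr hT) ?(heis_sym hT (subspaceZ (heis_sub hT) _ _))//
    ?(heis_frmZr hT)// ?rho_rho ?mulr0//; exact: (subspaceZ (heis_sub hT)).
have [c c0 cE] := lor_exp_inverse T hH L_even L_va mu1 mu2 mu0.
exists c => // x Jx; rewrite -iterate_m1.
- by rewrite cE nprodZl va_vacl.
- exact: (lor_expJ_regular mu_rho).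
- apply: (@lor_expJ_regular (- mu) (- t)) => //.
  + by rewrite mu_rho scaleNr.
  + exact: (latticeN L_even).
  + exact: (latticeN (II_even C)).
Qed.

Lemma Nrho_rho : Nrho = N%:R *: rho.
Proof.
congr (_, _); rewrite /= II_vecZ mulr1; congr (II_vec _ _).
by have N0 := lor_N_neq0; field.
Qed.

Lemma II_Nrho : @II_lattice C Nrho.2.
Proof. by exists N%:Z, K. Qed.

Lemma sigma_Nrho : form sigma Nrho = N%:R.
Proof.
rewrite (lor_sigma_form hH) /= ?II_vec0E//.
exact: (subspaceZ (subspace_lspan L)).
Qed.

(** * Uniqueness of lifts in a window and shifts between windows *)

Section Injectivity.
Hypothesis Nalpha_L : L (N%:R *: alpha).

Lemma lor_shift_injective x : J x -> nprod expNrho (-1) x = 0 -> x = 0.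
Proof.
move=> Jx Ex.
have [|||c c0 cE] := @lor_expJ_inverse (- Nrho) (- N%:R).
- by rewrite Nrho_rho scaleNr.
- exact: (latticeN L_even).
- exact: (latticeN (II_even C) II_Nrho).
have := cE x Jx; rewrite opprK Ex nprod0r => /esym/eqP.
by rewrite scaler_eq0 (negPf c0) => /eqP.
Qed.

(** Once the creation terms are projected away, [x = y' - E y'] with [E] of degree [N]. Finite
    support of [y'] is propagated upwards from very low degrees to the window, and downwards from
    very high ones by injectivity of [E]; together these give [y' = 0]. *)
Lemma quot_injective (I : eqType) (a0 : int) (s : seq I) (deg : I -> int) (f : I -> T) :
  (forall i, i \in s -> a0 <= deg i < a0 + N%:Z /\
     nprod (elt sigma) 0 (f i) = (deg i)%:~R *: f i) ->
  let x := \sum_(i <- s) f i in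
  J x -> (forall h (n : nat), space h -> nprod (elt h) n.+1%:Z x = 0) ->
  q x = 0 -> x = 0.
Proof.
move=> sf x Jx hx qx.
have Px : P x by apply/(quot_ker Va).
have [l [y [Jl Jy xE]]] := lor_P_decomposition Px.
pose E := nprod expNrho (-1).
have E_lin : linear E := va_linr _ _.
have JE y' : J y' -> J (E y').
  by apply: lor_J_mode; exact: (lor_expJ_mem Nrho_rho Nalpha_L II_Nrho).
have [d [b zb]] := zbasis_lattice L_even.
have [g bgP] := lattice_dual_bases L_even hH zb.
have bgT := lor_dual_bases T hH alpha_H alpha_norm bgP.
have hO z : (exists mu, lor_lattice L mu /\ pure_vac mu z) ->
    exists mu, highest_weight space form elt mu z.
  by move=> [nu [Lnu py]]; exists nu; exact: pure_vacuum_highest_weight.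
pose cr := creation elt (lor_basis alpha kappa b).
pose an := annihilation elt (lor_cobasis alpha kappa g).
pose Inv z := exists2 y', J y' & z = x - (y' - E y').
have Inv_proj t k z : Inv z -> Inv (fock_proj cr an t k.+1 z).
  move=> [y' Jy' ->]; have p_lin := @fock_proj_linear _ _ _ cr an (creation_linear _ _)
    (annihilation_linear _ _) t k.+1.
  have an_mem : space (lor_cobasis alpha kappa g t.1) := dual_g bgT _.
  have px : fock_proj cr an t k.+1 x = x.
    by apply: fock_proj_id; [exact: creation_linear|exact: annihilation_linear|exact: hx].
  rewrite (lfunB p_lin) (lfunB p_lin) px.
  suff [Jp Ep] : J (fock_proj cr an t k.+1 y') /\
      E (fock_proj cr an t k.+1 y') = fock_proj cr an t k.+1 (E y').
    by exists (fock_proj cr an t k.+1 y'); rewrite // Ep.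
  case: t an_mem {p_lin px} => -[i|[]] n an_mem.
  - have Hb := dual_f bgP i; have Hg := dual_g bgP i.
    apply: (@fock_proj_comm _ _ _ cr an _ _ J T (cr (inl i, n)) (an (inl i, n)) E y') => //.
    + by move=> c u v _ _; exact: E_lin.
    + move=> u Ju; apply: (subspaceZ subJ); apply: lor_J_orthogonal => //.
      exact: rho_hat.
    + by move=> u Ju; apply: lor_J_annihilation.
    + move=> u Ju; rewrite /cr /creation (lfunZ E_lin); congr (_ *: _).
      apply: (lor_expJ_orthogonal Nrho_rho Nalpha_L II_Nrho) => //.
      exact: rho_hat.
    + by move=> u Ju; apply: (lor_expJ_annihilation Nrho_rho Nalpha_L II_Nrho).
  - apply: (@fock_proj_comm _ _ _ cr an _ _ J T (cr (inr true, n)) (an (inr true, n)) E y') => //.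
    + by move=> c u v _ _; exact: E_lin.
    + by move=> u Ju; apply: (subspaceZ subJ); apply: lor_J_orthogonal.
    + by move=> u Ju; apply: lor_J_annihilation.
    + move=> u Ju; rewrite /cr /creation (lfunZ E_lin); congr (_ *: _).
      by apply: (lor_expJ_orthogonal Nrho_rho Nalpha_L II_Nrho).
    + by move=> u Ju; apply: (lor_expJ_annihilation Nrho_rho Nalpha_L II_Nrho).
  - rewrite !fock_proj_id//; try exact: creation_linear; try exact: annihilation_linear.
      by have /lor_JP := JE _ Jy'; exact.
    by have /lor_JP := Jy'; exact.
(* The [rho] creation terms of [x] sum to [x - (y - E y)]. Reducing this sum, whose vacuum part is
   zero, only replaces [y] by another element of [J]. *)
have [y' Jy' /esym/eqP] : Inv 0.
  apply: (@fock_reduce _ _ _ cr an (creation_linear _ _) (annihilation_linear _ _)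
    (annihilation_creation hT bgT) (annihilation_creation_neq hT bgT)
    (creation_comm hT bgT) (annihilation_comm hT bgT) Inv 0
    [seq ((inr true, t.1), t.1.+1%:R *: t.2) | t <- l] Inv_proj).
  - by move=> i; exact: nprod0r.
  - move=> _ /mapP[t _ ->]; apply: (fock_span_nilpotent hT hO (lor_fock_span V_span _)).
    exact: (dual_g bgT).
  exists y => //; rewrite add0r big_map xE addrK; apply: eq_bigr => t _.
  by rewrite /cr /creation nprodZr scalerA mulVf ?scale1r// pnatr_eq0.
rewrite subr_eq0 => /eqP xE'.
have [pr [pr_lin [pr_sum [pr_fin [pr_eig [_ [pr_comm pr_stab]]]]]]] :=
  int_grading (va_linr (elt sigma) 0) (lor_sigma_span hH V_span (T := T)).
have pr_x a : ~~ (a0 <= a < a0 + N%:Z) -> pr a x = 0.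
  move=> a_out; rewrite /x (lfun_sum (pr_lin a)) big_seq big1// => c /sf[c_in fc].
  by rewrite (pr_eig (deg c))// ifF//; apply: contraNF a_out => /eqP ->.
have pr_E a : pr a (E y') = E (pr (a - N%:Z) y').
  apply: pr_comm => // z; rewrite /E (lor_expJ_comm Nrho_rho Nalpha_L II_Nrho)//.
  have := sigma_Nrho; rewrite {1}Nrho_rho (heis_frmZr hT)// => ->.
  by rewrite sub0r subrK.
have prJ a : J (pr a y').
  by apply: (pr_stab J subJ) => // z; exact: (@lor_J_annihilation sigma 0%N z sigma_mem).
have prE a : pr a x = pr a y' - E (pr (a - N%:Z) y').
  by rewrite xE' (lfunB (pr_lin a)) pr_E.
have [M pr_M] : exists M : nat, forall a, (M < `|a|)%N -> pr a y' = 0.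
  have [s' s'0] := pr_fin y'.
  have [M sM] := seq_int_bound s'.
  by exists M => a aM; apply: s'0; apply: contraTN aM => /sM; rewrite -leqNgt.
have lower (n : nat) a : a < a0 -> a < - M%:Z + n%:Z * N%:Z -> pr a y' = 0.
  elim: n a => [|n IHn] a a_lt a_n; first by apply: pr_M; lia.
  have := prE a; rewrite pr_x; last by rewrite negb_and -!ltNge a_lt.
  by rewrite (IHn (a - N%:Z)); [rewrite (lfun0 E_lin) subr0|lia|nia].
(* Degrees inside the window are included, because [a + N] then already lies above it. *)
have upper (n : nat) a : a0 <= a -> M%:Z - n%:Z * N%:Z < a -> pr a y' = 0.
  elim: n a => [|n IHn] a a_le a_n; first by apply: pr_M; lia.
  have := prE (a + N%:Z); rewrite pr_x; last by rewrite negb_and -leNgt -ltNge; lia.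
  rewrite addrK (IHn (a + N%:Z)); [|lia|nia].
  by rewrite sub0r => /esym/eqP; rewrite oppr_eq0 => /eqP /(lor_shift_injective (prJ a)).
have y'0 : y' = 0.
  have [s' [_ ->]] := pr_sum y'; apply: big1 => a _.
  have [a_lt|a_le] := ltP a a0.
    by apply: (lower (`|a| + M).+1 a) => //; nia.
  by apply: (upper (`|a| + M).+1 a) => //; nia.
by rewrite xE' y'0 (lfun0 E_lin) subrr.
Qed.

Lemma quot_shift mu x (k : int) : lor_lattice L mu -> pure_vac mu x -> J x ->
  exists x', [/\ pure_vac (mu + k%:~R *: Nrho) x', J x' & q x' = q x].
Proof.
move=> Lmu px Jx.
have [c c0 cE] := lor_expJ_inverse Nrho_rho Nalpha_L II_Nrho.
have L_shift m : lor_lattice L (mu + m%:~R *: Nrho).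
  case: Lmu => Lmu1 [a [a' mu2]]; split.
    apply: (dual_latticeD hH Lmu1); apply: (dual_latticeZ hH L_even).
    exact: (sub_dual_lattice L_even).
  exists (a + m * N%:Z), (a' + m * K).
  by rewrite /= mu2 II_vecZ II_vecD !intrD !intrM.
have step (m : int) x' : pure_vac (mu + m%:~R *: Nrho) x' -> J x' -> q x' = q x ->
    exists x'', [/\ pure_vac (mu + (m + 1)%:~R *: Nrho) x'', J x'' & q x'' = q x].
  move=> px' Jx' qx'; exists (nprod expNrho (-1) x'); split.
  - apply: highest_weight_pure => //; rewrite intrD scalerDl scale1r addrA.
    apply: (lor_expJ_weight Nrho_rho) => //; [exact: II_Nrho|by case: (L_shift m) => -[]|].
    exact: (pure_vacuum_highest_weight (L_shift m)).
  - by apply: lor_J_mode => //; exact: (lor_expJ_mem Nrho_rho Nalpha_L II_Nrho).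
  - have JE : J (nprod expNrho (-1) x').
      by apply: lor_J_mode => //; exact: (lor_expJ_mem Nrho_rho Nalpha_L II_Nrho).
    have := quot_P (subspaceB subJ Jx' JE) (lor_P_shift Jx').
    by rewrite (lonB subJ q_lin)// qx' => /eqP; rewrite subr_eq0 => /eqP.
have NL1 := latticeN L_even Nalpha_L; have NL2 := latticeN (II_even C) II_Nrho.
have Nr : - Nrho = - N%:R *: rho by rewrite Nrho_rho scaleNr.
have step_back (m : int) x' : pure_vac (mu + m%:~R *: Nrho) x' -> J x' -> q x' = q x ->
    exists x'', [/\ pure_vac (mu + (m - 1)%:~R *: Nrho) x'', J x'' & q x'' = q x].
  move=> px' Jx' qx'; set x1 := nprod (lor_exp T e (- Nrho)) (-1) x'.
  have Jx1 : J x1 by apply: lor_J_mode => //; exact: (lor_expJ_mem Nr NL1 NL2).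
  have px1 : pure_vac (mu + (m - 1)%:~R *: Nrho) x1.
    apply: highest_weight_pure => //; rewrite intrD scalerDl scaleN1r addrA.
    apply: (lor_expJ_weight Nr) => //; first by case: (L_shift m) => -[].
    exact: (pure_vacuum_highest_weight (L_shift m)).
  have JE : J (nprod expNrho (-1) x1).
    by apply: lor_J_mode => //; exact: (lor_expJ_mem Nrho_rho Nalpha_L II_Nrho).
  (* The exponentials of [N rho] and [- N rho] are inverse only up to the scalar [c]. *)
  exists (c^-1 *: x1); split.
  - exact: (subspaceZ (subspace_pure_vacuum _ _ _)).
  - exact: (subspaceZ subJ).
  - have := quot_P (subspaceB subJ Jx1 JE) (lor_P_shift Jx1).
    rewrite (lonB subJ q_lin)// /x1 cE// (lonZ subJ q_lin c Jx') -/x1 (lonZ subJ q_lin)//.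
    by move=> /eqP; rewrite subr_eq0 => /eqP ->; rewrite scalerA mulVf// scale1r.
elim: k => [|k [x' [px' Jx' qx']]|k [x' [px' Jx' qx']]].
- by exists x; rewrite scale0r addr0.
- have -> : k.+1%:Z = k%:Z + 1 by lia.
  exact: step px' Jx' qx'.
- have -> : - k.+1%:Z = - k%:Z - 1 by lia.
  exact: step_back px' Jx' qx'.
Qed.

End Injectivity.

(** * Membership of [N alpha] in [L], and lifts in a window *)

Section OrderVector.
Variables (Lt : set V) (et : V -> Va).
Local Notation Ua := (Comm (generated_va (hat @` lspan L))).
Hypothesis Lt_even : even_lattice frm Lt.
Hypothesis Lt_H : lspan Lt = lspan L.
Hypothesis Lt_va : lattice_va frm Lt (Comm Ua) hat et.

Lemma quot_vac_neq0 : vac Va <> 0.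
Proof.
have := exp_neq0 Lt_va (lattice0 Lt_even).
by case: Lt_va => _ -> _ _ _ /eqP.
Qed.

Lemma quot_commutes x : J x ->
  (forall y, J y -> forall n : nat, nprod x n%:Z y = 0) -> Comm Ua (q x).
Proof.
move=> Jx x_reg u [m|//] _ _; have [y Jy <-] := quot_surj u.
rewrite -quot_nprod// (annihilate_sym (x_reg y Jy)).
exact: (lon0 subJ q_lin).
Qed.

(** The exponential is regular on [J], so its image commutes with all of [V^[alpha]] and lies in
    [V_Lt], where its weight zero makes it a multiple of the vacuum. The inverse exponential
    excludes the multiple zero. *)
Lemma quot_exp_scalar (c : nat) : L (c%:R *: (N%:R *: alpha)) ->
  exists2 m, m != 0 & q (lor_exp T e (c%:R *: Nrho)) = m *: vac Va.
Proof.
move=> Lc; set mu := c%:R *: Nrho.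
have mu_rho : mu = (c%:R * N%:R) *: rho by rewrite /mu Nrho_rho scalerA.
have mu2 : @II_lattice C mu.2.
  by exists (c%:Z * N%:Z), (c%:Z * K); rewrite /mu /= II_vecZ !intrM.
have Jw := lor_expJ_mem mu_rho Lc mu2.
have Hmu : space mu by exact: (lspan_sub Lc).
have Cw : Comm Ua (q (lor_exp T e mu)).
  by apply: quot_commutes => // y; exact: (lor_expJ_regular mu_rho).
have hVt : heisenberg (lspan Lt) frm hat by rewrite Lt_H; exact: quot_heisenberg.
have hw : highest_weight (lspan Lt) frm hat 0 (q (lor_exp T e mu)).
  rewrite Lt_H; have := quot_highest_weight Hmu Jw (@lor_expJ_highest_weight mu Lc mu2).
  by rewrite /mu /= II_vecZ II_vec0E scalerA subrr.
have [m mE] := lattice_va_vacuum hVt Lt_even Lt_va Cw hw.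
exists m => //; apply/eqP => m0; move: mE; rewrite m0 scale0r => w0.
have mu0 : form mu mu = 0.
  have Hr t : space (t *: rho) by exact: (subspaceZ (heis_sub hT)).
  by rewrite mu_rho (heis_frmZr hT)// (heis_sym hT)// (heis_frmZr hT)// rho_rho !mulr0.
have Lmu : L mu.1 := Lc.
have [c' c'0 cE] := lor_exp_inverse T hH L_even L_va Lmu mu2 mu0.
have Jw' : J (lor_exp T e (- mu)).
  apply: (@lor_expJ_mem (- mu) (- (c%:R * N%:R))); first by rewrite mu_rho scaleNr.
    exact: (latticeN L_even).
  exact: (latticeN (II_even C)).
have Jvac : J (vac T) by case: subvaJ.
have := congr1 q cE; rewrite quot_nprod// w0 nprod0l (lonZ subJ q_lin)// quot_vac.
move=> /esym/eqP; rewrite scaler_eq0 (negPf c'0) => /eqP.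
exact: quot_vac_neq0.
Qed.

(* Apply the [sigma]-degree to [e^(c N rho) - m in P]: the degree components
   [t a] of [q y] satisfy [t a = t (a - N)] except at [a = 0] and [a = c N], so
   [t N = - m] when [1 < c].  Here [expNrho] may still be meaningless. *)
Lemma quot_degree_shift (c : nat) : (1 < c)%N -> L (c%:R *: (N%:R *: alpha)) ->
  exists Y, [/\ J Y, q Y = vac Va & nprod (elt sigma) 0 Y = N%:R *: Y].
Proof.
move=> c_gt1 Lc; have [m m0 qw] := quot_exp_scalar Lc.
set w := lor_exp T e _ in qw.
have mu_rho : c%:R *: Nrho = (c%:R * N%:R) *: rho by rewrite Nrho_rho scalerA.
have mu2 : @II_lattice C (c%:R *: Nrho).2.
  by exists (c%:Z * N%:Z), (c%:Z * K); rewrite /= II_vecZ !intrM.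
have Jw : J w := lor_expJ_mem mu_rho Lc mu2.
have Jvac : J (vac T) by case: subvaJ.
have Jz : J (w - m *: vac T) by apply: (subspaceB subJ) => //; exact: (subspaceZ subJ).
have Pz : P (w - m *: vac T).
  apply/(quot_ker Va) => //; rewrite (lonB subJ q_lin) ?(lonZ subJ q_lin)//.
    by rewrite qw quot_vac subrr.
  exact: (subspaceZ subJ).
have [l [y [Jl Jy zE]]] := lor_P_decomposition Pz.
pose G := nprod expNrho (-1).
have G_lin : linear G := va_linr _ _.
have [pr [pr_lin [_ [pr_fin [pr_eig [pr_deg [pr_comm pr_stab]]]]]]] :=
  int_grading (va_linr (elt sigma) 0) (lor_sigma_span hH V_span (T := T)).
have prJ a x : J x -> J (pr a x).
  move=> Jx; apply: (pr_stab J subJ) => // u.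
  exact: (@lor_J_annihilation sigma 0%N u sigma_mem).
(* Only the second tensor factor enters, so [e (N alpha)] may be arbitrary here. *)
have pr_G a x : pr a (G x) = G (pr (a - N%:Z) x).
  apply: pr_comm => // u; rewrite zero_mode_derivation.
  by rewrite (lor_sigma_tens T _ 0 II_Nrho)/= II_vec0E nprodZl.
have pr_rho a (n : nat) x : pr a (nprod (elt rho) (- n.+1%:Z) x) =
    nprod (elt rho) (- n.+1%:Z) (pr a x).
  rewrite (pr_comm _ 0 (va_linr _ _)) ?subr0// => u.
  by rewrite (heis_zero_mode hT)// scale0r addr0.
pose D x := \sum_(t <- l) nprod (elt rho) (- t.1.+1%:Z) (pr x t.2).
have JD x : J (D x).
  apply: (subspace_sum subJ) => t /Jl Jt; apply: lor_J_orthogonal => //.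
  exact: prJ.
have qD x : q (D x) = 0.
  rewrite (lon_sum subJ q_lin) => [|t /Jl Jt]; last first.
    by apply: lor_J_orthogonal => //; exact: prJ.
  rewrite big_seq big1// => t /Jl Jt; apply: quot_P.
    by apply: lor_J_orthogonal => //; exact: prJ.
  by apply: lor_P_creation; exact: prJ.
have prE a : pr a w - m *: pr a (vac T) = D a + (pr a y - G (pr (a - N%:Z) y)).
  have := congr1 (pr a) zE; rewrite (lfunB (pr_lin a)) (lfunZ (pr_lin a)) => ->.
  rewrite (lfunD (pr_lin a)) (lfunB (pr_lin a)) -/(G y) pr_G (lfun_sum (pr_lin a)).
  by congr (_ + _); apply: eq_bigr => t _; rewrite pr_rho.
have JG a : J (G (pr a y)).
  have -> : G (pr a y) = D (a + N%:Z) + pr (a + N%:Z) y -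
      (pr (a + N%:Z) w - m *: pr (a + N%:Z) (vac T)).
    have := prE (a + N%:Z); rewrite addrK => ->.
    by rewrite addrA opprB [RHS]addrC subrK.
  apply: (subspaceB subJ); first by apply: (subspaceD subJ) => //; exact: prJ.
  apply: (subspaceB subJ); first exact: prJ.
  by apply: (subspaceZ subJ); exact: prJ.
pose t a := q (pr a y).
have qG a : q (G (pr a y)) = t a.
  have := quot_P (subspaceB subJ (prJ a _ Jy) (JG a)) (lor_P_shift (prJ a _ Jy)).
  by rewrite (lonB subJ q_lin)//; [move=> /eqP; rewrite subr_eq0 => /eqP <-|exact: prJ].
have w_deg : nprod (elt sigma) 0 w = (c%:Z * N%:Z)%:~R *: w.
  by rewrite (lor_sigma_tens T _ 0 mu2)/= mxE II_vec0E intrM.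
have vac_deg : nprod (elt sigma) 0 (vac T) = 0%:~R *: vac T.
  by rewrite va_creat// scale0r.
have tE a : t a = t (a - N%:Z) + (if a == c%:Z * N%:Z then m *: vac Va else 0)
    - (if a == 0 then m *: vac Va else 0).
  have := congr1 q (prE a); rewrite (pr_eig _ a _ w_deg) (pr_eig _ a _ vac_deg).
  have JI (c0 : bool) x : J x -> J (if c0 then x else 0).
    by case: c0 => // _; exact: (subspace0 subJ).
  have qI (c0 : bool) x : q (if c0 then x else 0) = if c0 then q x else 0.
    by case: c0 => //; exact: (lon0 subJ q_lin).
  have -> : q (D a + (pr a y - G (pr (a - N%:Z) y))) = t a - t (a - N%:Z).
    rewrite (lonD q_lin (JD a) (subspaceB subJ (prJ a _ Jy) (JG _))) qD add0r.
    by rewrite (lonB subJ q_lin (prJ a _ Jy) (JG _)) qG.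
  rewrite (lonB subJ q_lin (JI _ _ Jw) (subspaceZ subJ _ (JI _ _ Jvac))).
  rewrite (lonZ subJ q_lin _ (JI _ _ Jvac)) !qI qw quot_vac => /eqP.
  rewrite eq_sym subr_eq => /eqP ->; rewrite addrC addrA; congr (_ + _ - _).
  by case: ifP => _; rewrite ?scaler0.
have t_neg (n : nat) : t (- N%:Z) = t (- (n.+1%:Z * N%:Z)).
  elim: n => [|n IHn]; first by rewrite mul1r.
  rewrite IHn tE !ifF ?addr0 ?subr0; try by apply/eqP; nia.
  by congr t; lia.
have t_N0 : t (- N%:Z) = 0.
  have [s' s'0] := pr_fin y; have [M sM] := seq_int_bound s'.
  rewrite (t_neg M) /t s'0 ?(lon0 subJ q_lin)//.
  by apply/negP => /sM; nia.
have tN : t N%:Z = - (m *: vac Va).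
  rewrite tE subrr tE sub0r t_N0 add0r eqxx.
  rewrite !ifF ?subr0 ?addr0 ?sub0r//; by apply/eqP; nia.
have JN : J (pr N%:Z y) by exact: prJ.
exists (- m^-1 *: pr N%:Z y); split.
- exact: (subspaceZ subJ).
- by rewrite (lonZ subJ q_lin)// -/(t _) tN scalerN scaleNr opprK scalerA mulVf ?scale1r.
- by rewrite nprodZr pr_deg !scalerA mulrC.
Qed.

Lemma lor_rho_multiple (mu : X) (a : C) : mu.1 = a *: alpha -> mu.2 0 0 = a -> space mu ->
  form rho mu = 0 -> mu = a *: rho.
Proof.
move=> mu1 mu20 Hmu rmu; have mu21 : mu.2 0 1 = a * kappa.
  move: rmu; rewrite /lor_form mu1 (heis_frmZr hH)// alpha_norm /=.
  rewrite [X in II_form _ X]II_vec_eta II_formE mu20 => E.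
  by apply/eqP; rewrite -subr_eq0 -oppr_eq0 -{}E; apply/eqP; ring.
rewrite [LHS]surjective_pairing mu1 [mu.2]II_vec_eta mu20 mu21.
by congr (_, _); rewrite /= II_vecZ mulr1.
Qed.

Hypothesis V_irr : irreducible_sub (@setT (adjoint_module V)).
Hypothesis VL_U : VL = Comm (Comm (generated_va (lspan L))).
Hypothesis Nalpha_dual : Ls (N%:R *: alpha).

Lemma lor_commutantP u : Comm (generated_va (lspan L)) u <->
  highest_weight (lspan L) frm idV 0 u.
Proof.
by have := commutant_highest_weight hH u; rewrite image_id.
Qed.

(* [P] is only meaningful once [N alpha] is known to lie in [L]: if the minimal
   multiple of [N alpha] in [L] were proper, the degree argument would give a
   vacuum vector of weight [N alpha] in [V], commuting with [U] by simplicity. *)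
Lemma Nalpha_mem : L (N%:R *: alpha).
Proof.
have [c c0 Lc] := dual_multiple L_even hH Nalpha_dual.1 Nalpha_dual.2.
have [c_le1|c_gt1] := leqP c 1.
  by move: Lc; rewrite (_ : c = 1%N) ?scale1r//; lia.
have [Y [JY qY Ydeg]] := quot_degree_shift c_gt1 Lc.
have [d [b zb]] := zbasis_lattice L_even.
have [g bgP] := lattice_dual_bases L_even hH zb.
have H0 : lspan L 0 := subspace0 (subspace_lspan L).
have hvac : highest_weight (lspan L) frm hat 0 (q Y).
  by move=> h n Hh; rewrite qY va_creat// (heis_frm0r hH Hh) scale0r if_same.
have [s [F [us sF s_lam qYE s_deg]]] := quot_vacuum_lift bgP H0 JY hvac.
(* Quotient weight zero, degree [N] and orthogonality to [rho] leave [N rho] as the only possible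
   weight of a lift. *)
have s_mu mu : mu \in s -> mu = Nrho.
  move=> ms; have mu2 := s_deg _ Ydeg _ ms; rewrite Nrho_rho.
  have [[[Hmu _] _] _ _ _ rmu] := sF _ ms.
  apply: lor_rho_multiple => //.
  by have /eqP := s_lam _ ms; rewrite mu2 subr_eq0 => /eqP.
have [Nrho_s|Nrho_s] := boolP (Nrho \in s); last first.
  have s0 : s = [::].
    by case: (s) s_mu Nrho_s => // mu s' /(_ mu (mem_head _ _)) ->; rewrite mem_head.
  by have := quot_vac_neq0; rewrite -qY qYE s0 big_nil.
have sE : s = [:: Nrho].
  case: (s) us s_mu Nrho_s => // mu [|nu s'] /= us s_mu _.
    by rewrite (s_mu mu (mem_head _ _)).
  have := s_mu mu (mem_head _ _); have := s_mu nu; rewrite !inE eqxx orbT => /(_ isT).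
  by move=> nuE muE; move: us; rewrite inE muE nuE eqxx.
have [Lmu [v [hv FE]] JF _ _] := sF _ Nrho_s.
set ex := ii_e A Nrho.2 in FE.
have qv : q (tens T v ex) = vac Va by rewrite -FE -qY qYE sE big_seq1.
have J_tens z : highest_weight (lspan L) frm idV (N%:R *: alpha) z -> J (tens T z ex).
  move=> hz; apply: (@lor_J_highest_weight Nrho); first exact: Nalpha_dual.1.
    by apply: (pure_vacuum_highest_weight Lmu); exists z.
  by rewrite Nrho_rho (heis_frmZr hT)// rho_rho mulr0.
have J_U u : highest_weight (lspan L) frm idV 0 u -> J (tens T u (vac A)).
  move=> hu; apply/lor_JP => n; rewrite lor_elt_act /= (hu alpha n alpha_H).
  by rewrite (heis_frm0r hH alpha_H) scale0r if_same tens0l add0r va_creat// tens0r.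
have v_U : Comm (Comm (generated_va (lspan L))) v.
  move=> u [k|//] /lor_commutantP hu _; apply: contrapT => v1_neq0.
  set v1 := nprod u k%:Z v in v1_neq0.
  have hv1 : highest_weight (lspan L) frm idV (N%:R *: alpha) v1.
    exact: commutant_mode_highest_weight.
  have qv1 : q (tens T v1 ex) = 0.
    rewrite /v1 -tens_actl quot_nprod ?qv ?va_creat//; [exact: J_U|exact: J_tens].
  (* A nonzero [u(k) v] would generate [v] under [U]; but its image is a nonnegative mode applied to
     the vacuum, hence zero, and then the image of [v], the vacuum, would vanish too. *)
  have := highest_weight_irreducible hH L_even V_span V_irr Nalpha_dual hv1 v1_neq0 hv.
  suff sub : lspan [set z | exists u' l, highest_weight (lspan L) frm idV 0 u' /\
      z = nprod u' l v1] `<=` [set z | J (tens T z ex) /\ q (tens T z ex) = 0].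
    by move=> /sub[_]; rewrite qv; exact: quot_vac_neq0.
  apply: lspan_min => [|_ [u' [l [hu' ->]]]].
    split; first by rewrite /= tens0l (lon0 subJ q_lin); split=> //; exact: subspace0.
    move=> a x y [Jx qx] [Jy qy] /=; rewrite tensDl tensZl q_lin// qx qy scaler0 addr0.
    by split=> //; exact: subJ.2.
  split; first exact/J_tens/commutant_mode_highest_weight.
  by rewrite -tens_actl quot_nprod ?qv1 ?nprod0r//; [exact: J_U|exact: J_tens].
apply: (lattice_va_weight hH L_even L_va (x := v)).
- by rewrite VL_U.
- by apply/eqP => v0; apply: quot_vac_neq0; rewrite -qv v0 tens0l (lon0 subJ q_lin).
- exact: Nalpha_dual.1.
- exact: highest_weight_weight.
Qed.

(** Each component of a lift is shifted separately by a multiple of [N rho]. Shifted weights may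
    coincide, so the result is regrouped by weight. *)
Lemma quot_window_lift (a0 : int) lam y : lspan L lam ->
  highest_weight (lspan L) frm hat lam y ->
  exists (s : seq X) (F : X -> T),
  [/\ uniq s,
      forall mu, mu \in s -> [/\ lor_lattice L mu, pure_vac mu (F mu) & form rho mu = 0],
      forall mu, mu \in s -> mu.1 - mu.2 0 0 *: alpha = lam,
      forall mu, mu \in s -> exists2 a : int, mu.2 0 0 = a%:~R & a0 <= a < a0 + N%:Z
    & y = q (\sum_(mu <- s) F mu)].
Proof.
move=> Hlam hy; have [x Jx xy] := quot_surj y.
have [d [b zb]] := zbasis_lattice L_even.
have [g bgP] := lattice_dual_bases L_even hH zb.
have hqx : highest_weight (lspan L) frm hat lam (q x) by rewrite xy.
have [s0 [F0 [_ sF0 s0_lam qxE _]]] := quot_vacuum_lift bgP Hlam Jx hqx.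
pose Lam := [set mu | [/\ lor_lattice L mu, form rho mu = 0, mu.1 - mu.2 0 0 *: alpha = lam
  & exists2 a : int, mu.2 0 0 = a%:~R & a0 <= a < a0 + N%:Z]].
pose O := lspan [set z | exists mu, Lam mu /\ pure_vac mu z].
have subO : subspace O := subspace_lspan _.
have LamJ mu z : Lam mu -> pure_vac mu z -> J z.
  move=> [Lmu rmu _ _] pz; apply: (lor_J_highest_weight _ _ rmu); first by case: Lmu => -[].
  exact: (pure_vacuum_highest_weight Lmu).
have OJ z : O z -> J z.
  by apply: (lspan_min subJ) => w [mu [Lm pw]]; exact: (LamJ mu).
have [x' Ox' qx'] : exists2 x', O x' & q x' = y.
  rewrite -xy qxE.
  suff : [set y | exists2 x', O x' & q x' = y] (\sum_(mu <- s0) q (F0 mu)) by [].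
  apply: subspace_sum => [|mu ms].
    split; first by exists 0; [exact: subspace0|exact: (lon0 subJ q_lin)].
    move=> c _ _ [u Ou <-] [v Ov <-]; exists (c *: u + v); first exact: subO.2.
    by rewrite q_lin//; exact: OJ.
  have [Lmu pF JF _ rmu] := sF0 _ ms.
  have [a [a' mu2]] := Lmu.2.
  (* This replaces the degree [a] by [a0] plus the remainder of [a - a0] modulo [N]. *)
  pose k := - divz (a - a0) N%:Z.
  have [z [pz Jz qz]] := quot_shift Nalpha_mem k Lmu pF JF.
  exists z => //; apply: lspan_sub; exists (mu + k%:~R *: Nrho); split=> //.
  have Hmu : space mu by case: Lmu => -[].
  have Hk : space (k%:~R *: Nrho).
    by apply: (subspaceZ (heis_sub hT)); exact: Nalpha_dual.1.
  split.
  - case: Lmu => Lmu1 _; split.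
      apply: (dual_latticeD hH Lmu1); exact: (dual_latticeZ hH L_even).
    exists (a + k * N%:Z), (a' + k * K).
    by rewrite /= mu2 II_vecZ II_vecD !intrD !intrM.
  - have := heis_frmDr hT 1 rho_mem Hmu Hk; rewrite scale1r mul1r => ->.
    rewrite rmu add0r Nrho_rho (heis_frmZr hT) ?(heis_frmZr hT)// ?rho_rho ?mulr0//.
    exact: (subspaceZ (heis_sub hT)).
  - rewrite -(s0_lam _ ms) /= mu2 II_vecZ II_vecD !II_vec0E scalerDl opprD !scalerA.
    by rewrite addrACA subrr addr0.
  exists (a + k * N%:Z); first by rewrite /= mu2 II_vecZ II_vecD II_vec0E intrD intrM.
  have N0 : N%:Z != 0 by lia.
  have := divz_eq (a - a0) N%:Z; have := modz_ge0 (a - a0) N0.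
  have := ltz_mod (a - a0) N0; rewrite /k; nia.
have [s [F [us sF x'E]]] := lspan_graded (fun mu _ => @subspace_pure_vacuum C V L A T mu) Ox'.
exists s, F; split=> // [mu /sF[[]]|mu /sF[[]]|mu /sF[[]]|]//.
by rewrite -x'E.
Qed.

(** [quot_injective] makes the whole sum vanish, and distinct weights then separate its terms. *)
Lemma quot_window_injective (I : eqType) (a0 : int) (s : seq I) (w : I -> X) (F : I -> T) :
  uniq s -> {in s &, injective w} ->
  (forall i, i \in s -> [/\ lor_lattice L (w i), pure_vac (w i) (F i) & form rho (w i) = 0]) ->
  (forall i, i \in s -> exists2 a : int, (w i).2 0 0 = a%:~R & a0 <= a < a0 + N%:Z) ->
  q (\sum_(i <- s) F i) = 0 -> forall i, i \in s -> F i = 0.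
Proof.
move=> us w_inj sF s_deg q0.
have [d [b zb]] := zbasis_lattice L_even.
have [g bgP] := lattice_dual_bases L_even hH zb.
have bgT := lor_dual_bases T hH alpha_H alpha_norm bgP.
have hF i : i \in s -> highest_weight space form elt (w i) (F i).
  by move=> /sF[Lw pF _]; exact: pure_vacuum_highest_weight.
have Hw i : i \in s -> space (w i) by move=> /sF[[[]]].
pose deg i := xget 0 [set a : int | (w i).2 0 0 = a%:~R /\ a0 <= a < a0 + N%:Z].
have degP i : i \in s -> (w i).2 0 0 = (deg i)%:~R /\ a0 <= deg i < a0 + N%:Z.
  move=> /s_deg[a aE a_in].
  exact: (@xgetPex _ 0 [set a : int | (w i).2 0 0 = a%:~R /\ a0 <= a < a0 + N%:Z]
    (ex_intro _ a (conj aE a_in))).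
have F0 : \sum_(i <- s) F i = 0.
  apply: (@quot_injective Nalpha_mem I a0 s deg F) => //.
  - move=> i si; have [wE d_in] := degP i si; split=> //.
    by rewrite (hF i si sigma 0%N sigma_mem) (lor_sigma_form hH (Hw i si)) wE.
  - apply: (subspace_sum subJ) => i si; have [_ _ rw] := sF i si.
    exact: (lor_J_highest_weight (Hw i si) (hF i si)).
  - move=> h n Hh; rewrite (lfun_sum (va_linr _ _)) big_seq big1// => i si.
    by rewrite (hF i si h n.+1).
apply: (@weight_components _ _ [set 0] _ space I (fun h => nprod (elt h) 0)
  (fun h i => form h (w i)) s F (@subspace_zero _ T)) => //.
- by move=> h Hh; exact: va_linr.
- by move=> h x _ ->; exact: nprod0r.
- by move=> h i Hh si; exact: (hF i si h 0%N).
move=> i j si sj ij; apply: contrapT => nex; move/eqP: ij; apply; apply: w_inj => //.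
apply: (weight_separation hT bgT); [exact: Hw|exact: Hw|move=> h Hh].
by apply/eqP/negPn/negP => ne; apply: nex; exists h.
Qed.

Lemma lor_commutant_mem u : Comm (generated_va (lspan L)) u ->
  J (tens T u (vac A)) /\ Ua (q (tens T u (vac A))).
Proof.
move=> /lor_commutantP hu.
have hT0 : highest_weight space form elt 0 (tens T u (vac A)).
  move=> h n Hh; rewrite lor_elt_act (hu h.1 n Hh) va_creat// tens0r addr0.
  rewrite (heis_frm0r hH Hh) scale0r if_same tens0l.
  by rewrite (heis_frm0r hT Hh) scale0r if_same.
have Ju : J (tens T u (vac A)).
  apply: (lor_J_highest_weight _ hT0); first exact: (subspace0 (heis_sub hT)).
  exact: (heis_frm0r hT rho_mem).
split=> //; apply/(commutant_highest_weight quot_heisenberg).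
have := quot_highest_weight (subspace0 (heis_sub hT)) Ju hT0.
by rewrite /= mxE scale0r subrr.
Qed.

(** * The commutant decomposition and the extended lattice *)

Section Conclusion.
Variables (r N0 : nat) (K0 : int).
Hypothesis N_def : N = (N0 * r)%N.
Hypothesis K_defr : K = K0 * r%:Z.
Hypothesis NK_coprime : coprime N0 `|K0|.
Hypothesis N0alpha_dual : Ls (N0%:R *: alpha).
Variable D : coset_decomposition L e VL (Comm (generated_va (lspan L))).

Let N0_neq0 : N0%:R != 0 :> C.
Proof. by rewrite pnatr_eq0; apply: contraTneq N_gt0 => N00; rewrite N_def N00. Qed.

Let r_neq0 : r%:R != 0 :> C.
Proof. by rewrite pnatr_eq0; apply: contraTneq N_gt0 => r0; rewrite N_def r0 muln0. Qed.

Lemma kappaE : kappa = K0%:~R / N0%:R.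
Proof.
rewrite K_defr N_def natrM intrM -[r%:Z%:~R]/(r%:R : C).
by field; rewrite N0_neq0 r_neq0.
Qed.

Let wv (m : nat) : X := (m * N0)%:R *: rho.

Let wv2 m : (wv m).2 = II_vec (m * N0)%:R (m%:R * K0%:~R).
Proof.
rewrite /wv /= II_vecZ mulr1 kappaE natrM; congr II_vec.
by field.
Qed.

Let wv_deg m : (wv m).2 0 0 = (m * N0)%:Z%:~R.
Proof. by rewrite wv2 II_vec0E. Qed.

Let wv_dual m : Ls (wv m).1.
Proof.
rewrite /wv /= natrM -scalerA.
exact: (dual_latticeZ hH L_even m%:Z).
Qed.

Let wv_lattice m : lor_lattice L (wv m).
Proof.
split; first exact: wv_dual.
by exists (m * N0)%:Z, (m%:Z * K0); rewrite wv2 intrM.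
Qed.

Let wv_rho m : form rho (wv m) = 0.
Proof. by rewrite /wv (heis_frmZr hT)// rho_rho mulr0. Qed.

Let wv_inj : injective wv.
Proof.
move=> m n /(congr1 (fun x : X => x.2 0 0)); rewrite !wv_deg => /intr_inj[].
have := N_gt0; rewrite N_def; nia.
Qed.

Let wv_window m : (m < r)%N ->
  exists2 a : int, (wv m).2 0 0 = a%:~R & 0 <= a < 0 + N%:Z.
Proof. by move=> mr; exists (m * N0)%:Z; [exact: wv_deg|have := N_gt0; rewrite N_def; nia]. Qed.

Let wv_J m x : pure_vac (wv m) x -> J x.
Proof.
move=> px; apply: (lor_J_highest_weight (mu := wv m)) => //; first by case: (wv_dual m).
exact: pure_vacuum_highest_weight.
Qed.

Let wv_Ua m x : pure_vac (wv m) x -> Ua (q x).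
Proof.
move=> px; apply/(commutant_highest_weight quot_heisenberg).
have Hm : space (wv m) by case: (wv_dual m).
have := quot_highest_weight Hm (wv_J px) (pure_vacuum_highest_weight (wv_lattice m) px).
by rewrite wv_deg subrr.
Qed.

Lemma commutant_lift y : Ua y -> exists g : 'I_r -> T,
  (forall m : 'I_r, pure_vac (wv m) (g m)) /\ y = \sum_m q (g m).
Proof.
move=> /(commutant_highest_weight quot_heisenberg) hy.
have H0 : lspan L 0 := subspace0 (subspace_lspan L).
have [s [F [us sF s_lam s_deg ->]]] := quot_window_lift 0 H0 hy.
have s_wv mu : mu \in s -> exists m : 'I_r, mu = wv m.
  move=> ms; have [Lmu _ rmu] := sF _ ms; have [a aE a_in] := s_deg _ ms.
  have Hmu : space mu by case: Lmu => -[].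
  have muE : mu = a%:~R *: rho.
    apply: lor_rho_multiple => //.
    by have /eqP := s_lam _ ms; rewrite aE subr_eq0 => /eqP.
  have [_ [a' [b' mu2]]] := Lmu.
  (* The last coordinate of [a rho] is [a K0 / N0] and must be an integer. Coprimality of [N0] and
     [K0] forces [N0] to divide [a], and the window [[0, N)] leaves [r] quotients. *)
  have aK : a * K0 = b' * N0%:Z.
    move: mu2; rewrite muE /= II_vecZ mulr1 kappaE => /II_vec_inj[_ bE].
    by apply/(@intr_inj C); rewrite !intrM -bE -[N0%:Z%:~R]/(N0%:R : C); field.
  have /dvdzP[k ak] : (N0%:Z %| a)%Z.
    rewrite -(@Gauss_dvdzl _ _ K0); first by rewrite aK dvdz_mull.
    by rewrite coprimezE absz_nat.
  have kr : (`|k| < r)%N by move: a_in; have := N_gt0; rewrite N_def ak; nia.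
  exists (Ordinal kr); rewrite muE ak /wv /=; congr (_ *: _).
  by rewrite natrM -[N0%:R]/(N0%:Z%:~R : C) -[_%:R]/(`|k|%N%:Z%:~R : C) -intrM; congr intmul; nia.
exists (fun m => if wv m \in s then F (wv m) else 0); split.
  move=> m; case: ifP => [/sF[]//|_].
  exact: (subspace0 (subspace_pure_vacuum _ _ _)).
have JF mu : mu \in s -> J (F mu).
  by move=> ms; have [_ pF _] := sF _ ms; have [m mE] := s_wv _ ms;
     move: pF; rewrite {1}mE => /wv_J.
rewrite (lon_sum subJ q_lin)//.
pose G mu := q (if mu \in s then F mu else 0).
transitivity (\sum_(mu <- s) G mu).
  by rewrite big_seq [RHS]big_seq; apply: eq_bigr => mu ms; rewrite /G ms.
rewrite -(@big_uniq_support _ _ s [seq wv m | m : 'I_r <- enum 'I_r] G)//.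
- by rewrite big_map big_enum.
- by rewrite map_inj_uniq ?enum_uniq// => m n /wv_inj/val_inj.
- by move=> mu /s_wv[m ->]; apply: map_f; rewrite mem_enum.
- by move=> mu _ /negPf ms; rewrite /G ms; exact: (lon0 subJ q_lin).
Qed.

Let u_ (m : nat) : V := (m * N0)%:R *: alpha.

Let pure (m : nat) (w : dec_U D (u_ m)) : T :=
  tens T (dec_tau (dec_E D (u_ m) (u_ m)) w) (ii_e A (wv m).2).

Let VL_H : lspan L `<=` VL.
Proof. by case: L_va => _ _ [_]. Qed.

Let u_self m : L (u_ m - u_ m).
Proof. by rewrite subrr; exact: (lattice0 L_even). Qed.

Let u_dual m : Ls (u_ m).
Proof. exact: (wv_dual m). Qed.

Let pure_vacuum_pure m w : pure_vac (wv m) (@pure m w).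
Proof.
exists (dec_tau (dec_E D (u_ m) (u_ m)) w); split=> //.
change (highest_weight (lspan L) frm idV (u_ m) (dec_tau (dec_E D (u_ m) (u_ m)) w)).
by apply: dec_highest_weight => //; exact: u_dual.
Qed.

Let pure_lin m : linear (@pure m).
Proof.
by move=> c x y; rewrite /pure (dec_bilinear D (wv_dual m)).2 tensDl tensZl.
Qed.

Let pure_eq0 m w : @pure m w = 0 -> w = 0.
Proof.
move=> /tens_eq0 p0; apply: (dec_tau_inj (wv_dual m) (u_self m)); apply: p0.
by apply: (exp_neq0 (ii_lattice A)); case: (wv_lattice m).
Qed.

Let window_injective (s : seq 'I_r) (F : 'I_r -> T) : uniq s ->
  (forall m, m \in s -> pure_vac (wv m) (F m)) ->
  q (\sum_(m <- s) F m) = 0 -> forall m, m \in s -> F m = 0.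
Proof.
move=> us pF; apply: (@quot_window_injective _ 0 s (fun m => wv m)) => //.
- by move=> m n _ _ /wv_inj/val_inj.
- by move=> m ms; split; [exact: wv_lattice|exact: pF|exact: wv_rho].
- by move=> m _; exact: wv_window.
Qed.

(** The embeddings send [w] to the class of [e^(m N0 alpha) (x) w (x) e^(m N0, m K0)]. Injectivity
    and directness are uniqueness of lifts in the window from [0]; surjectivity combines
    [commutant_lift] with [coset_highest_weight]. *)
Lemma commutant_decomposition :
  exists f : forall m : 'I_r, dec_U D ((m * N0)%:R *: alpha) -> Va,
  [/\ forall m, linear (f m),
      forall m, injective (f m),
      forall m b n w, Comm (generated_va (lspan L)) b ->
        f m (vact b n w) = nprod (q (tens T b (vac A))) n (f m w)
    & direct_sum_of setT (fun m => range (f m)) Ua].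
Proof.
have f_lin (m : 'I_r) : linear (fun w => q (@pure m w)).
  by move=> c x y; rewrite pure_lin q_lin//; exact: wv_J (pure_vacuum_pure _).
exists (fun m w => q (@pure m w)); split=> //.
- move=> m w w' /eqP; rewrite -subr_eq0 -(lfunB (f_lin m)) => /eqP qw.
  apply/eqP; rewrite -subr_eq0; apply/eqP/(@pure_eq0 m).
  have := @window_injective [:: m] (fun m' => if m' == m then @pure m (w - w') else 0).
  rewrite big_seq1 eqxx => /(_ isT _ qw m (mem_head _ _)); rewrite eqxx; apply.
  by move=> m'; rewrite inE => /eqP ->; rewrite eqxx; exact: pure_vacuum_pure.
- move=> m b n w Ub; rewrite /pure dec_actU// -tens_actl quot_nprod//.
    by case: (lor_commutant_mem Ub).
  exact: wv_J (pure_vacuum_pure _).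
split.
- move=> m _; split; first by exists 0 => //; rewrite (lfun0 (f_lin m)).
  by move=> c _ _ [w _ <-] [w' _ <-]; exists (c *: w + w') => //; exact: f_lin.
- by move=> m _ _ [w _ <-]; exact: wv_Ua (pure_vacuum_pure _).
- move=> y /commutant_lift[g [pg ->]]; exists (enum 'I_r), (fun m => q (g m)).
  split; last by rewrite big_enum.
  move=> m _; split=> //; have [v [hv gE]] := pg m.
  have [w vE] := coset_highest_weight D hH L_even VL_H (wv_dual m) hv.
  by exists w => //; rewrite gE vE.
move=> s F us sF F0 m ms.
have xE (k : 'I_r) : exists x, pure_vac (wv k) x /\ (k \in s -> F k = q x).
  have [ks|ks] := boolP (k \in s); last first.
    by exists 0; split=> //; exact: (subspace0 (subspace_pure_vacuum _ _ _)).
  have [_ [w _ <-]] := sF k ks; exists (@pure k w); split=> //.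
have [x xP] := choice xE.
have qx0 : q (\sum_(k <- s) x k) = 0.
  rewrite (lon_sum subJ q_lin) => [|k _]; last by case: (xP k) => /wv_J.
  apply: etrans F0; rewrite big_seq [RHS]big_seq.
  by apply: eq_bigr => k ks; rewrite (xP k).2.
rewrite (xP m).2// (window_injective us (fun k _ => (xP k).1) qx0 ms).
exact: (lon0 subJ q_lin).
Qed.

Lemma extended_lattice_sub lam : Lt lam -> exists u (a b : int),
  [/\ L u, lam = u - a%:~R *: alpha & frm u alpha = b%:~R + a%:~R * kappa].
Proof.
move=> Ltl; have Hlam : lspan L lam by rewrite -Lt_H; exact: lspan_sub.
have := exp_highest_weight Lt_va Ltl; rewrite Lt_H => hy.
have [s [F [us sF s_lam s_deg yE]]] := quot_window_lift 0 Hlam hy.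
have JF mu : mu \in s -> J (F mu).
  move=> ms; have [Lmu pF rmu] := sF _ ms.
  apply: (lor_J_highest_weight (mu := mu)) => //; first by case: Lmu => -[].
  exact: pure_vacuum_highest_weight.
have [mu ms F_neq0] : exists2 mu, mu \in s & F mu != 0.
  apply: contrapT => nex; have /eqP := exp_neq0 Lt_va Ltl; apply; rewrite yE.
  rewrite big_seq big1 ?(lon0 subJ q_lin)// => mu ms.
  by apply/eqP/negPn/negP => Fmu; apply: nex; exists mu.
have [Lmu [v [hv FE]] rmu] := sF _ ms; have [[Hmu _] [a [b mu2]]] := Lmu.
have v_U : Comm (Comm (generated_va (lspan L))) v.
  move=> u [k|//] Uu _; have [Ju Uau] := lor_commutant_mem Uu.
  have hu : highest_weight (lspan L) frm idV 0 u by exact/lor_commutantP.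
  pose G nu := nprod (tens T u (vac A)) k%:Z (F nu).
  (* A nonnegative mode of [u] kills [e^lam], and window uniqueness transfers this from the sum of
     the lifted components to each of them. *)
  have G0 : G mu = 0.
    apply: (@quot_window_injective _ 0 s id G) => //.
    - move=> nu ns; have [Lnu [v' [hv' F'E]] rnu] := sF _ ns; split=> //.
      exists (nprod u k%:Z v'); split; last by rewrite /G F'E tens_actl.
      exact: commutant_mode_highest_weight.
    - rewrite -(lfun_sum (va_linr _ _)) quot_nprod// -?yE; last exact: (subspace_sum subJ).
      have Ce : Comm Ua (et lam) by exact: (exp_mem Lt_va).
      exact: Ce.
  move: G0; rewrite /G FE tens_actl => /tens_eq0; apply.
  by apply: (exp_neq0 (ii_lattice A)); case: Lmu.
exists mu.1, a, b; split.
- apply: (lattice_va_weight hH L_even L_va (x := v)) => //.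
  + by rewrite VL_U.
  + by apply: contra_neq F_neq0 => v0; rewrite FE v0 tens0l.
  + exact: highest_weight_weight.
- by rewrite -(s_lam _ ms) mu2 II_vec0E.
- move: rmu; rewrite /lor_form mu2 II_formE (heis_sym hH alpha_H Hmu) /= => /eqP.
  by rewrite addr_eq0 opprK mul1r mulrC => /eqP.
Qed.

Lemma extended_lattice_sup u (a b : int) : L u ->
  frm u alpha = b%:~R + a%:~R * kappa -> Lt (u - a%:~R *: alpha).
Proof.
move=> Lu ua; pose mu : X := (u, II_vec a%:~R b%:~R).
have Hu : lspan L u := lspan_sub Lu.
have mu2 : @II_lattice C mu.2 by exists a, b.
have Lmu : lor_lattice L mu by split; [exact: sub_dual_lattice|].
have pE : pure_vac mu (lor_exp T e mu) by exact: (lor_exp_vacuum _ L_va).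
have hE := pure_vacuum_highest_weight Lmu pE.
have rmu : form rho mu = 0.
  rewrite /lor_form /= II_formE (heis_sym hH alpha_H Hu) ua; ring.
have JE : J (lor_exp T e mu) by exact: (lor_J_highest_weight (mu := mu)).
(* A single vector of degree [a] fits in the window that starts at [a], so its image is nonzero. *)
have qE0 : q (lor_exp T e mu) != 0.
  apply/eqP => q0; have /eqP := lor_exp_neq0 T L_va (mu := mu) Lu mu2; apply.
  apply: (@quot_window_injective _ a [:: tt] (fun=> mu) (fun=> lor_exp T e mu) _ _ _ _ _ tt) => //.
  - by move=> [] [].
  - by exists a; rewrite /= ?II_vec0E//; have := N_gt0; lia.
  - by rewrite big_seq1.
have hVt : heisenberg (lspan Lt) frm hat by rewrite Lt_H; exact: quot_heisenberg.
have Hmu : lspan L (u - a%:~R *: alpha).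
  by apply: (subspaceB (subspace_lspan L)) => //; exact: (subspaceZ (subspace_lspan L)).
have := quot_weight (mu := mu) Hu JE (highest_weight_weight hE).
rewrite /= II_vec0E -Lt_H => wE.
apply: (lattice_va_weight hVt Lt_even Lt_va _ qE0) => //; last by rewrite Lt_H.
(* Elements of [Ua] lift to vacuum vectors with weights multiple of [rho]. These weights are
   orthogonal to [mu], so [e^mu] is regular on the lifts. *)
move=> _ [n|//] /commutant_lift[g [pg ->]] _.
rewrite (lfun_sum (va_linl _ _)) big1// => m _.
have Jg := wv_J (pg m).
rewrite -quot_nprod// annihilate_sym ?(lon0 subJ q_lin)// => i.
apply: (lor_exp_regular hH L_even L_va) => // k.
rewrite (pure_vacuum_highest_weight (wv_lattice m) (pg m)) //.
rewrite /wv (heis_frmZr hT)// (heis_sym hT)// rmu mulr0 scale0r if_same//.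
Qed.

End Conclusion.
End OrderVector.

End Quotient.

Local Open Scope complex_scope.

Theorem theorem3p21 (R : realType) (V : voa R[i])
  (V_sreg : strongly_regular V) (V_hol : holomorphic V) (V_cft : cft_type V)
  (V_c24 : central_charge V = 24) (V1_neq0 : exists2 v, wt V 1 v & v <> 0)
  (A H : set V) (A_cartan : cartan_subalgebra A)
  (H_sub : subspace H) (H_A : H `<=` A)
  (alpha : V) (alpha_H : H alpha)
  (g : V -> V)
  (g_exp : is_exp_op (fun v => (2 * (pi : R)%:C * 'i) *: nprod alpha 0 v) g)
  (N : nat) (g_order : has_order g N)
  (N_gen : generates_Z (eigenvalue_of (fun v => N%:R *: nprod alpha 0 v)))
  (K : int) (K_def : K%:~R = N%:R * voa_form V alpha alpha / 2) :
  let: r := gcdn N `|K|%N in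
  let: N0 := (N %/ r)%N in
  let: K0 := (K %/ r%:Z)%Z in
  let: U := Comm (generated_va H) in
  forall (L : set V) (e : V -> V)
    (L_even : even_lattice (voa_form V) L) (L_H : lspan L = H)
    (L_Comm : lattice_va (voa_form V) L (Comm U) id e)
    (D : coset_decomposition L e (Comm U) U)
    (Pi : II_va R[i]) (T : tensor_va V Pi)
    (Va : quotient_va (lor_J T alpha N K) (lor_P e T alpha N K)),
  let: hat := lor_hat alpha Va in
  let: Ua := Comm (generated_va (hat @` H)) in
  forall (Lt : set V) (et : V -> Va)
    (Lt_even : even_lattice (voa_form V) Lt) (Lt_H : lspan Lt = H)
    (Lt_Comm : lattice_va (voa_form V) Lt (Comm Ua) hat et),
  forall N0alpha_dual : dual_lattice (voa_form V) L (N0%:R *: alpha),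
  [/\ lbar L (N0%:R *: alpha) = L,
      (* an isomorphism of U-modules from the direct sum of the U(m N0 alpha),
         where U acts on V^[alpha] through u |-> u (x) e^(0,0) *)
      exists f : forall m : 'I_r, dec_U D ((m * N0)%:R *: alpha) -> Va,
        [/\ forall m, linear (f m),
            forall m, injective (f m),
            forall m b n w, U b ->
              f m (vact b n w)
              = nprod (quot_map Va (tens T b (vac Pi))) n (f m w)
          & direct_sum_of setT (fun m => range (f m)) Ua]
    & Lt = [set w | exists u (k : int), lbracket L alpha N0 K0 u /\
              w = u + (k%:~R * N0%:R) *: alpha]].
Proof.
move=> L e L_even L_H L_Comm; subst H.
move=> D Pi T Va Lt et Lt_even Lt_H Lt_Comm N0alpha_dual.
set r := gcdn N _ in N0alpha_dual *; set N0 := (N %/ r)%N in N0alpha_dual *.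
set K0 := (K %/ _)%Z.
have N_gt0 : (0 < N)%N by case: g_order.
have r_gt0 : (0 < r)%N by rewrite gcdn_gt0 N_gt0.
have N_def : N = (N0 * r)%N by rewrite divnK// dvdn_gcdl.
have K_defr : K = K0 * r by rewrite divzK// dvdzE /= dvdn_gcdr.
have NK_coprime : coprime N0 `|K0|.
  rewrite /coprime -(eqn_pmul2r r_gt0) mul1n muln_gcdl -N_def.
  by rewrite -[X in (_ * X)%N]/(`|r%:Z|%N) -abszM -K_defr.
have vac0 : vac V != 0.
  case: V1_neq0 => v _ v0; apply/eqP => V0; apply: v0.
  by rewrite -[v](va_vacl (-1)) V0 (lfun0 (va_linl _ _)).
have hH := lattice_va_heisenberg vac0 L_Comm.
have V_span := coset_span D hH L_even (fun h => let: And5 _ _ (conj _ F) _ _ := L_Comm in F h).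
have Nalpha_dual : dual_lattice (voa_form V) L (N%:R *: alpha).
  rewrite N_def mulnC natrM -scalerA.
  exact: (dual_latticeZ hH L_even r%:Z).
have N0a u : L u -> voa_form V u (N0%:R *: alpha) = N0%:R * voa_form V u alpha.
  by move=> /lspan_sub Hu; rewrite (heis_frmZr hH).
have sub := extended_lattice_sub hH L_even L_Comm V_span alpha_H N_gt0 K_def
  Lt_even Lt_H Lt_Comm V_hol.1 erefl Nalpha_dual.
have sup := extended_lattice_sup hH L_even L_Comm V_span alpha_H N_gt0 K_def
  Lt_even Lt_H Lt_Comm V_hol.1 erefl Nalpha_dual N_def K_defr NK_coprime N0alpha_dual.
have kE := kappaE R[i] N_gt0 N_def K_defr.
have lbarE : lbar L (N0%:R *: alpha) = L.
  apply/seteqP; split=> [u []//|u Lu]; split=> //.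
  rewrite (heis_sym hH); [exact: N0alpha_dual.2|exact: lspan_sub|].
  exact: N0alpha_dual.1.
split=> //.
  exact: (commutant_decomposition hH L_even L_Comm V_span alpha_H N_gt0 K_def
    Lt_even Lt_H Lt_Comm V_hol.1 erefl Nalpha_dual N_def K_defr NK_coprime
    N0alpha_dual D).
have N0_gt0 : (0 < N0)%N by move: N_gt0; rewrite N_def muln_gt0 => /andP[].
have N0_neq0 : N0%:R != 0 :> R[i] by rewrite pnatr_eq0 -lt0n.
apply/seteqP; split=> [w /sub[u [a [b [Lu -> ua]]]]|w].
  (* Split [a] into its residue [m] and a multiple of [N0]. Multiplying [<u,alpha> = b + a K0 / N0]
     by [N0] gives the integer [N0 b + a K0], which is congruent to [m K0]. *)
  have N0z : N0%:Z != 0 by rewrite eqz_nat -lt0n.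
  have mE : `|(a %% N0)%Z|%N%:Z = (a %% N0)%Z by rewrite gez0_abs ?modz_ge0.
  exists (u - `|(a %% N0)%Z|%N%:R *: alpha), (- (a %/ N0)%Z); split.
    exists u, `|(a %% N0)%Z|%N, (N0%:Z * b + a * K0); split=> //.
    - by rewrite lbarE.
    - by rewrite -ltz_nat mE ltz_pmod.
    - by rewrite N0a// ua kE intrD !intrM; field.
    - by rewrite mE -modzDml modzMr add0r modzMml.
  rewrite pmulrn mE [in LHS](divz_eq a N0) intrD intrM mulrNz mulNr scalerDl opprD scaleNr.
  by rewrite addrA addrAC.
move=> [_ [k [[u [m [l [[Lu _] mN0 ul lm ->]]]] ->]]].
have [t tE] : exists t : int, l = t * N0 + m%:Z * K0.
  exists ((l - m%:Z * K0) %/ N0)%Z; rewrite divzK ?subrK//.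
  by rewrite -eqz_mod_dvd; apply/eqP.
rewrite (_ : _ + _ = u - (m%:Z - k * N0%:Z)%:~R *: alpha).
  (* Lowering the degree by [k N0] lowers [a kappa] by [k K0], which the last coordinate has to make
     up for. *)
  apply: (sup _ _ (t + k * K0)) => //; apply: (mulfI N0_neq0).
  by rewrite -N0a// ul kE tE !(intrD, intrM, intrB) ; field.
by rewrite intrB intrM scalerBl opprB addrA addrAC.
Qed.
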